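(* Let $n\ge 2$ and let $S^n$ be the unit round sphere. The twistor sections of the Clifford bundle $\mathrm{C}\ell(S^n)$ are exactly the sections of the form $$\sigma=c_1+df_1+d^*(\ast f_2)+\ast c_2,$$ with constants $c_1,c_2\in\mathbb{R}$ and smooth functions $f_1,f_2:S^n\to\mathbb{R}$ such that $\Delta f_i=nf_i$ for $i=1,2$.
   Context: The Clifford bundle $\mathrm{C}\ell(M)$ of a Riemannian $n$-manifold $M$ (convention $X\cdot X=-|X|^2$) is identified, as a vector bundle with metric and connection, with the exterior bundle $\bigoplus_p\Lambda^p(M)$ of differential forms; under this identification Clifford multiplication by a tangent vector $X$ is $X\cdot\varphi=X^\flat\wedge\varphi-\iota_X\varphi$. $\mathrm{C}\ell(M)$ is regarded as a left module over itself with the Levi-Civita-induced connection $\nabla$. Its Dirac operator is $D\sigma=\sum_i e_i\cdot\nabla_{e_i}\sigma$ for a local orthonormal frame $e_1,\dots,e_n$ of $TM$; equivalently $D=d+d^*$, where $d^*$ is the formal adjoint of $d$. A (smooth) section $\sigma$ is a twistor section if $\nabla_X\sigma+\frac1nX\cdot D\sigma=0$ for all $X\in TM$. $\ast$ is the Hodge star operator, determined by $\varphi\wedge\ast\psi=\langle\varphi,\psi\rangle\,\ast1$ with $\ast 1$ the volume form, and $\Delta=dd^*+d^*d$ is the Hodge Laplacian (nonnegative). *)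

(* Defs.v *)
From mathcomp Require Import all_boot all_order all_algebra.
From mathcomp Require Import all_classical all_reals all_analysis.

Set Implicit Arguments.
Unset Strict Implicit.
Unset Printing Implicit Defensive.

Import Order.TTheory GRing.Theory Num.Theory.
Import numFieldNormedType.Exports.

Local Open Scope classical_set_scope.
Local Open Scope ring_scope.

(** S^n is the unit sphere of the Euclidean space R^(n+1);
    T_x S^n is the orthogonal complement of x.  Objects on S^n are represented
    by functions on R^(n+1) of which only the values on S^n are ever used. *)

Section Euclidean.
Context {R : realType} {n : nat}.
Implicit Types x y v : 'rV[R]_n.+1.

Definition dot x y : R := \sum_i x 0 i * y 0 i.

Definition sphere : set 'rV[R]_n.+1 := [set x | dot x x = 1].

Definition tangent_vector x v := dot x v = 0.

(* The rows of e form an orthonormal basis of T_x S^n (there are n of them). *)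
Definition tangent_frame x (e : 'M[R]_(n, n.+1)) :=
  (forall i, tangent_vector x (row i e)) /\
  (forall i j, dot (row i e) (row j e) = (i == j)%:R).

Definition retraction x : 'rV[R]_n.+1 := (Num.sqrt (dot x x))^-1 *: x.

Fixpoint iter_derive (vs : seq 'rV[R]_n.+1) (F : 'rV[R]_n.+1 -> R^o) :
    'rV[R]_n.+1 -> R^o :=
  if vs is v :: vs' then fun x => 'D_v (iter_derive vs' F) x else F.

(* C^infinity on an open set: every iterated directional derivative is Frechet
   differentiable, hence continuous. *)
Definition smooth_on (U : set 'rV[R]_n.+1) (F : 'rV[R]_n.+1 -> R^o) :=
  forall vs x, U x -> differentiable (iter_derive vs F) x.

Definition smooth_function (f : 'rV[R]_n.+1 -> R) :=
  forall p, sphere p -> exists (U : set 'rV[R]_n.+1) (F : 'rV[R]_n.+1 -> R),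
    [/\ open U, U p, smooth_on U F & forall x, U x -> sphere x -> F x = f x].

End Euclidean.

(** The exterior algebra of R^(n+1), in the orthonormal basis
    e_I = e_(i_1) /\ ... /\ e_(i_p), I = {i_1 < ... < i_p}; vectors and
    covectors are identified by the metric. *)

Definition extalg (R : realType) (n : nat) := {ffun {set 'I_n.+1} -> R^o}.

Section ExteriorAlgebra.
Context {R : realType} {n : nat}.
Implicit Types (x v : 'rV[R]_n.+1) (a b : extalg R n) (I J : {set 'I_n.+1}).

Definition scalar (c : R) : extalg R n :=
  [ffun I => if I == finset.set0 then c else 0].

Definition flat v : extalg R n := [ffun I => \sum_(i | I == [set i]%SET) v 0 i].

(* e_I /\ e_J = shuffle_sign I J e_(I u J) for disjoint I, J *)
Definition shuffle_sign I J : R :=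
  (-1) ^+ #|[set ij in finset.setX I J | (ij.2 < ij.1)%N]%SET|.

Definition wedge a b : extalg R n :=
  [ffun K : {set 'I_n.+1} => \sum_(I : {set 'I_n.+1} | I \subset K)
     shuffle_sign I (K :\: I)%SET * a I * b (K :\: I)%SET].

Definition interior v a : extalg R n :=
  [ffun I : {set 'I_n.+1} => \sum_(i | i \notin I)
     (-1) ^+ #|[set j in I | (j < i)%N]%SET| * v 0 i * a (i |: I)%SET].

Definition inner a b : R := \sum_I a I * b I.

Definition degree_part (p : nat) a : extalg R n :=
  [ffun I : {set 'I_n.+1} => if #|I| == p then a I else 0].

(* Lambda (T_x S^n), as a subspace of Lambda (R^(n+1)) *)
Definition tangential x a := interior x a = 0.

(* For |x| = 1, the orthogonal projection of Lambda (R^(n+1)) onto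
   Lambda (T_x S^n), i.e., the pullback of forms along T_x S^n -> R^(n+1). *)
Definition tangential_part x a : extalg R n := interior x (wedge (flat x) a).

Definition clifford v a : extalg R n := wedge (flat v) a - interior v a.

(* The volume form of S^n at x, for the orientation by the outward normal. *)
Definition volume_form x : extalg R n :=
  interior x [ffun I => if I == [set: 'I_n.+1]%SET then 1 else 0].

(* The Hodge star of Lambda (T_x S^n), through its defining property
   phi /\ *psi = <phi, psi> *1, for phi of pure degree p. *)
Definition is_hodge x (psi chi : extalg R n) :=
  tangential x chi /\
  forall (p : nat) (phi : extalg R n), (p <= n)%N ->
    tangential x phi -> degree_part p phi = phi ->
    wedge phi (degree_part (n - p) chi) = inner phi psi *: volume_form x.

Definition hodge x psi : extalg R n := xget 0 [set chi | is_hodge x psi chi].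

End ExteriorAlgebra.

(** The Riemannian measure of S^n, as a Borel measure on R^(n+1). *)

Definition borel_space (R : realType) (n : nat) :=
  g_sigma_algebraType (@open 'rV[R]_n.+1).

(* The finite nonzero Borel measures carried by S^n and invariant under O(n+1)
   are exactly the positive multiples of the Riemannian measure of S^n; the
   formal adjoint of d does not depend on the multiple. *)
Definition riemannian_measure (R : realType) (n : nat)
    (mu : {measure set (borel_space R n) -> \bar R}) :=
  [/\ mu (~` sphere) = 0%E,
      (0 < mu sphere)%E, (mu sphere < +oo)%E &
      forall g : 'M[R]_n.+1, g *m g^T = 1%:M ->
        forall A : set (borel_space R n), measurable A ->
          mu [set x : 'rV[R]_n.+1 | A (x *m g)] = mu A].

Section CliffordBundle.
Context {R : realType} {n : nat}.
Implicit Types (x v : 'rV[R]_n.+1) (f : 'rV[R]_n.+1 -> R).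
Implicit Types sigma phi psi eta : 'rV[R]_n.+1 -> extalg R n.

Definition smooth_section sigma :=
  (forall x, sphere x -> tangential x (sigma x)) /\
  (forall I, smooth_function (fun x => sigma x I)).

(* Componentwise derivative at x of the extension of sigma that is constant
   along rays; for x in S^n and v tangent at x it is the derivative of sigma
   along any curve in S^n with velocity v. *)
Definition flat_derivative v sigma x : extalg R n :=
  [ffun I => 'D_v (fun y => sigma (retraction y) I : R^o) x].

(* Levi-Civita connection: tangential part of the flat derivative. *)
Definition nabla v sigma x : extalg R n :=
  tangential_part x (flat_derivative v sigma x).

(* D sigma at x, computed in the orthonormal frame e of T_x S^n *)
Definition dirac (e : 'M[R]_(n, n.+1)) sigma x : extalg R n :=
  \sum_(i < n) clifford (row i e) (nabla (row i e) sigma x).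

Definition twistor_section sigma :=
  smooth_section sigma /\
  forall x (e : 'M[R]_(n, n.+1)) v,
    sphere x -> tangent_frame x e -> tangent_vector x v ->
    nabla v sigma x + n%:R^-1 *: clifford v (dirac e sigma x) = 0.

(* Exterior derivative: pullback to S^n of the exterior derivative
   sum_k dx_k /\ d_k of an extension of sigma to R^(n+1) \ {0}. *)
Definition ext_d sigma x : extalg R n :=
  tangential_part x
    (\sum_(k < n.+1)
       wedge (flat (delta_mx 0 k)) (flat_derivative (delta_mx 0 k) sigma x)).

Section Codifferential.
Variable mu : {measure set (borel_space R n) -> \bar R}.

(* The formal adjoint of d, i.e., the operator such that
   int <d phi, psi> = int <phi, d^* psi> for all smooth forms phi. *)
Definition is_codiff psi eta :=
  smooth_section eta /\
  forall phi, smooth_section phi ->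
    \int[mu]_(x in sphere) inner (ext_d phi x) (psi x) =
    \int[mu]_(x in sphere) inner (phi x) (eta x).

Definition codiff psi : 'rV[R]_n.+1 -> extalg R n :=
  xget (fun=> 0) [set eta | is_codiff psi eta].

Definition hodge_laplacian phi x : extalg R n :=
  ext_d (codiff phi) x + codiff (ext_d phi) x.

End Codifferential.

Definition function_form f x : extalg R n := scalar (f x).

Definition hodge_star psi x : extalg R n := hodge x (psi x).

End CliffordBundle.

(* Main.v *)
(* Extend forms on S^n to R^(n+1) \ {0} with components constant along rays; the
   twistor equation of s becomes a formula for the partial derivatives of s in
   terms of s and the potential t = D s / n.  It yields d s = N t and
   d^* s = (n - N) t, with N the degree operator, and since d^2 = 0 these are
   orthogonal in L^2, so t = h + g vol with functions h and g.  Commuting the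
   derivatives of s then shows that the interior products of
   s - grad h + iota_(grad g) vol have pure degree n - 1, so that
   s = u_0 + grad h - iota_(grad g) vol + u_1 vol with functions u_0 and u_1.
   Comparing degrees in d s = n g vol and d^* s = n h gives Delta h = n h,
   Delta g = n g and the constancy of u_0 and u_1.  Conversely, the Hessian of a
   function f with Delta f = n f is - f times the metric: by Bochner's argument
   in elementary form, the partial derivatives of the degree one homogeneous
   extension of f are harmonic on S^n, hence constant. *)

From HB Require Import structures.
Require Import Defs.
From mathcomp Require Import all_boot all_order all_algebra.
From mathcomp Require Import all_classical all_reals all_analysis.
From mathcomp Require Import measurable_realfun ring lra zify.

Set Implicit Arguments.
Unset Strict Implicit.
Unset Printing Implicit Defensive.

Import Order.TTheory GRing.Theory Num.Theory.
Import numFieldNormedType.Exports.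

Local Open Scope classical_set_scope.
Local Open Scope ring_scope.

(** * The exterior algebra *)

(** [codiff] and [hodge] are picked by a choice operator from their defining properties, so nothing
    can be said about them before existence and uniqueness are settled. For [codiff] both rest on
    the invariance of [mu] alone: differentiating an integral along rotations takes the place of
    Stokes' theorem, and transitivity of the orthogonal group shows that a nonnegative smooth
    function with integral zero vanishes on the sphere. The partial derivatives of ray-constant
    extensions do not commute; the commutator of d_l and d_k is x_l d_k - x_k d_l. It turns a second
    derivative of s into an undifferentiated interior product of s, which is how an algebraic
    equation for s arises. The remaining work is algebra of the operators [eps k] and [iota k] of
    the ambient basis, with N = sum_k eps_k iota_k, and the tangential projection removes every term
    with a factor x. The bound n >= 2 enters through n - 1 != 0: it separates the degrees 0 and n -
    1, and the degrees 1 and n, when the equations for d s and d^* s are split by degree. *)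

Section ExteriorOperators.
Context {R : realType} {n : nat}.
Local Notation interior := Defs.interior.
Local Notation scalar := Defs.scalar.
Implicit Types (x v w : 'rV[R]_n.+1) (a b : extalg R n) (I J K : {set 'I_n.+1}).
Implicit Types i j k : 'I_n.+1.

(** The sign of moving e_i into its place among the factors of e_I. The strict comparison ignores i
    itself, so one sign serves both for inserting i into a set and for removing it. *)
Definition koszul_sign i I : R := (-1) ^+ #|[set j in I | (j < i)%N]%SET|.

Lemma koszul_sign_sqr i I : koszul_sign i I * koszul_sign i I = 1.
Proof. by rewrite /koszul_sign -expr2 sqrr_sign. Qed.

Lemma koszul_signU1 i j I : j \notin I ->
  koszul_sign i (j |: I)%SET = (-1) ^+ (j < i)%N * koszul_sign i I.
Proof.
move=> jI; rewrite /koszul_sign -exprD; congr (_ ^+ _).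
have -> : [set k in (j |: I)%SET | (k < i)%N]%SET =
   (if (j < i)%N then j |: [set k in I | (k < i)%N] else [set k in I | (k < i)%N])%SET.
  apply/setP => k; case: ifP => ji; rewrite !inE; case: (k =P j) => [->|]//=;
  by rewrite ?ji ?(negbTE jI).
by case: ifP => ji; rewrite ?cardsU1 ?inE ?(negbTE jI).
Qed.

Lemma koszul_signD1 i j I : j \in I ->
  koszul_sign i (I :\ j)%SET = (-1) ^+ (j < i)%N * koszul_sign i I.
Proof.
move=> jI; rewrite -[in RHS](finset.setD1K jI) koszul_signU1 ?finset.setD11//.
by rewrite mulrA -expr2 sqrr_sign mul1r.
Qed.

Lemma koszul_sign_swap i j : i != j ->
  (-1) ^+ (j < i)%N = - (-1) ^+ (i < j)%N :> R.
Proof.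
move=> ij; case: (ltngtP i j) => [ | |/val_inj/eqP] /=; last by rewrite (negbTE ij).
- by rewrite expr0 expr1 opprK.
- by rewrite expr0 expr1.
Qed.

Lemma wedge_flatE v a K : wedge (flat v) a K =
  \sum_(i in K) v 0 i * (koszul_sign i K * a (K :\ i)%SET).
Proof.
rewrite ffunE.
under eq_bigr => I _ do rewrite ffunE -mulrA mulrCA mulr_suml.
rewrite (exchange_big_dep predT)//= [RHS]big_mkcond/=.
apply: eq_bigr => i _; case: ifPn => iK; last first.
  rewrite big_pred0// => I; apply/negbTE/negP => /andP[IK /eqP IE].
  by move: IK; rewrite IE finset.sub1set (negbTE iK).
rewrite (big_pred1 [set i]%SET) => [|I]; last first.
  rewrite /= andbC; case: eqP => //= ->; by rewrite finset.sub1set.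
congr (_ * (_ * _)); rewrite /shuffle_sign /koszul_sign; congr (_ ^+ _).
(* The inversions of the shuffle of {i} with K \ {i} are the pairs (i, q) with q in K below i. *)
have pinj : injective (pair i : 'I_n.+1 -> 'I_n.+1 * 'I_n.+1) by move=> ? ? [].
rewrite -(card_imset _ pinj); apply: eq_card => -[p q].
rewrite !inE /=; apply/idP/imsetP => [/andP[/and3P[/eqP -> qi qK] qlt]|].
  by exists q; rewrite // inE qK.
move=> [r]; rewrite inE => /andP[rK ri] [-> ->]; rewrite eqxx rK ri /= !andbT.
by apply: contraTneq ri => ->; rewrite ltnn.
Qed.

Lemma interiorE v a I : interior v a I =
  \sum_(i | i \notin I) v 0 i * (koszul_sign i I * a (i |: I)%SET).
Proof.
by rewrite ffunE; apply: eq_bigr => i _; rewrite -mulrA mulrCA.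
Qed.

Lemma wedge_is_linear a : linear (wedge a).
Proof.
move=> c b1 b2; apply/ffunP => K; rewrite !ffunE /= /GRing.scale/= mulr_sumr -big_split /=.
by apply: eq_bigr => I _; rewrite !ffunE mulrDr mulrCA.
Qed.

Lemma interior_is_linear v : linear (interior v).
Proof.
move=> c b1 b2; apply/ffunP => K; rewrite !ffunE /= /GRing.scale/= mulr_sumr -big_split /=.
by apply: eq_bigr => I _; rewrite !ffunE mulrDr mulrCA.
Qed.

HB.instance Definition _ a :=
  GRing.isLinear.Build R (extalg R n) (extalg R n) _ (wedge a) (wedge_is_linear a).
HB.instance Definition _ v :=
  GRing.isLinear.Build R (extalg R n) (extalg R n) _ (interior v) (interior_is_linear v).

Lemma wedgel_is_linear b : linear (wedge^~ b).
Proof.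
move=> c a1 a2; apply/ffunP => K; rewrite !ffunE /= /GRing.scale/= mulr_sumr -big_split /=.
by apply: eq_bigr => I _; rewrite !ffunE mulrDr mulrDl; congr (_ + _); rewrite /GRing.scale/=; ring.
Qed.

Lemma extZE c a I : (c *: a) I = c * a I. Proof. by rewrite ffunE. Qed.
Lemma extDE a b I : (a + b) I = a I + b I. Proof. by rewrite ffunE. Qed.
Lemma extNE a I : (- a) I = - a I. Proof. by rewrite ffunE. Qed.
Lemma ext0E I : (0 : extalg R n) I = 0. Proof. by rewrite ffunE. Qed.
Definition extE := (extZE, extDE, extNE, ext0E).

Lemma row_delta_sum v : v = \sum_k v 0 k *: delta_mx 0 k.
Proof. by rewrite [LHS]row_sum_delta. Qed.

(** Creation and annihilation operators of the ambient basis. Identities for [wedge (flat v)] and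
    [interior v] are proved for these and extended by linearity in v. *)
Definition eps k a : extalg R n := wedge (flat (delta_mx 0 k)) a.
Definition iota k a : extalg R n := interior (delta_mx 0 k) a.
HB.instance Definition _ k :=
  GRing.isLinear.Build R (extalg R n) (extalg R n) _ (eps k) (wedge_is_linear _).
HB.instance Definition _ k :=
  GRing.isLinear.Build R (extalg R n) (extalg R n) _ (iota k) (interior_is_linear _).

Lemma epsD k a b : eps k (a + b) = eps k a + eps k b. Proof. exact: raddfD. Qed.
Lemma epsB k a b : eps k (a - b) = eps k a - eps k b. Proof. exact: raddfB. Qed.
Lemma epsN k a : eps k (- a) = - eps k a. Proof. exact: raddfN. Qed.
Lemma eps0 k : eps k 0 = 0. Proof. exact: raddf0. Qed.
Lemma epsZ k c a : eps k (c *: a) = c *: eps k a. Proof. exact: linearZ. Qed.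

Lemma iotaD k a b : iota k (a + b) = iota k a + iota k b. Proof. exact: raddfD. Qed.
Lemma iotaB k a b : iota k (a - b) = iota k a - iota k b. Proof. exact: raddfB. Qed.
Lemma iotaN k a : iota k (- a) = - iota k a. Proof. exact: raddfN. Qed.
Lemma iota0 k : iota k 0 = 0. Proof. exact: raddf0. Qed.
Lemma iotaZ k c a : iota k (c *: a) = c *: iota k a. Proof. exact: linearZ. Qed.

Lemma interiorD v a b : interior v (a + b) = interior v a + interior v b. Proof. exact: raddfD. Qed.
Lemma interiorB v a b : interior v (a - b) = interior v a - interior v b. Proof. exact: raddfB. Qed.
Lemma interior0 v : interior v 0 = 0. Proof. exact: raddf0. Qed.
Lemma interiorZ v c a : interior v (c *: a) = c *: interior v a. Proof. exact: linearZ. Qed.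

Lemma wedgeD a0 a b : wedge a0 (a + b) = wedge a0 a + wedge a0 b. Proof. exact: raddfD. Qed.
Lemma wedgeB a0 a b : wedge a0 (a - b) = wedge a0 a - wedge a0 b. Proof. exact: raddfB. Qed.
Lemma wedgeN a0 a : wedge a0 (- a) = - wedge a0 a. Proof. exact: raddfN. Qed.
Lemma wedge0 a0 : wedge a0 0 = 0. Proof. exact: raddf0. Qed.
Lemma wedgeZ a0 c a : wedge a0 (c *: a) = c *: wedge a0 a. Proof. exact: linearZ. Qed.

Lemma eps_sumr k (T : finType) (P : pred T) F :
  eps k (\sum_(t | P t) F t) = \sum_(t | P t) eps k (F t).
Proof. exact: raddf_sum. Qed.
Lemma iota_sumr k (T : finType) (P : pred T) F :
  iota k (\sum_(t | P t) F t) = \sum_(t | P t) iota k (F t).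
Proof. exact: raddf_sum. Qed.
Lemma interior_sumr v (T : finType) (P : pred T) F :
  interior v (\sum_(t | P t) F t) = \sum_(t | P t) interior v (F t).
Proof. exact: raddf_sum. Qed.
Lemma wedge_sumr a0 (T : finType) (P : pred T) F :
  wedge a0 (\sum_(t | P t) F t) = \sum_(t | P t) wedge a0 (F t).
Proof. exact: raddf_sum. Qed.

Lemma epsE k a I : eps k a I = if k \in I then koszul_sign k I * a (I :\ k)%SET else 0.
Proof.
rewrite wedge_flatE; case: ifPn => kI.
  rewrite (bigD1 k)//= big1 ?addr0; last first.
    by move=> i /andP[_ ik]; rewrite mxE eqxx/= (negbTE ik) mul0r.
  by rewrite mxE !eqxx mul1r.
rewrite big1 // => i iI; rewrite mxE eqxx/=; case: eqP => [ik|]; last by rewrite mul0r.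
by rewrite -ik iI in kI.
Qed.

Lemma iotaE k a I : iota k a I = if k \in I then 0 else koszul_sign k I * a (k |: I)%SET.
Proof.
rewrite interiorE; case: ifPn => kI.
rewrite big1 // => i iI; rewrite mxE eqxx/=; case: eqP => [ik|]; last by rewrite mul0r.
  by rewrite ik kI in iI.
rewrite (bigD1 k)//= big1 ?addr0; last first.
    by move=> i /andP[_ ik]; rewrite mxE eqxx/= (negbTE ik) mul0r.
by rewrite mxE !eqxx mul1r.
Qed.

Lemma wedge_flat_sum v a : wedge (flat v) a = \sum_k v 0 k *: eps k a.
Proof.
apply/ffunP => K; rewrite wedge_flatE sum_ffunE big_mkcond; apply: eq_bigr => i _.
by rewrite extZE epsE; case: ifP => // _; rewrite mulr0.
Qed.

Lemma interior_sum v a : interior v a = \sum_k v 0 k *: iota k a.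
Proof.
apply/ffunP => K; rewrite interiorE sum_ffunE big_mkcond; apply: eq_bigr => i _.
by rewrite extZE iotaE; case: (i \in K); rewrite //= mulr0.
Qed.

Lemma iota_anticomm i j a : iota i (iota j a) = - iota j (iota i a).
Proof.
apply/ffunP => I; rewrite extNE !iotaE !finset.in_setU1.
have [<-|ij] := eqVneq i j; first by rewrite /=; case: ifP; rewrite ?mulr0 oppr0.
rewrite /=; case: ifPn => iI; case: ifPn => jI; rewrite /= ?mulr0 ?oppr0//.
rewrite !koszul_signU1// (finset.setUCA [set i]%SET) (koszul_sign_swap ij).
by ring.
Qed.

Lemma iota_iota k a : iota k (iota k a) = 0.
Proof.
by apply/ffunP => I; rewrite !iotaE ext0E finset.setU11 mulr0 if_same.
Qed.

(** The canonical anticommutation relation. For i = j exactly one of the two products survives at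
    each I, with squared sign 1; for i != j the two orders differ by the sign in
    [koszul_sign_swap]. *)
Lemma eps_iota i j a : eps i (iota j a) = (i == j)%:R *: a - iota j (eps i a).
Proof.
apply/ffunP => I; rewrite !extE epsE !iotaE epsE !finset.in_setU1 !finset.in_setD1.
have [<-|ij] := eqVneq i j.
  rewrite mul1r/=; case: ifPn => iI.
    rewrite subr0 koszul_signD1// ltnn expr0 mul1r mulrA koszul_sign_sqr mul1r.
    by rewrite finset.setD1K.
  rewrite koszul_signU1// ltnn expr0 mul1r mulrA koszul_sign_sqr mul1r.
  by rewrite finset.setU1K// subrr.
rewrite mul0r sub0r /=; case: ifPn => iI; case: ifPn => jI; rewrite /= ?mulr0 ?oppr0//.
rewrite koszul_signU1// koszul_signD1// (koszul_sign_swap ij).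
have -> : ((j |: I) :\ i = j |: (I :\ i))%SET.
  apply/setP => k; by rewrite !inE; case: (k =P j) => [->|]//=; rewrite eq_sym ij.
by ring.
Qed.

Lemma eps_anticomm i j a : eps i (eps j a) = - eps j (eps i a).
Proof.
apply/ffunP => I; rewrite extNE !epsE !finset.in_setD1.
have [<-|ij] := eqVneq i j; first by rewrite /=; case: ifP; rewrite ?mulr0 oppr0.
rewrite /=; case: ifPn => iI; case: ifPn => jI; rewrite /= ?mulr0 ?oppr0//.
rewrite !koszul_signD1// (koszul_sign_swap ij) finset.setDDl finset.setUC -finset.setDDl.
by ring.
Qed.

Lemma eps_eps k a : eps k (eps k a) = 0.
Proof.
by apply/ffunP => I; rewrite !epsE ext0E finset.setD11 mulr0 if_same.
Qed.

(** * Degree operator, inner product and tangential projection *)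

Definition grading a : extalg R n := [ffun I : {set 'I_n.+1} => #|I|%:R * a I].

Lemma sum_eps_iota a : \sum_k eps k (iota k a) = grading a.
Proof.
apply/ffunP => I; rewrite sum_ffunE ffunE.
rewrite (eq_bigr (fun k => if k \in I then a I else 0)).
  by rewrite -big_mkcond/= sumr_const mulr_natl.
move=> k _; rewrite epsE; case: ifPn => // kI.
rewrite iotaE finset.setD11 koszul_signD1// ltnn mul1r mulrA koszul_sign_sqr mul1r.
by rewrite finset.setD1K.
Qed.

Lemma sum_iota_eps a : \sum_k iota k (eps k a) = n.+1%:R *: a - grading a.
Proof.
rewrite -sum_eps_iota; apply/eqP; rewrite -subr_eq0 opprB addrA -big_split/=.
rewrite subr_eq0; apply/eqP.
rewrite (eq_bigr (fun=> a)); last by move=> k _; rewrite eps_iota eqxx scale1r addrC subrK.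
by rewrite sumr_const card_ord scaler_nat.
Qed.

Lemma wedge_interior v w a :
  wedge (flat v) (interior w a) = dot v w *: a - interior w (wedge (flat v) a).
Proof.
rewrite (interior_sum w a) wedge_flat_sum (wedge_flat_sum v a) (interior_sum w).
rewrite /dot scaler_suml -sumrB.
under eq_bigr => i _.
  rewrite eps_sumr scaler_sumr.
  under eq_bigr => j _ do rewrite epsZ eps_iota scalerBr scalerBr.
  rewrite sumrB (bigD1 i)//= big1 ?addr0; last first.
    by move=> j ji; rewrite eq_sym (negbTE ji) scale0r !scaler0.
  rewrite eqxx scale1r scalerA.
  over.
rewrite !sumrB; congr (_ - _).
rewrite exchange_big; apply: eq_bigr => j _ /=.
rewrite iota_sumr scaler_sumr; apply: eq_bigr => i _.
by rewrite iotaZ !scalerA mulrC.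
Qed.

Lemma interior_anticomm v w a : interior v (interior w a) = - interior w (interior v a).
Proof.
rewrite !(interior_sum w) !(interior_sum v) -sumrN.
under eq_bigr => i _ do rewrite iota_sumr scaler_sumr.
rewrite exchange_big; apply: eq_bigr => j _ /=.
rewrite iota_sumr scaler_sumr -sumrN; apply: eq_bigr => i _.
by rewrite !iotaZ iota_anticomm !scalerN !scalerA mulrC.
Qed.

Lemma interior_interior v a : interior v (interior v a) = 0.
Proof.
have /eqP := interior_anticomm v v a; rewrite -addr_eq0 -mulr2n -scaler_nat.
by rewrite scaler_eq0 pnatr_eq0/= => /eqP.
Qed.

Lemma wedge_anticomm v w a :
  wedge (flat v) (wedge (flat w) a) = - wedge (flat w) (wedge (flat v) a).
Proof.
rewrite !(wedge_flat_sum w) !(wedge_flat_sum v) -sumrN.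
under eq_bigr => i _ do rewrite eps_sumr scaler_sumr.
rewrite exchange_big; apply: eq_bigr => j _ /=.
rewrite eps_sumr scaler_sumr -sumrN; apply: eq_bigr => i _.
by rewrite !epsZ eps_anticomm !scalerN !scalerA mulrC.
Qed.

Lemma wedge_wedge v a : wedge (flat v) (wedge (flat v) a) = 0.
Proof.
have /eqP := wedge_anticomm v v a; rewrite -addr_eq0 -mulr2n -scaler_nat.
by rewrite scaler_eq0 pnatr_eq0/= => /eqP.
Qed.

Lemma innerC a b : inner a b = inner b a.
Proof. by apply: eq_bigr => I _; rewrite mulrC. Qed.

Lemma innerDl a1 a2 b : inner (a1 + a2) b = inner a1 b + inner a2 b.
Proof. by rewrite -big_split; apply: eq_bigr => I _; rewrite extDE mulrDl. Qed.

Lemma innerZl c a b : inner (c *: a) b = c * inner a b.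
Proof. by rewrite mulr_sumr; apply: eq_bigr => I _; rewrite extZE mulrA. Qed.

Lemma innerDr a b1 b2 : inner a (b1 + b2) = inner a b1 + inner a b2.
Proof. by rewrite !(innerC a) innerDl. Qed.

Lemma innerZr c a b : inner a (c *: b) = c * inner a b.
Proof. by rewrite !(innerC a) innerZl. Qed.

Lemma inner0l b : inner 0 b = 0.
Proof. by rewrite -(scale0r 0) innerZl mul0r. Qed.

Lemma innerNr a b : inner a (- b) = - inner a b.
Proof. by rewrite -scaleN1r innerZr mulN1r. Qed.

Lemma inner_suml (T : finType) (F : T -> extalg R n) b :
  inner (\sum_t F t) b = \sum_t inner (F t) b.
Proof. exact: (big_morph (inner^~ b) (fun a1 a2 => innerDl a1 a2 b) (inner0l b)). Qed.

Lemma inner_sumr (T : finType) (F : T -> extalg R n) b :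
  inner b (\sum_t F t) = \sum_t inner b (F t).
Proof. by rewrite innerC inner_suml; apply: eq_bigr => t _; rewrite innerC. Qed.

Lemma inner_ge0 a : 0 <= inner a a.
Proof. by apply: sumr_ge0 => I _; rewrite -expr2 sqr_ge0. Qed.

Lemma inner_eq0 a : inner a a = 0 -> a = 0.
Proof.
move=> a0; apply/ffunP => I; rewrite ext0E; apply/eqP; rewrite -sqrf_eq0 expr2; apply/eqP.
by apply: (psumr_eq0P _ a0) => // J _; rewrite -expr2 sqr_ge0.
Qed.

(** Inserting and removing k match the sets without k with the sets containing k, and both operators
    carry the same sign there. *)
Lemma inner_eps k a b : inner (eps k a) b = inner a (iota k b).
Proof.
rewrite /inner.
under eq_bigr => I _ do rewrite epsE (fun_if (fun y => y * b I)) mul0r.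
under [RHS]eq_bigr => I _ do rewrite iotaE (fun_if (fun y => a I * y)) mulr0 -if_neg.
rewrite -!big_mkcond/= (reindex_onto (fun I => k |: I)%SET (fun I => I :\ k)%SET)/=; last first.
  by move=> I kI; rewrite finset.setD1K.
apply: eq_big => [I|I]; last first.
  case/andP => _ /eqP kI; rewrite kI koszul_signU1; last first.
    by rewrite -kI finset.setD11.
  by rewrite ltnn; ring.
rewrite finset.setU11/=; apply/eqP/idP => [<-|kI]; first by rewrite finset.setD11.
by rewrite finset.setU1K.
Qed.

Lemma inner_wedge v a b : inner (wedge (flat v) a) b = inner a (interior v b).
Proof.
rewrite wedge_flat_sum interior_sum inner_suml inner_sumr.
by apply: eq_bigr => k _; rewrite innerZl innerZr inner_eps.
Qed.

Lemma tangential_part_is_linear x : linear (tangential_part x).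
Proof. by move=> c a b; rewrite /tangential_part !linearP. Qed.
HB.instance Definition _ x := GRing.isLinear.Build R (extalg R n) (extalg R n) _
  (tangential_part x) (tangential_part_is_linear x).

Lemma tangential_tangential_part x a : tangential x (tangential_part x a).
Proof. exact: interior_interior. Qed.

Lemma tangential_partE x a : sphere x ->
  tangential_part x a = a - wedge (flat x) (interior x a).
Proof.
by rewrite /sphere/= => x1; rewrite wedge_interior x1 scale1r opprB addrC subrK.
Qed.

Lemma tangential_part_id x a : sphere x -> tangential x a -> tangential_part x a = a.
Proof. by move=> Sx ax; rewrite tangential_partE// ax linear0 subr0. Qed.

Lemma tangential_part_wedge x a : tangential_part x (wedge (flat x) a) = 0.
Proof. by rewrite /tangential_part wedge_wedge linear0. Qed.

Lemma inner_tangential_part x a b :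
  inner (tangential_part x a) b = inner a (tangential_part x b).
Proof.
by rewrite [LHS]innerC -inner_wedge -!inner_wedge innerC inner_wedge.
Qed.

Lemma gradingD a b : grading (a + b) = grading a + grading b.
Proof. by apply/ffunP => I; rewrite !ffunE mulrDr. Qed.

Lemma gradingZ c a : grading (c *: a) = c *: grading a.
Proof. by apply/ffunP => I; rewrite !ffunE /GRing.scale/= mulrCA. Qed.

Lemma grading0 : grading 0 = 0.
Proof. by apply/ffunP => I; rewrite !ffunE mulr0. Qed.

Lemma gradingE a I : grading a I = #|I|%:R * a I.
Proof. by rewrite ffunE. Qed.

Lemma grading_iota k a : grading (iota k a) = iota k (grading a - a).
Proof.
apply/ffunP => I; rewrite gradingE !iotaE; case: ifPn => kI; first by rewrite mulr0.
by rewrite !extE gradingE cardsU1 kI add1n -natr1; ring.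
Qed.

Lemma grading_eps k a : grading (eps k a) = eps k (grading a + a).
Proof.
apply/ffunP => I; rewrite gradingE !epsE; case: ifPn => kI; last by rewrite mulr0.
by rewrite !extE gradingE (cardsD1 k I) kI add1n -natr1; ring.
Qed.

Definition top_form : extalg R n := [ffun I => if I == [set: 'I_n.+1]%SET then 1 else 0].

Lemma eps_top k : eps k top_form = 0.
Proof.
apply/ffunP => I; rewrite epsE ext0E ffunE; case: ifP => // kI.
case: eqP => [E|]; last by rewrite mulr0.
by have := finset.setD11 k I; rewrite E inE.
Qed.

Lemma wedge_top v : wedge (flat v) top_form = 0.
Proof. by rewrite wedge_flat_sum big1 // => k _; rewrite eps_top scaler0. Qed.

Lemma volume_formE x : volume_form x = interior x top_form. Proof. by []. Qed.

Lemma grading_top : grading top_form = n.+1%:R *: top_form.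
Proof.
apply/ffunP => I; rewrite gradingE extZE ffunE; case: eqP => [->|]; last by rewrite !mulr0.
by rewrite finset.cardsT card_ord.
Qed.

Lemma iota_scalar k c : iota k (scalar c) = 0.
Proof.
apply/ffunP => I; rewrite iotaE ext0E; case: ifP => // _; rewrite ffunE.
by case: eqP => [E|]; rewrite ?mulr0//; have := finset.setU11 k I; rewrite E inE.
Qed.

Lemma interior_scalar v c : interior v (scalar c) = 0.
Proof. by rewrite interior_sum big1 // => k _; rewrite iota_scalar scaler0. Qed.

Lemma scalarE c : scalar c = c *: scalar 1 :> extalg R n.
Proof. by apply/ffunP => I; rewrite extZE !ffunE; case: ifP; rewrite ?mulr1 ?mulr0. Qed.

Lemma grading_scalar c : grading (scalar c) = 0.
Proof.
apply/ffunP => I; rewrite gradingE ext0E ffunE; case: eqP => [->|]; last by rewrite mulr0.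
by rewrite cards0 mul0r.
Qed.

(** * Exterior products of general forms and the Hodge star of a function *)

Lemma koszul_signE i I : koszul_sign i I = \prod_(j in I) (-1) ^+ (j < i)%N.
Proof.
rewrite /koszul_sign -sum1_card; under eq_bigl => j do rewrite inE.
rewrite big_mkcondr/= expr_sum; apply: eq_bigr => j _.
by case: (j < i)%N.
Qed.

Lemma koszul_signU i I J : (I :&: J = finset.set0)%SET ->
  koszul_sign i (I :|: J)%SET = koszul_sign i I * koszul_sign i J.
Proof. by move=> /eqP; rewrite finset.setI_eq0 => IJ; rewrite !koszul_signE -bigU//=; apply: eq_bigl => j; rewrite !inE. Qed.

(** As products over elements, the signs split along unions by the rules for big operators; the two
    associativity lemmas below depend on this. *)
Lemma shuffle_signE I J : shuffle_sign I J = \prod_(i in I) koszul_sign i J :> R.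
Proof.
rewrite /shuffle_sign /koszul_sign -expr_sum; congr (_ ^+ _).
under eq_bigr => i _ do rewrite -sum1_card.
rewrite pair_big_dep/= -sum1_card; apply: eq_bigl => -[i j].
by rewrite !inE /= andbA.
Qed.

(** Associativity with a basis covector on the left. The sets containing k correspond to subsets of
    K \ k, and the sign of k against K factors over the two pieces of K \ k. *)
Lemma eps_wedgel k a b : wedge (eps k a) b = eps k (wedge a b).
Proof.
apply/ffunP => K; rewrite epsE ffunE.
under eq_bigr => I _ do
  rewrite epsE (fun_if (fun y => shuffle_sign I (K :\: I)%SET * y)) mulr0 (fun_if ( *%R^~ (b (K :\: I)%SET))) mul0r.
rewrite -big_mkcondr/=; case: ifPn => kK; last first.
  rewrite big_pred0// => I; apply/negbTE/negP => /andP[/fintype.subsetP IK /IK].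
  by rewrite (negbTE kK).
rewrite ffunE mulr_sumr (reindex_onto (fun I => k |: I)%SET (fun I => I :\ k)%SET)/=; last first.
  by move=> I /andP[_ kI]; rewrite finset.setD1K.
apply: eq_big => [I|I].
  rewrite finset.setU11 andbT subsetD1 finset.subUset finset.sub1set kK /=.
  congr (_ && _); apply/eqP/idP => [<-|kI]; first by rewrite finset.setD11.
  by rewrite finset.setU1K.
case/andP => /andP[/fintype.subsetP IK _] /eqP kI; rewrite kI.
have kNI : k \notin I by rewrite -kI finset.setD11.
have -> : (K :\: (k |: I) = (K :\ k) :\: I)%SET by rewrite finset.setDDl.
set J := (_ :\: I)%SET.
rewrite !shuffle_signE finset.big_setU1//= koszul_signU1// ltnn mul1r.
have -> : koszul_sign k K = koszul_sign k I * koszul_sign k J.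
  rewrite -koszul_signU; last first.
    by apply/setP => j; rewrite !inE; case: (j \in I).
  have -> : (I :|: J = K :\ k)%SET.
    apply/setP => j; rewrite !inE; case: (boolP (j \in I)) => //= jI.
    rewrite IK ?inE ?jI ?orbT// andbT; apply/esym; apply: contraNneq kNI => <-//.
  by rewrite koszul_signD1// ltnn mul1r.
by ring.
Qed.

(** The grade involution, the sign picked up when a covector is moved past a form, see
    [eps_wedger]. *)
Definition parity a : extalg R n := [ffun I : {set 'I_n.+1} => (-1) ^+ #|I| * a I].

(** Reversing each comparison with k costs one sign per element of I, since k is not in I. *)
Lemma prod_sign_lt k I : k \notin I ->
  \prod_(j in I) (-1) ^+ (k < j)%N = (-1) ^+ #|I| * koszul_sign k I :> R.
Proof.
move=> kI; rewrite koszul_signE -sum1_card expr_sum -big_split; apply: eq_bigr => j jI /=.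
have jk : k != j by apply: contraNneq kI => ->.
by rewrite expr1 mulN1r (koszul_sign_swap jk) opprK.
Qed.

Lemma eps_wedger k a b : wedge a (eps k b) = eps k (wedge (parity a) b).
Proof.
apply/ffunP => K; rewrite epsE ffunE.
under eq_bigr => I _ do
  rewrite epsE (fun_if (fun y => shuffle_sign I (K :\: I)%SET * a I * y)) mulr0.
rewrite -big_mkcondr/=; case: ifPn => kK; last first.
  by rewrite big_pred0// => I; rewrite inE (negbTE kK) !andbF.
rewrite ffunE mulr_sumr; apply: eq_big => [I|I].
  by rewrite subsetD1 inE kK andbT.
case/andP => /fintype.subsetP IK; rewrite inE => /andP[kI _].
rewrite [parity a I]ffunE.
have -> : ((K :\: I) :\ k = (K :\ k) :\: I)%SET by rewrite !finset.setDDl finset.setUC.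
have EKI : (K :\: I = k |: ((K :\ k) :\: I))%SET.
  by apply/setP => j; rewrite !inE; case: (j =P k) => [->|]//=; rewrite kK kI.
set J := ((K :\ k) :\: I)%SET; have kJ : k \notin J by rewrite !inE eqxx /= andbF.
rewrite EKI koszul_signU1// ltnn mul1r !shuffle_signE.
under eq_bigr => i _ do rewrite koszul_signU1//.
rewrite big_split/= prod_sign_lt//.
have -> : koszul_sign k K = koszul_sign k I * koszul_sign k J.
  rewrite -koszul_signU; last first.
    by apply/setP => j; rewrite !inE; case: (j \in I); rewrite ?andbF.
  have -> : (I :|: J = K :\ k)%SET.
    apply/setP => j; rewrite !inE; case: (boolP (j \in I)) => //= jI.
    rewrite IK// andbT; apply/esym; apply: contraNneq kI => <-//.
  by rewrite koszul_signD1// ltnn mul1r.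
by ring.
Qed.

Lemma iota_degree_part k q a :
  iota k (degree_part q.+1 a) = degree_part q (iota k a).
Proof.
apply/ffunP => I; rewrite iotaE ffunE [RHS]ffunE iotaE; case: ifPn => kI; first by rewrite if_same.
by rewrite cardsU1 kI add1n eqSS; case: ifP; rewrite ?mulr0.
Qed.

Lemma iota_degree_part0 k a : iota k (degree_part 0 a) = 0.
Proof.
apply/ffunP => I; rewrite iotaE ffunE ext0E; case: ifPn => kI//.
by rewrite cardsU1 kI add1n mulr0.
Qed.

Lemma eps_degree_part k q a :
  eps k (degree_part q a) = degree_part q.+1 (eps k a).
Proof.
apply/ffunP => I; rewrite epsE ffunE [RHS]ffunE epsE; case: ifPn => kI; last by rewrite if_same.
by rewrite (cardsD1 k I) kI add1n eqSS; case: ifP; rewrite ?mulr0.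
Qed.

Lemma degree_part_is_linear q : linear (@degree_part R n q).
Proof.
move=> c a b; apply/ffunP => I; rewrite !ffunE /GRing.scale /=.
by case: ifP; rewrite ?mulr0 ?addr0.
Qed.

HB.instance Definition _ q := GRing.isLinear.Build R (extalg R n) (extalg R n) _
  (degree_part q) (degree_part_is_linear q).

Lemma degree_partZ q c a : degree_part q (c *: a) = c *: degree_part q a.
Proof. exact: linearZ. Qed.
Lemma degree_part_sumr q (T : finType) (P : pred T) F :
  degree_part q (\sum_(t | P t) F t : extalg R n) = \sum_(t | P t) degree_part q (F t).
Proof. exact: raddf_sum. Qed.

Lemma interior_degree_part v q a :
  interior v (degree_part q.+1 a) = degree_part q (interior v a).
Proof.
rewrite !interior_sum degree_part_sumr; apply: eq_bigr => k _.
by rewrite degree_partZ iota_degree_part.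
Qed.

Lemma interior_degree_part0 v a : interior v (degree_part 0 a) = 0.
Proof. by rewrite interior_sum big1 // => k _; rewrite iota_degree_part0 scaler0. Qed.

Lemma wedge_degree_part v q a :
  wedge (flat v) (degree_part q a) = degree_part q.+1 (wedge (flat v) a).
Proof.
rewrite !wedge_flat_sum degree_part_sumr; apply: eq_bigr => k _.
by rewrite degree_partZ eps_degree_part.
Qed.

Lemma tangential_part_degree x q a :
  tangential_part x (degree_part q a) = degree_part q (tangential_part x a).
Proof. by rewrite /tangential_part wedge_degree_part interior_degree_part. Qed.

Lemma parity_degree_part q a : parity (degree_part q a) = (-1) ^+ q *: degree_part q a.
Proof.
apply/ffunP => I; rewrite ffunE extZE ffunE; case: ifP => [/eqP->//|_].
by rewrite !mulr0.
Qed.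

Definition basis_form I : extalg R n := [ffun K => (K == I)%:R].

Lemma wedge_basis_form I a :
  wedge (basis_form (~: I)) a [set: 'I_n.+1]%SET = shuffle_sign (~: I)%SET I * a I.
Proof.
rewrite ffunE (bigD1 (~: I)%SET)//= ?finset.subsetT// big1 ?addr0 => [|K /andP[_ KI]].
  by rewrite ffunE eqxx mulr1 finset.setTD finset.setCK.
by rewrite ffunE (negbTE KI) mulr0 mul0r.
Qed.

Lemma wedge_flat_wedger v a b :
  wedge a (wedge (flat v) b) = wedge (flat v) (wedge (parity a) b).
Proof.
rewrite !wedge_flat_sum wedge_sumr; apply: eq_bigr => k _.
by rewrite wedgeZ eps_wedger.
Qed.

Lemma wedge_addl a1 a2 b : wedge (a1 + a2) b = wedge a1 b + wedge a2 b.
Proof. by have := wedgel_is_linear b 1 a1 a2; rewrite !scale1r. Qed.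

Lemma wedge_scalel c a b : wedge (c *: a) b = c *: wedge a b.
Proof.
apply/ffunP => K; rewrite extZE !ffunE mulr_sumr; apply: eq_bigr => I _.
by rewrite extZE; ring.
Qed.

Lemma wedge_flat_wedgel v a b :
  wedge (wedge (flat v) a) b = wedge (flat v) (wedge a b).
Proof.
rewrite !wedge_flat_sum.
apply/ffunP => K; rewrite ffunE sum_ffunE.
rewrite (eq_bigr (fun I => \sum_k v 0 k *
   (shuffle_sign I (K :\: I)%SET * eps k a I * b (K :\: I)%SET))); last first.
  move=> I _; rewrite sum_ffunE mulr_sumr mulr_suml; apply: eq_bigr => k _.
  by rewrite extZE; ring.
rewrite exchange_big; apply: eq_bigr => k _ /=.
by rewrite extZE -eps_wedgel ffunE mulr_sumr.
Qed.

(* Pairing with the tangential part of the complementary basis form reads off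
   the coefficients of [x /\ b]. *)
Lemma wedge_pairing_nondegenerate x q b : sphere x -> tangential x b ->
  degree_part q b = b -> (q <= n)%N ->
  (forall a, tangential x a -> degree_part (n - q) a = a -> wedge a b = 0) -> b = 0.
Proof.
move=> Sx bx bq qn ab0.
suff xb0 : wedge (flat x) b = 0.
  by rewrite -(tangential_part_id Sx bx) /tangential_part xb0 interior0.
apply/ffunP => I; rewrite ext0E; have [qI|qI] := eqVneq #|I| q.+1; last first.
  by rewrite -bq wedge_degree_part ffunE (negbTE qI).
suff /eqP : shuffle_sign (~: I)%SET I * wedge (flat x) b I = 0.
  by rewrite mulf_eq0 signr_eq0 => /eqP.
rewrite -wedge_basis_form; set e := basis_form _.
have eq : degree_part (n - q) e = e.
  apply/ffunP => K; rewrite !ffunE; have [->|_] := eqVneq K (~: I)%SET; last by rewrite if_same.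
  by rewrite cardsCs finset.setCK card_ord qI subSS eqxx.
(* The normal part of e has a factor x and dies against x /\ b. For the tangential part, x can be
   moved to the front up to sign, which leaves a product with b that vanishes by hypothesis. *)
have -> : e = tangential_part x e + wedge (flat x) (interior x e).
  by rewrite tangential_partE// subrK.
rewrite wedge_addl wedge_flat_wedgel (wedge_flat_wedger x (interior x e)) wedge_wedge addr0.
rewrite wedge_flat_wedger -eq tangential_part_degree parity_degree_part.
rewrite wedge_scalel -tangential_part_degree ab0 ?scaler0 ?linear0 ?ext0E//.
- exact: tangential_tangential_part.
- by rewrite eq -tangential_part_degree eq.
Qed.

Lemma degree_part_id q a : degree_part q (degree_part q a) = degree_part q a.
Proof. by apply/ffunP => I; rewrite !ffunE; case: (_ == _). Qed.

Lemma degree_part_volume x : degree_part n (volume_form x) = volume_form x.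
Proof.
rewrite volume_formE -interior_degree_part; congr interior.
apply/ffunP => I; rewrite !ffunE; have [->|_] := eqVneq I [set: 'I_n.+1]%SET; last by rewrite if_same.
by rewrite finset.cardsT card_ord eqxx.
Qed.

Lemma interior_setT v a : interior v a [set: 'I_n.+1]%SET = 0.
Proof. by rewrite interiorE big1 // => i; rewrite inE. Qed.

Lemma scalar1_wedge a : wedge (scalar 1) a = a.
Proof.
apply/ffunP => K; rewrite ffunE (bigD1 finset.set0)/= ?finset.sub0set// big1; last first.
  by move=> I /andP[_ /negbTE I0]; rewrite ffunE I0 mulr0 mul0r.
by rewrite ffunE eqxx finset.setD0 shuffle_signE finset.big_set0 !mul1r addr0.
Qed.

Lemma inner_scalar (r c : R) : inner (scalar r : extalg R n) (scalar c) = r * c.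
Proof.
rewrite /inner (bigD1 finset.set0)//= big1 ?addr0 => [|I /negbTE I0].
  by rewrite !ffunE eqxx.
by rewrite !ffunE I0 mul0r.
Qed.

Lemma tangential_scalar x c : tangential x (scalar c).
Proof. exact: interior_scalar. Qed.

Lemma tangential_volume x : tangential x (volume_form x).
Proof. exact: interior_interior. Qed.

Lemma tangential_degree_part x q a : tangential x a -> tangential x (degree_part q a).
Proof.
rewrite /tangential; case: q => [|q] ax; first by rewrite interior_degree_part0.
by rewrite interior_degree_part ax; apply/ffunP => I; rewrite !ffunE if_same.
Qed.

Lemma degree_partE_scalar a : degree_part 0 a = scalar (a finset.set0).
Proof.
apply/ffunP => I; rewrite !ffunE cards_eq0.
by have [->|] := eqVneq I finset.set0.
Qed.

Lemma tangential_setT x a : sphere x -> tangential x a -> a [set: 'I_n.+1]%SET = 0.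
Proof. by move=> Sx ax; rewrite -(tangential_part_id Sx ax) interior_setT. Qed.

Lemma is_hodge_scalar x c : is_hodge x (scalar c) (c *: volume_form x).
Proof.
split; first by rewrite /tangential interiorZ volume_formE interior_interior scaler0.
move=> [|p] a pn ax ap.
  rewrite subn0 degree_partZ degree_part_volume -ap degree_partE_scalar scalarE.
  by rewrite wedgeZ wedge_scalel scalar1_wedge -scalarE inner_scalar scalerA mulrC.
have -> : inner a (scalar c) = 0.
  rewrite /inner big1 // => I _; rewrite -ap !ffunE.
  by have [->|] := eqVneq I finset.set0; rewrite ?cards0 ?mul0r ?mulr0.
rewrite scale0r degree_partZ -degree_part_volume wedgeZ.
have -> : degree_part (n - p.+1) (degree_part n (volume_form x)) = 0.
  apply/ffunP => I; rewrite !ffunE; case: eqP => // ->; case: eqP => // E.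
  by move: pn E; clear; lia.
by rewrite wedge0 scaler0.
Qed.

(** The choice in [hodge] forces a uniqueness proof. Degrees below n vanish by nondegeneracy of the
    wedge pairing, degree n is determined by the test form 1, and degree n + 1 is absent from a
    tangential form. *)
Lemma hodge_scalar x c : sphere x -> hodge x (scalar c) = c *: volume_form x.
Proof.
move=> Sx; apply: xget_unique; first exact: is_hodge_scalar.
move=> b [bx hb].
have b0 q : (q < n)%N -> degree_part q b = 0.
  move=> qn; apply: (@wedge_pairing_nondegenerate x q) => //.
  - exact: tangential_degree_part.
  - exact: degree_part_id.
  - exact: ltnW.
  move=> a ax aq; have := hb (n - q)%N a (leq_subr _ _) ax aq.
  rewrite subKn ?(ltnW qn)// => ->.
  rewrite /inner big1 ?scale0r// => I _; rewrite -aq !ffunE.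
  have [->|] := eqVneq I finset.set0; rewrite ?mulr0// cards0 eq_sym subn_eq0 leqNgt qn.
  by rewrite mul0r.
have := hb 0%N (scalar 1) (leq0n _) (tangential_scalar _ _).
rewrite degree_partE_scalar ffunE eqxx subn0 inner_scalar mul1r scalar1_wedge => <- //.
apply/ffunP => I; rewrite ffunE; have [//|In] := eqVneq #|I| n.
have : (#|I| <= n.+1)%N by rewrite -[X in (_ <= X)%N]card_ord max_card.
rewrite leq_eqVlt => /orP[/eqP I1|]; last first.
  rewrite ltnS leq_eqVlt (negbTE In)/= => /b0 /ffunP/(_ I).
  by rewrite !ffunE eqxx.
suff -> : I = [set: 'I_n.+1]%SET by rewrite (tangential_setT Sx bx).
by apply/eqP; rewrite eqEcard finset.subsetT finset.cardsT card_ord I1 leqnn.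
Qed.

End ExteriorOperators.

(** * Smooth functions and symmetry of second derivatives *)

(** The differential of f also serves for g, because the two remainders agree near 0. *)
Lemma near_eq_differentiable {K : numFieldType} {V W : normedModType K} (f g : V -> W) (x : V) :
  (\near x, f x = g x) -> differentiable f x -> differentiable g x.
Proof.
move=> fg df.
have fg0 : \forall h \near (0 : V), f (h + x) = g (h + x).
  by move: fg; rewrite (near_shift 0); apply: filterS => h /=; rewrite subr0.
have ge : g \o shift x = cst (g x) + 'd f x +o_ (0 : V) id.
  have fe := diff_locally df.
  apply/eqaddoP => e e0; near=> h.
  have -> : (g \o shift x - (cst (g x) + 'd f x)) h =
            (f \o shift x - (cst (f x) + 'd f x)) h.
    rewrite !fctE /= (nbhs_singleton fg); congr (_ - _).
    by apply/esym; near: h.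
  by near: h; move/eqaddoP : fe => /(_ e e0).
have dg := diff_unique (diff_continuous df) ge.
by apply/diff_locallyP; rewrite dg; split=> //; apply: diff_continuous.
Unshelve. all: by end_near. Qed.

Section Smoothness.
Context {R : realType} {n : nat}.
Local Notation E := ('rV[R]_n.+1).
Implicit Types (U : set E) (F G : E -> R^o) (x y v w : E).

(** Smoothness graded by order, with the derivative taken first peeled off. This is the form in
    which product and chain rules admit an induction on the order. *)
Fixpoint smooth_upto (k : nat) U F : Prop :=
  (forall x, U x -> differentiable F x) /\
  if k is k'.+1 then forall v, smooth_upto k' U ('D_v F) else True.

Lemma smooth_uptoW k U F : smooth_upto k.+1 U F -> smooth_upto k U F.
Proof.
elim: k F => [|k IH] F [dF sF]; split=> // v.
by apply: IH; apply: sF.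
Qed.

Lemma smooth_upto_diff k U F : smooth_upto k U F -> forall x, U x -> differentiable F x.
Proof. by case: k => [|k] []. Qed.

Lemma smooth_onP U F : smooth_on U F <-> forall k, smooth_upto k U F.
Proof.
(* The head of the list in [iter_derive] is the derivative taken last, so the derivative taken first
   has to be extracted from the end. *)
have Hrcons vs v F' : iter_derive (rcons vs v) F' = iter_derive vs ('D_v F').
  by elim: vs => //= w vs ->.
split=> [sF k|sF vs].
  elim: k F sF => [|k IH] F sF; split=> //; try by move=> x; exact: (sF [::]).
  by move=> v; apply: IH => vs x Ux; rewrite -Hrcons; exact: sF.
elim/last_ind: vs F sF => [|vs v IH] F sF x Ux; first exact: (smooth_upto_diff (sF 0%N)).
by rewrite Hrcons; apply: IH => // k; have [_] := sF k.+1; exact.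
Qed.

Lemma open_near_eq U F G x : open U -> {in U, F =1 G} -> U x -> \near x, F x = G x.
Proof.
move=> oU FG Ux; have Un : nbhs x U by apply: open_nbhs_nbhs.
by apply: filterS Un => y /mem_set /FG.
Qed.

Lemma smooth_upto_eq k U F G : open U -> {in U, F =1 G} ->
  smooth_upto k U F -> smooth_upto k U G.
Proof.
move=> oU; elim: k F G => [|k IH] F G FG [dF sF]; split => //.
- by move=> x Ux; apply: near_eq_differentiable (dF x Ux); exact: (open_near_eq oU).
- by move=> x Ux; apply: near_eq_differentiable (dF x Ux); exact: (open_near_eq oU).
- move=> v; apply: IH (sF v) => x /set_mem Ux.
  by apply: near_eq_derive; exact: (open_near_eq oU).
Qed.

Lemma smooth_upto_cst k U (c : R^o) : smooth_upto k U (fun=> c).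
Proof.
elim: k c => [|k IH] c; split=> // v.
have -> : 'D_v (fun=> c) = (fun=> 0) :> (E -> R^o) by apply/funext => x; exact: derive_cst.
exact: IH.
Qed.

Lemma smooth_uptoD k U F G : open U -> smooth_upto k U F -> smooth_upto k U G ->
  smooth_upto k U (fun x => F x + G x).
Proof.
move=> oU; elim: k F G => [|k IH] F G [dF sF] [dG sG].
  by split => // x Ux; apply: differentiableD; [exact: dF|exact: dG].
split=> [x Ux|v]; first by apply: differentiableD; [exact: dF|exact: dG].
apply: smooth_upto_eq (IH _ _ (sF v) (sG v)) => // x /set_mem Ux.
by rewrite -deriveD//; apply: diff_derivable; [exact: dF|exact: dG].
Qed.

Lemma smooth_uptoM k U F G : open U -> smooth_upto k U F -> smooth_upto k U G ->
  smooth_upto k U (fun x => F x * G x).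
Proof.
move=> oU; elim: k F G => [|k IH] F G [dF sF] [dG sG].
  by split => // x Ux; apply: differentiableM; [exact: dF|exact: dG].
have WF := @smooth_uptoW k U F (conj dF sF); have WG := @smooth_uptoW k U G (conj dG sG).
split=> [x Ux|v]; first by apply: differentiableM; [exact: dF|exact: dG].
apply: smooth_upto_eq (smooth_uptoD oU (IH _ _ WF (sG v)) (IH _ _ WG (sF v))) => // x /set_mem Ux.
by rewrite deriveM//; apply: diff_derivable; [exact: dF|exact: dG].
Qed.

Lemma smooth_upto_sum k U (m : nat) (F : 'I_m -> E -> R^o) : open U ->
  (forall i, smooth_upto k U (F i)) -> smooth_upto k U (fun x => \sum_i F i x).
Proof.
move=> oU; elim: m F => [|m IH] F sF.
  by under eq_fun do rewrite big_ord0; exact: smooth_upto_cst.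
under eq_fun do rewrite big_ord_recl.
by apply: smooth_uptoD => //; apply: IH.
Qed.

Lemma is_derive_line {V : normedModType R} (f : V -> R^o) (x v : V) (t : R) :
  differentiable f (x + t *: v) ->
  is_derive t 1 (fun s : R => f (x + s *: v)) ('D_v f (x + t *: v)).
Proof.
move=> df; have dl : derivable f (x + t *: v) v := diff_derivable df.
have E : (fun h : R => h^-1 *: (((fun s : R => f (x + s *: v)) \o shift t) (h *: (1 : R)) - f (x + t *: v))) =
         (fun h : R => h^-1 *: ((f \o shift (x + t *: v)) (h *: v) - f (x + t *: v))).
  apply/funext => h /=; congr (_ *: (f _ - _)).
  by rewrite scaler1 scalerDl addrCA.
by split; [rewrite /derivable E|rewrite /derive E].
Qed.

Lemma MVT_line {V : normedModType R} (f : V -> R^o) (x v : V) (h : R) : 0 < h ->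
  (forall t, 0 <= t <= h -> differentiable f (x + t *: v)) ->
  exists2 c, 0 <= c <= h & f (x + h *: v) - f x = h * 'D_v f (x + c *: v).
Proof.
move=> h0 df.
have [||c c0h] := @MVT_segment R (fun s => f (x + s *: v)) (fun s => 'D_v f (x + s *: v)) 0 h (ltW h0).
- move=> t; rewrite in_itv/= => /andP[t0 th].
  by apply: is_derive_line; apply: df; rewrite !ltW.
- apply: derivable_within_continuous => t; rewrite in_itv/= => th.
  by have [] := is_derive_line (df _ th).
rewrite scale0r addr0 subr0 mulrC => E; exists c => //.
Qed.

Lemma derive_coord (i : 'I_n.+1) v x : 'D_v (fun y : E => y 0 i : R^o) x = v 0 i.
Proof.
apply: cvg_lim => //; apply: cvg_near_cst.
by near=> h; rewrite /= !mxE addrK /GRing.scale/= mulKf//; near: h; exact: nbhs_dnbhs_neq.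
Unshelve. all: by end_near. Qed.

Lemma smooth_upto_coord k U (i : 'I_n.+1) : smooth_upto k U (fun y : E => y 0 i : R^o).
Proof.
case: k => [|k]; split=> //; try by move=> x _; exact: differentiable_coord.
move=> v; have -> : 'D_v (fun y : E => y 0 i : R^o) = (fun=> v 0 i).
  by apply/funext => x; exact: derive_coord.
exact: smooth_upto_cst.
Qed.

End Smoothness.

Lemma dist_le_of_common_approx (R : realType) (e p q r r' : R) :
  `|p - r| < e / 2 -> `|q - r'| < e / 2 -> r = r' -> `|p - q| <= e.
Proof.
move=> pr qr rr; rewrite -rr distrC in qr.
rewrite -(subrKA r) (le_trans (ler_normD _ _))// (splitr e) lerD// ltW//.
Qed.

Section SymmetricDerivatives.
Context {R : realType} {n : nat}.
Local Notation E := ('rV[R]_n.+1).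
Implicit Types (F : E -> R^o) (x u v : E).

Lemma differentiable_shift F x v : differentiable F (x + v) ->
  differentiable (fun y => F (y + v)) x.
Proof.
move=> dF; apply: (@differentiable_comp _ _ _ _ (fun y => y + v) F) => //.
Qed.

Lemma derive_shiftE F x u v : 'D_u (fun y => F (y + v)) x = 'D_u F (x + v).
Proof.
rewrite /derive (_ : (fun h : R => _) =
  (fun h : R => h^-1 *: ((F \o shift (x + v)) (h *: u) - F (x + v))))//.
by apply/funext => h /=; rewrite addrA.
Qed.

(** The mean value theorem is applied in the direction u to y |-> F (y + h v) - F y, then in the
    direction v to the derivative of F along u. The left-hand side is symmetric in u and v, which is
    the point of the lemma. *)
Lemma second_difference F (U : set E) x u v (h : R) : 0 < h ->
  (forall s t : R, 0 <= s <= h -> 0 <= t <= h -> U (x + s *: u + t *: v)) ->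
  (forall y, U y -> differentiable F y) ->
  (forall y, U y -> differentiable ('D_u F) y) ->
  exists s t : R, [/\ 0 <= s <= h, 0 <= t <= h &
    F (x + h *: u + h *: v) - F (x + h *: u) - (F (x + h *: v) - F x) =
    h ^+ 2 * 'D_v ('D_u F) (x + s *: u + t *: v)].
Proof.
move=> h0 hU dF ddF.
have hh : 0 <= h <= h by rewrite lexx ltW.
have h00 : 0 <= (0 : R) <= h by rewrite lexx ltW.
have U0 s : 0 <= s <= h -> U (x + s *: u).
  by move=> sh; rewrite -[_ + _]addr0 -(scale0r v); apply: hU.
have [t th|s sh Es] := @MVT_line R E (fun y => F (y + h *: v) - F y) x u h h0.
  apply: differentiableB; last exact/dF/U0.
  by apply/differentiable_shift/dF/hU.
have [t th|t th Et] := @MVT_line R E ('D_u F) (x + s *: u) v h h0.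
  by apply: ddF; apply: hU.
exists s, t; split => //; rewrite Es deriveB; last 2 first.
- by apply/diff_derivable/differentiable_shift/dF/hU.
- by apply/diff_derivable/dF/U0.
by rewrite derive_shiftE Et expr2 mulrA.
Qed.

(** Schwarz's theorem: the symmetric second difference equals h^2 times either mixed derivative at
    points close to x, and both mixed derivatives are continuous at x. *)
Lemma derive_comm F (U : set E) x u v : open U -> U x ->
  (forall y, U y -> differentiable F y) ->
  (forall y, U y -> differentiable ('D_u F) y) ->
  (forall y, U y -> differentiable ('D_v F) y) ->
  {for x, continuous ('D_v ('D_u F))} -> {for x, continuous ('D_u ('D_v F))} ->
  'D_v ('D_u F) x = 'D_u ('D_v F) x.
Proof.
move=> oU Ux dF duF dvF cvu cuv.
apply/eqP; rewrite -subr_eq0 -normr_le0; apply/ler_addgt0Pr => e e0; rewrite add0r.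
have e20 : 0 < e / 2 by rewrite divr_gt0.
pose N := [set y | [/\ U y, `|'D_v ('D_u F) x - 'D_v ('D_u F) y| < e / 2 &
                     `|'D_u ('D_v F) x - 'D_u ('D_v F) y| < e / 2]].
have Nx : nbhs x N.
  have NU : nbhs x U by apply: open_nbhs_nbhs; split.
  have /cvgrPdist_lt/(_ _ e20) N1 := cvu.
  have /cvgrPdist_lt/(_ _ e20) N2 := cuv.
  have N12 := @filterI _ _ (nbhs_filter x) _ _ (@filterI _ _ (nbhs_filter x) _ _ NU N1) N2.
  by apply: (@filterS _ _ (nbhs_filter x) _ _ _ N12) => y [[Uy n1] n2]; split; [exact: Uy|exact: n1|exact: n2].
have /nbhs_ballP[d /= d0 dN] := Nx.
(* The summand 1 keeps [M] positive. With h = d / (2 M) the parallelogram at x with sides h u and h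
   v stays in the ball of radius d on which both mixed derivatives are close to their values at
   x. *)
pose M := `|u| + `|v| + 1.
have M0 : 0 < M by rewrite ltr_wpDl// addr_ge0.
pose h := d / (2 * M).
have h0 : 0 < h by rewrite divr_gt0// mulr_gt0.
have hM : h * M < d.
  by rewrite /h invfM mulrA mulfVK ?gt_eqF// ltr_pdivrMr// ltr_pMr// ltr1n.
have small (s t : R) : 0 <= s <= h -> 0 <= t <= h -> N (x + s *: u + t *: v).
  move=> /andP[s0 sh] /andP[t0 th]; apply: dN; rewrite -ball_normE /=.
  rewrite -addrA opprD addNKr normrN (le_lt_trans _ hM)//.
  rewrite (le_trans (ler_normD _ _))// !normrZ !ger0_norm// /M mulrDr mulr1 mulrDr.
  rewrite (le_trans (lerD (ler_wpM2r _ sh) (ler_wpM2r _ th)))// lerDl ltW//.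
have [s1 [t1 [sh1 th1 E1]]] := @second_difference F U x u v h h0
  (fun (s t : R) sh th => let: And3 a _ _ := small s t sh th in a) dF duF.
have [t2 [s2 [th2 sh2 E2]]] := @second_difference F U x v u h h0
  (fun (s t : R) sh th => let: And3 a _ _ := small t s th sh in
     eq_ind _ U a _ (addrAC _ _ _)) dF dvF.
have DE : 'D_v ('D_u F) (x + s1 *: u + t1 *: v) = 'D_u ('D_v F) (x + s2 *: u + t2 *: v).
  apply: (@mulfI R (h ^+ 2)); first by rewrite expf_neq0// gt_eqF.
  have /esym := E1; rewrite (_ : x + h *: u + h *: v = x + h *: v + h *: u); last exact: addrAC.
  move=> E1'; rewrite (_ : x + s2 *: u + t2 *: v = x + t2 *: v + s2 *: u); last exact: addrAC.
  apply: (etrans E1'); apply: etrans E2.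
  have rr (a b c d' : R) : a - b - (c - d') = a - c - (b - d') by ring.
  exact: rr.
have [_ B _] := small _ _ sh1 th1; have [_ _ A] := small _ _ sh2 th2.
exact: dist_le_of_common_approx B A DE.
Qed.

End SymmetricDerivatives.

(** * Functions on the sphere *)

Section Retraction.
Context {R : realType} {n : nat}.
Local Notation E := ('rV[R]_n.+1).
Implicit Types (U : set E) (F G : E -> R^o) (x y v w : E).

Definition punctured : set E := [set y | y != 0].

Lemma open_punctured : open punctured.
Proof.
have -> : punctured = ~` [set 0].
  by apply/seteqP; split=> y /=; rewrite /punctured/= => /eqP.
apply: closed_openC; apply: accessible_closed_set1; apply: hausdorff_accessible; exact: norm_hausdorff.
Qed.

Lemma dotC x y : dot x y = dot y x.
Proof. by apply: eq_bigr => i _; rewrite mulrC. Qed.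

Lemma dotDl x y w : dot (x + y) w = dot x w + dot y w.
Proof. by rewrite -big_split; apply: eq_bigr => i _; rewrite mxE mulrDl. Qed.

Lemma dotZl (c : R) x y : dot (c *: x) y = c * dot x y.
Proof. by rewrite /dot mulr_sumr; apply: eq_bigr => i _; rewrite mxE mulrA. Qed.

Lemma dotDr x y w : dot w (x + y) = dot w x + dot w y.
Proof. by rewrite !(dotC w) dotDl. Qed.

Lemma dotZr (c : R) x y : dot x (c *: y) = c * dot x y.
Proof. by rewrite !(dotC x) dotZl. Qed.

Lemma dot_ge0 x : 0 <= dot x x.
Proof. by apply: sumr_ge0 => i _; rewrite -expr2 sqr_ge0. Qed.

Lemma dot_eq0 x : (dot x x == 0) = (x == 0).
Proof.
apply/eqP/eqP => [x0|->]; last by rewrite /dot big1// => i _; rewrite mxE mul0r.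
apply/rowP => i; rewrite mxE; apply/eqP; rewrite -sqrf_eq0 expr2; apply/eqP.
by apply: (psumr_eq0P _ x0) => // j _; rewrite -expr2 sqr_ge0.
Qed.

Lemma dot_gt0 x : punctured x -> 0 < dot x x.
Proof. by move=> x0; rewrite lt_neqAle dot_ge0 eq_sym dot_eq0 x0. Qed.

Lemma sphere_punctured x : sphere x -> punctured x.
Proof. by rewrite /sphere/punctured/= => x1; rewrite -dot_eq0 x1 oner_eq0. Qed.

Definition inv_norm y : R^o := (Num.sqrt (dot y y))^-1.

Lemma inv_norm_gt0 y : punctured y -> 0 < inv_norm y.
Proof. by move=> y0; rewrite invr_gt0 sqrtr_gt0 dot_gt0. Qed.

Lemma inv_norm_sqr y : punctured y -> inv_norm y * inv_norm y * dot y y = 1.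
Proof.
move=> y0; rewrite /inv_norm -invfM -expr2 sqr_sqrtr ?dot_ge0// mulVf//.
by rewrite gt_eqF// dot_gt0.
Qed.

Lemma inv_norm_sphere x : sphere x -> inv_norm x = 1.
Proof. by rewrite /sphere /inv_norm/= => ->; rewrite sqrtr1 invr1. Qed.

Lemma retractionE y : retraction y = inv_norm y *: y. Proof. by []. Qed.

Lemma sphere_retraction y : punctured y -> sphere (retraction y).
Proof.
by move=> y0; rewrite /sphere/= retractionE dotZl dotZr mulrA inv_norm_sqr.
Qed.

Lemma retraction_id x : sphere x -> retraction x = x.
Proof. by move=> Sx; rewrite retractionE inv_norm_sphere// scale1r. Qed.

Lemma retraction_scale (c : R) y : 0 < c -> retraction (c *: y) = retraction y.
Proof.
move=> c0; rewrite /retraction dotZl dotZr mulrA -expr2 sqrtrM ?sqr_ge0//.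
rewrite sqrtr_sqr gtr0_norm// invfM scalerA mulrAC mulVf ?mul1r// gt_eqF//.
Qed.

Lemma smooth_upto_dot k U : open U -> smooth_upto k U (fun y => dot y y).
Proof.
move=> oU; apply: smooth_upto_sum => // i.
by apply: smooth_uptoM => //; exact: smooth_upto_coord.
Qed.

Lemma differentiable_dot y : differentiable (fun z : E => dot z z : R^o) y.
Proof. exact: (smooth_upto_diff (smooth_upto_dot 0 openT)). Qed.

Lemma derive_dot v y : 'D_v (fun z : E => dot z z : R^o) y = 2 * dot y v.
Proof.
rewrite /dot.
have -> : (fun z : E => \sum_i z 0 i * z 0 i : R^o) =
          \sum_i (fun z : E => z 0 i * z 0 i : R^o).
  by apply/funext => z; rewrite fct_sumE.
have dc i : derivable (fun z : E => z 0 i : R^o) y v.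
  by apply: diff_derivable; exact: differentiable_coord.
rewrite derive_sum; last by move=> i; exact: derivableM (dc i) (dc i).
rewrite mulr_sumr; apply: eq_bigr => i _.
by rewrite (deriveM (dc i) (dc i)) derive_coord /GRing.scale/=; ring.
Qed.

Lemma differentiable_inv_norm y : punctured y -> differentiable inv_norm y.
Proof.
move=> y0; have d0 := dot_gt0 y0.
apply: (@differentiableV _ _ (fun z => Num.sqrt (dot z z) : R^o)); last first.
  by rewrite gt_eqF// sqrtr_gt0.
apply: (@differentiable_comp _ _ _ _ (fun z => dot z z : R^o) (@Num.sqrt R)).
  exact: differentiable_dot.
by apply/derivable1_diffP; have [] := is_derive1_sqrt d0.
Qed.

(** Obtained by differentiating the relation [inv_norm_sqr], which determines the derivative since
    [inv_norm] is not zero. *)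
Lemma derive_inv_norm v y : punctured y ->
  'D_v inv_norm y = - (dot y v * (inv_norm y * inv_norm y * inv_norm y)).
Proof.
move=> y0.
have dr := diff_derivable (differentiable_inv_norm y0) : derivable inv_norm y v.
have dd := diff_derivable (differentiable_dot y) : derivable (fun z : E => dot z z : R^o) y v.
have : 'D_v (inv_norm * inv_norm * (fun z : E => dot z z : R^o)) y = 0.
  rewrite -(derive_cst (1 : R^o) y v); apply: near_eq_derive.
  apply: (open_near_eq open_punctured) => // z /set_mem z0.
  exact: inv_norm_sqr.
rewrite (deriveM (derivableM dr dr) dd) (deriveM dr dr) derive_dot.
rewrite /GRing.scale /=.
have := inv_norm_sqr y0; have := inv_norm_gt0 y0.
set r := inv_norm y; set D := 'D_v _ _; set d := dot y v; set q := dot y y.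
move=> r0 rq H.
have lin (r0' D' d' q' : R) : r0' * r0' * q' = 1 ->
  r0' * r0' * (2 * d') + q' * (r0' * D' + r0' * D') = 0 -> D' = - (d' * (r0' * r0' * r0')).
  move=> h1 h2; apply/eqP; rewrite -subr_eq0 -(mulrI_eq0 _ (@mulfI R 2 _)) ?pnatr_eq0//.
  have -> : 2 * (D' - - (d' * (r0' * r0' * r0'))) =
    r0' * (r0' * r0' * (2 * d') + q' * (r0' * D' + r0' * D')) + 2 * D' * (1 - r0' * r0' * q') by ring.
  by rewrite h1 h2 subrr !mulr0 addr0.
exact: lin rq H.
Qed.

(** The first derivative is a polynomial in [inv_norm] and the coordinates, so order k + 1 reduces
    to order k. *)
Lemma smooth_upto_inv_norm k : smooth_upto k punctured inv_norm.
Proof.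
have oP := open_punctured.
elim: k => [|k IH]; first by split=> // x /differentiable_inv_norm.
split=> [x /differentiable_inv_norm//|v].
have s3 : smooth_upto k punctured (fun y => inv_norm y * inv_norm y * inv_norm y).
  exact: smooth_uptoM oP (smooth_uptoM oP IH IH) IH.
have sv : smooth_upto k punctured (fun y => \sum_i (- v 0 i) * y 0 i).
  apply: smooth_upto_sum => // i; apply: smooth_uptoM => //.
    exact: smooth_upto_cst.
  exact: smooth_upto_coord.
apply: smooth_upto_eq (smooth_uptoM oP sv s3) => // x /set_mem x0.
rewrite derive_inv_norm// -mulNr; congr (_ * _).
by rewrite /dot -sumrN; apply: eq_bigr => i _; rewrite mulNr mulrC.
Qed.

Lemma smooth_upto_sub k U U' F : U' `<=` U -> smooth_upto k U F -> smooth_upto k U' F.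
Proof.
move=> UU; elim: k F => [|k IH] F [dF sF]; split => //; try by move=> x /UU /dF.
by move=> v; apply: IH; exact: sF.
Qed.

Lemma smooth_upto_local k U F :
  (forall x, U x -> exists V : set E, [/\ open V, V x & smooth_upto k V F]) ->
  smooth_upto k U F.
Proof.
elim: k F => [|k IH] F H; split => //.
- by move=> x /H[V [_ Vx /smooth_upto_diff]]; exact.
- by move=> x /H[V [_ Vx /smooth_upto_diff]]; exact.
by move=> v; apply: IH => x /H[V [oV Vx [_ sF]]]; exists V; split => //; exact: sF.
Qed.

Lemma retraction_sum y : retraction y = \sum_j (inv_norm y * y 0 j) *: delta_mx 0 j.
Proof.
by rewrite retractionE {2}(row_delta_sum y) scaler_sumr; apply: eq_bigr => j _; rewrite scalerA.
Qed.

Lemma differentiable_retraction y : punctured y -> differentiable (@retraction R n) y.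
Proof.
move=> y0; have -> : @retraction R n =
    \sum_j (fun z : E => (inv_norm z * z 0 j) *: delta_mx 0 j).
  by apply/funext => z; rewrite retraction_sum fct_sumE.
apply: differentiable_sum => j; apply: differentiableZl.
apply: differentiableM; first exact: differentiable_inv_norm.
exact: differentiable_coord.
Qed.

Lemma derive_coord_comp (f : E -> E) j v y : differentiable f y ->
  ('D_v f y) 0 j = 'D_v (fun z => f z 0 j : R^o) y.
Proof.
move=> df; have dc := differentiable_coord (f y) 0 j.
have -> : (fun z => f z 0 j : R^o) = (fun M : E => M 0 j : R^o) \o f by [].
rewrite (deriveE _ (differentiable_comp df dc)) (diff_comp df dc) /=.
by rewrite -!deriveE// derive_coord.
Qed.

Lemma derive_retraction v y : punctured y ->
  'D_v (@retraction R n) y = inv_norm y *: v + 'D_v inv_norm y *: y.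
Proof.
move=> y0; apply/rowP => j; rewrite derive_coord_comp; last exact: differentiable_retraction.
rewrite !mxE.
have -> : (fun z => retraction z 0 j : R^o) = inv_norm * (fun z : E => z 0 j : R^o).
  by apply/funext => z; rewrite retractionE mxE.
have dr : derivable inv_norm y v by apply: diff_derivable; exact: differentiable_inv_norm.
have dc : derivable (fun z : E => z 0 j : R^o) y v.
  by apply: diff_derivable; exact: differentiable_coord.
by rewrite (deriveM dr dc) derive_coord /GRing.scale/= [X in _ + X]mulrC.
Qed.

Lemma derive_basis F v z : differentiable F z ->
  'D_v F z = \sum_i v 0 i * 'D_(delta_mx 0 i) F z.
Proof.
move=> dF; rewrite (deriveE _ dF) [in LHS](row_delta_sum v) linear_sum.
by apply: eq_bigr => i _; rewrite linearZ /= -(deriveE _ dF).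
Qed.

Lemma derive_comp_retraction F v y : punctured y -> differentiable F (retraction y) ->
  'D_v (F \o @retraction R n) y =
  inv_norm y * 'D_v F (retraction y) +
  'D_v inv_norm y * \sum_i y 0 i * 'D_(delta_mx 0 i) F (retraction y).
Proof.
move=> y0 dF; have dr := differentiable_retraction y0.
rewrite (deriveE _ (differentiable_comp dr dF)) (diff_comp dr dF) /=.
rewrite -(deriveE _ dr) derive_retraction// linearD !linearZ /= -(deriveE _ dF).
by rewrite -(deriveE _ dF) (derive_basis y dF).
Qed.

(** By the chain rule the derivatives of the composite are combinations, with smooth coefficients,
    of composites of derivatives of F; the induction therefore runs over all F at once. *)
Lemma smooth_upto_comp_retraction k U F : open U -> smooth_upto k U F ->
  smooth_upto k (punctured `&` @retraction R n @^-1` U) (F \o @retraction R n).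
Proof.
move=> oU; set W := _ `&` _.
have oW : open W.
  rewrite openE => y [y0 Uy]; apply: filterI.
    by apply: open_nbhs_nbhs; split => //; exact: open_punctured.
  have := differentiable_continuous (differentiable_retraction y0); apply.
  by apply: open_nbhs_nbhs; split.
have Wp : W `<=` punctured by move=> y [].
have dcomp G : (forall x, U x -> differentiable G x) ->
    forall x, W x -> differentiable (G \o @retraction R n) x.
  move=> dG x [x0 Ux]; apply: differentiable_comp; first exact: differentiable_retraction.
  exact: dG.
have sinv j := smooth_upto_sub Wp (smooth_upto_inv_norm j).
elim: k F => [|k IH] F [dF sF]; split => //; try exact: dcomp.
move=> v.
apply: smooth_upto_eq (smooth_uptoD oW (smooth_uptoM oW (sinv k) (IH _ (sF v)))
  (smooth_uptoM oW (proj2 (sinv k.+1) v)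
    (smooth_upto_sum oW (fun i : 'I_n.+1 => smooth_uptoM oW (smooth_upto_coord k W i)
       (IH _ (sF (delta_mx 0 i))))))) => // y /set_mem [y0 Uy].
by rewrite derive_comp_retraction//; exact: dF.
Qed.

Definition radial_extension (f : E -> R) : E -> R^o := fun y => f (retraction y).

(** Composing any local extension with [retraction] gives the radial extension, so a single
    canonical extension tests smoothness on the whole sphere. *)
Lemma smooth_functionP (f : E -> R) :
  smooth_function f <-> smooth_on punctured (radial_extension f).
Proof.
split=> [sf|sf p Sp]; last first.
  exists punctured, (radial_extension f); split => //.
  - exact: open_punctured.
  - exact: sphere_punctured.
  - by move=> x _ Sx; rewrite /radial_extension retraction_id.
apply/smooth_onP => k; apply: smooth_upto_local => y y0.
have [U [F [oU Uy sF FE]]] := sf _ (sphere_retraction y0).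
move/smooth_onP/(_ k)/(smooth_upto_comp_retraction oU) : sF.
set W := _ `&` _ => sF.
have oW : open W.
  rewrite openE => z [z0 Uz]; apply: filterI.
    by apply: open_nbhs_nbhs; split => //; exact: open_punctured.
  have := differentiable_continuous (differentiable_retraction z0); apply.
  by apply: open_nbhs_nbhs; split.
exists W; split => //.
apply: smooth_upto_eq sF => // z /set_mem [z0 Uz].
by rewrite /radial_extension -FE//; exact: sphere_retraction.
Qed.

End Retraction.

(* Partial derivative of the extension of [f] that is constant along rays: on
   the sphere, the derivative along the tangential part of the k-th basis
   vector.  Locked, because unfolding it makes unification diverge. *)
HB.lock Definition spartial {R : realType} {n : nat} (k : 'I_n.+1) (f : 'rV[R]_n.+1 -> R)
  (x : 'rV[R]_n.+1) : R := 'D_(delta_mx 0 k) (radial_extension f) x.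

(** * Calculus of the spherical partial derivatives *)

Section SphericalCalculus.
Context {R : realType} {n : nat}.
Local Notation E := ('rV[R]_n.+1).
Implicit Types (f g : E -> R) (x y v w : E) (k l i j : 'I_n.+1).

Lemma spartialE k f x : spartial k f x = 'D_(delta_mx 0 k) (radial_extension f) x.
Proof. by rewrite unlock. Qed.

Lemma smooth_function_eq f g : (forall x, sphere x -> f x = g x) ->
  smooth_function f -> smooth_function g.
Proof.
move=> fg sf p Sp; have [U [F [oU Up sF FE]]] := sf p Sp.
by exists U, F; split => // x Ux Sx; rewrite FE// fg.
Qed.

Lemma near_radial_extension f g x : (forall x, sphere x -> f x = g x) -> punctured x ->
  \near x, radial_extension f x = radial_extension g x.
Proof.
move=> fg x0; apply: (open_near_eq open_punctured) => // y /set_mem y0.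
by rewrite /radial_extension fg//; exact: sphere_retraction.
Qed.

Lemma derive_radial_extension_eq f g v x : (forall x, sphere x -> f x = g x) -> punctured x ->
  'D_v (radial_extension f) x = 'D_v (radial_extension g) x.
Proof. by move=> fg x0; apply: near_eq_derive; exact: near_radial_extension. Qed.

Lemma spartial_eq k f g x : (forall x, sphere x -> f x = g x) -> sphere x ->
  spartial k f x = spartial k g x.
Proof.
by move=> fg /sphere_punctured x0; rewrite !spartialE; exact: derive_radial_extension_eq.
Qed.

Lemma radial_extension_sphere f x : sphere x -> radial_extension f x = f x.
Proof. by move=> Sx; rewrite /radial_extension retraction_id. Qed.

Lemma smooth_function_upto f : smooth_function f ->
  forall m, smooth_upto m punctured (radial_extension f).
Proof. by move/smooth_functionP/smooth_onP. Qed.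

Lemma smooth_function_of_upto f :
  (forall m, smooth_upto m punctured (radial_extension f)) -> smooth_function f.
Proof. by move=> sf; apply/smooth_functionP; apply/smooth_onP => m; exact: sf. Qed.

Lemma smooth_function_of_extension f (F : E -> R^o) :
  (forall x, sphere x -> F x = f x) -> (forall m, smooth_upto m punctured F) ->
  smooth_function f.
Proof.
move=> Ff sF p Sp; exists punctured, F; split.
- exact: open_punctured.
- exact: sphere_punctured.
- exact/smooth_onP.
- by move=> x _; exact: Ff.
Qed.

Lemma smooth_function_cst (c : R) : smooth_function (fun _ : E => c).
Proof. by apply: smooth_function_of_upto => k; exact: smooth_upto_cst. Qed.

Lemma smooth_function_coord i : smooth_function (fun x : E => x 0 i).
Proof.
apply: (@smooth_function_of_extension _ (fun x : E => x 0 i : R^o)) => // k.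
exact: smooth_upto_coord.
Qed.

Lemma smooth_functionD f g : smooth_function f -> smooth_function g ->
  smooth_function (fun x => f x + g x).
Proof.
move=> /smooth_function_upto sf /smooth_function_upto sg.
by apply: smooth_function_of_upto => k; apply: smooth_uptoD => //; exact: open_punctured.
Qed.

Lemma smooth_functionM f g : smooth_function f -> smooth_function g ->
  smooth_function (fun x => f x * g x).
Proof.
move=> /smooth_function_upto sf /smooth_function_upto sg.
by apply: smooth_function_of_upto => k; apply: smooth_uptoM => //; exact: open_punctured.
Qed.

Lemma smooth_functionZ (c : R) f : smooth_function f -> smooth_function (fun x => c * f x).
Proof. by apply: smooth_functionM; exact: smooth_function_cst. Qed.

Lemma smooth_functionN f : smooth_function f -> smooth_function (fun x => - f x).
Proof.
by move=> /(smooth_functionZ (-1)); apply: smooth_function_eq => x _; rewrite mulN1r.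
Qed.

Lemma smooth_functionB f g : smooth_function f -> smooth_function g ->
  smooth_function (fun x => f x - g x).
Proof. by move=> sf /smooth_functionN; exact: smooth_functionD. Qed.

Lemma smooth_function_sum (T : Type) (r : seq T) (P : pred T) (F : T -> E -> R) :
  (forall t, P t -> smooth_function (F t)) ->
  smooth_function (fun x => \sum_(t <- r | P t) F t x).
Proof.
move=> sF; elim: r => [|t r IH].
  by under eq_fun do rewrite big_nil; exact: smooth_function_cst.
under eq_fun do rewrite big_cons.
case: (boolP (P t)) => Pt //.
by apply: smooth_functionD => //; exact: sF.
Qed.

Lemma smooth_function_spartial k f : smooth_function f -> smooth_function (spartial k f).
Proof.
move=> sf; apply: (@smooth_function_of_extension _
  ('D_(delta_mx 0 k) (radial_extension f))) => [x _|m].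
  by rewrite spartialE.
by have [_] := smooth_function_upto sf m.+1; exact.
Qed.

Lemma differentiable_radial_extension f x : smooth_function f -> punctured x ->
  differentiable (radial_extension f) x.
Proof. by move=> sf; apply: (smooth_upto_diff (smooth_function_upto sf 0%N)). Qed.

Lemma derivable_radial_extension f x v : smooth_function f -> sphere x ->
  derivable (radial_extension f) x v.
Proof.
move=> sf /sphere_punctured x0; apply: diff_derivable.
exact: differentiable_radial_extension.
Qed.

Lemma spartial_cst k (c : R) x : spartial k (fun=> c) x = 0.
Proof. by rewrite spartialE; exact: derive_cst. Qed.

Lemma spartialD k f g x : smooth_function f -> smooth_function g -> sphere x ->
  spartial k (fun x => f x + g x) x = spartial k f x + spartial k g x.
Proof.
move=> sf sg Sx.
have := deriveD (@derivable_radial_extension f x (delta_mx 0 k) sf Sx)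
  (@derivable_radial_extension g x (delta_mx 0 k) sg Sx).
by rewrite !spartialE; apply: etrans.
Qed.

Lemma spartialM k f g x : smooth_function f -> smooth_function g -> sphere x ->
  spartial k (fun x => f x * g x) x = f x * spartial k g x + g x * spartial k f x.
Proof.
move=> sf sg Sx.
have := deriveM (@derivable_radial_extension f x (delta_mx 0 k) sf Sx)
  (@derivable_radial_extension g x (delta_mx 0 k) sg Sx).
rewrite !radial_extension_sphere// !spartialE; exact.
Qed.

Lemma spartialZ k (c : R) f x : smooth_function f -> sphere x ->
  spartial k (fun x => c * f x) x = c * spartial k f x.
Proof.
move=> sf Sx; rewrite spartialM//; last exact: smooth_function_cst.
by rewrite spartial_cst mulr0 addr0.
Qed.

Lemma spartialN k f x : smooth_function f -> sphere x ->
  spartial k (fun x => - f x) x = - spartial k f x.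
Proof.
move=> sf Sx; rewrite -mulN1r -spartialZ//.
by apply: spartial_eq => // y _; rewrite mulN1r.
Qed.

Lemma spartialB k f g x : smooth_function f -> smooth_function g -> sphere x ->
  spartial k (fun x => f x - g x) x = spartial k f x - spartial k g x.
Proof. by move=> sf sg Sx; rewrite spartialD ?spartialN//; exact: smooth_functionN. Qed.

Lemma spartial_sum k (T : Type) (r : seq T) (P : pred T) (F : T -> E -> R) x :
  (forall t, P t -> smooth_function (F t)) -> sphere x ->
  spartial k (fun x => \sum_(t <- r | P t) F t x) x = \sum_(t <- r | P t) spartial k (F t) x.
Proof.
move=> sF Sx; elim: r => [|t r IH].
  by under eq_fun do rewrite big_nil; rewrite big_nil spartial_cst.
under eq_fun do rewrite big_cons; rewrite big_cons.
case: (boolP (P t)) => Pt //.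
by rewrite spartialD ?IH//; [exact: sF|exact: smooth_function_sum].
Qed.

(** The derivative of y_i / |y| at a unit vector: the matrix of the orthogonal projection onto the
    tangent space. *)
Lemma spartial_coord k i x : sphere x ->
  spartial k (fun y => y 0 i) x = (k == i)%:R - x 0 k * x 0 i.
Proof.
move=> Sx; have x0 := sphere_punctured Sx.
have := derive_coord_comp i (delta_mx 0 k) (differentiable_retraction x0).
rewrite derive_retraction// derive_inv_norm// inv_norm_sphere// !mulr1 scale1r.
rewrite !mxE /= [RHS]/= => E1.
rewrite spartialE /radial_extension -E1 eq_sym /dot (bigD1 k)//= big1 ?addr0; last first.
  by move=> j /negbTE jk; rewrite mxE jk andbF mulr0.
by rewrite mxE !eqxx mulr1 mulNr.
Qed.

Lemma derive_spartial v f x : smooth_function f -> sphere x ->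
  'D_v (radial_extension f) x = \sum_k v 0 k * spartial k f x.
Proof.
move=> sf /sphere_punctured x0; under eq_bigr do rewrite spartialE.
by apply: derive_basis; exact: differentiable_radial_extension.
Qed.

Lemma derive_radial f x : punctured x -> 'D_x (radial_extension f) x = 0.
Proof.
move=> x0; apply: cvg_lim => //; apply: cvg_near_cst; near=> h => /=.
rewrite -{2}(scale1r x) -scalerDl /radial_extension retraction_scale ?subrr ?scaler0//.
have : `|h| < 1 by near: h; exact: dnbhs0_lt.
by rewrite ltr_norml => /andP[h1 _]; rewrite -ltrBlDr sub0r.
Unshelve. all: by end_near. Qed.

Lemma sum_coord_spartial f x : smooth_function f -> sphere x ->
  \sum_k x 0 k * spartial k f x = 0.
Proof.
move=> sf Sx; rewrite -derive_spartial//; apply: derive_radial.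
exact: sphere_punctured.
Qed.

Lemma derive_scale (F : E -> R^o) (c : R) v z : differentiable F z ->
  'D_(c *: v) F z = c * 'D_v F z.
Proof. by move=> dF; rewrite !(deriveE _ dF) linearZ. Qed.

(** The derivatives of a function that is homogeneous of degree 0 are homogeneous of degree -1. In
    the chain rule for F = F o retraction the term along y drops out, as F is constant along
    rays. *)
Lemma derive_radial_extension v f y : smooth_function f -> punctured y ->
  'D_v (radial_extension f) y = inv_norm y * 'D_v (radial_extension f) (retraction y).
Proof.
move=> sf y0; have Sy := sphere_retraction y0.
have dF : differentiable (radial_extension f) (retraction y).
  exact: differentiable_radial_extension sf (sphere_punctured Sy).
have -> : 'D_v (radial_extension f) y = 'D_v (radial_extension f \o @retraction R n) y.
  apply: near_eq_derive; apply: (open_near_eq open_punctured) => // z /set_mem z0.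
  by rewrite /= /radial_extension (retraction_id (sphere_retraction z0)).
rewrite derive_comp_retraction// -(derive_basis y dF).
suff -> : 'D_y (radial_extension f) (retraction y) = 0 by rewrite mulr0 addr0.
have yE : y = (inv_norm y)^-1 *: retraction y.
  by rewrite retractionE scalerA mulVf ?scale1r// gt_eqF// inv_norm_gt0.
have -> := congr1 (fun u => 'D_u (radial_extension f) (retraction y)) yE.
by rewrite derive_scale// derive_radial ?mulr0//; exact: sphere_punctured.
Qed.

(** Off the sphere, d_k F is 1/|y| times the radial extension of [spartial k f]. Differentiating
    this factor in the direction l gives the correction - x_l [spartial k f]; the second derivatives
    of F itself commute. *)
Lemma spartial_comm k l f x : smooth_function f -> sphere x ->
  spartial l (spartial k f) x - spartial k (spartial l f) x =
  x 0 l * spartial k f x - x 0 k * spartial l f x.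
Proof.
move=> sf Sx; have x0 := sphere_punctured Sx.
have E2 i j : 'D_(delta_mx 0 i) ('D_(delta_mx 0 j) (radial_extension f)) x =
    spartial i (spartial j f) x - x 0 i * spartial j f x.
  have sj := smooth_function_spartial j sf.
  have -> : 'D_(delta_mx 0 i) ('D_(delta_mx 0 j) (radial_extension f)) x =
            'D_(delta_mx 0 i) (inv_norm * radial_extension (spartial j f)) x.
    apply: near_eq_derive; apply: (open_near_eq open_punctured) => // y /set_mem y0.
    transitivity (inv_norm y * radial_extension (spartial j f) y) => //.
    by rewrite [radial_extension (spartial j f) y]spartialE; exact: derive_radial_extension.
  have dr : derivable inv_norm x (delta_mx 0 i).
    by apply: diff_derivable; exact: differentiable_inv_norm.
  rewrite (deriveM dr (@derivable_radial_extension _ x (delta_mx 0 i) sj Sx)) derive_inv_norm//.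
  rewrite radial_extension_sphere// inv_norm_sphere// !mulr1 /GRing.scale/= mul1r.
  congr (_ + _); first by rewrite spartialE.
  rewrite mulrN mulrC; congr (- (_ * _)).
  rewrite /dot (bigD1 i)//= big1 ?addr0; last first.
    by move=> m /negbTE mi; rewrite mxE mi andbF mulr0.
  by rewrite mxE !eqxx mulr1.
have := smooth_function_upto sf 3%N; set F := radial_extension f => -[dF /= ddF].
have c i j : {for x, continuous ('D_(delta_mx 0 i) ('D_(delta_mx 0 j) F))}.
  apply: differentiable_continuous.
  by have [_ /(_ (delta_mx 0 i))[]] := ddF (delta_mx 0 j); move=> + _; exact.
have d1 i y : punctured y -> differentiable ('D_(delta_mx 0 i) F) y.
  by have [] := ddF (delta_mx 0 i); move=> + _; exact.
have := derive_comm open_punctured x0 dF (d1 k) (d1 l) (c l k) (c k l).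
have lin (a b p q : R) : a - p = b - q -> a - b = p - q.
  by move=> /eqP; rewrite subr_eq => /eqP ->; ring.
move=> DD; apply: lin.
exact: (etrans (esym (E2 l k)) (etrans DD (E2 k l))).
Qed.

End SphericalCalculus.

(** * Integration over the sphere *)

Section SphericalMeasure.
Context {R : realType} {n : nat}.
Local Notation E := ('rV[R]_n.+1).
Implicit Types (f g : E -> R) (x y v w : E) (k l i j : 'I_n.+1).
Context (mu : {measure set (borel_space R n) -> \bar R}) (hmu : riemannian_measure mu).

Lemma open_borel_measurable (U : set E) : open U -> measurable (U : set (borel_space R n)).
Proof. by move=> oU; apply: sub_sigma_algebra. Qed.

Lemma closed_sphere : closed (@sphere R n).
Proof.
have -> : @sphere R n = (fun x : E => dot x x : R) @^-1` [set 1] by [].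
apply: preimage_closed; last first.
  by apply: accessible_closed_set1; apply: hausdorff_accessible; exact: norm_hausdorff.
by move=> x _; apply: differentiable_continuous; exact: differentiable_dot.
Qed.

Lemma sphere_bounded : bounded_set (@sphere R n).
Proof.
exists 1; split => // M M1 x Sx /=; apply: le_trans (ltW M1).
change (mx_norm (x : 'rV[R]_n.+1) <= 1).
have [->//|/mx_norm_neq0[[i j] /= ->]] := eqVneq (mx_norm (x : 'rV[R]_n.+1)) 0.
rewrite ord1 -(ler_pXn2r (ltn0Sn 1))// ?nnegrE// expr1n real_normK ?num_real//.
move: Sx; rewrite /sphere /dot /= => <-; rewrite (bigD1 j)//= -expr2 lerDl.
by apply: sumr_ge0 => k _; rewrite -expr2 sqr_ge0.
Qed.

Lemma compact_sphere : compact (@sphere R n).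
Proof. by apply: bounded_closed_compact; [exact: sphere_bounded|exact: closed_sphere]. Qed.

Lemma measurable_sphere : measurable (@sphere R n : set (borel_space R n)).
Proof.
rewrite -[X in measurable X]setCK; apply: measurableC; apply: open_borel_measurable.
by apply: closed_openC; exact: closed_sphere.
Qed.

Lemma continuous_measurable_borel (U : set E) (F : E -> R) : open U ->
  {in U, continuous F} -> measurable_fun (U : set (borel_space R n)) (F : borel_space R n -> R).
Proof.
move=> oU cF; apply: (measurability _ (measurable_realfun.RGenOpens.measurableE R)).
move=> _ [_ [a [b ->] <-]]; apply: open_borel_measurable.
rewrite openE => x [Ux xab]; apply: filterI; first by apply: open_nbhs_nbhs.
have := cF x (mem_set Ux); apply.
by apply: open_nbhs_nbhs; split => //; exact: interval_open.
Qed.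

Lemma continuous_radial_extension f x : smooth_function f -> punctured x ->
  {for x, continuous (radial_extension f)}.
Proof.
by move=> sf x0; apply: differentiable_continuous; exact: differentiable_radial_extension.
Qed.

Lemma measurable_smooth_function f : smooth_function f ->
  measurable_fun (sphere : set (borel_space R n)) (f : borel_space R n -> R).
Proof.
move=> sf; apply: (@eq_measurable_fun _ _ (borel_space R n) _ _ (radial_extension f)).
  by move=> x /set_mem Sx; rewrite radial_extension_sphere.
apply: (@measurable_funS _ _ (borel_space R n) _ punctured).
- by apply: open_borel_measurable; exact: open_punctured.
- exact: sphere_punctured.
apply: continuous_measurable_borel; first exact: open_punctured.
by move=> x /set_mem x0; exact: continuous_radial_extension.
Qed.

Lemma sphere_nonempty : (@sphere R n) !=set0.
Proof.
exists (delta_mx 0 0); rewrite /sphere/= /dot (bigD1 0)//= big1 ?addr0 => [|j j0].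
  by rewrite mxE !eqxx mulr1.
by rewrite mxE (negbTE j0) andbF mul0r.
Qed.

Lemma smooth_function_bounded f : smooth_function f ->
  exists M : R, forall x, sphere x -> `|f x| <= M.
Proof.
move=> sf.
have cf : {within @sphere R n, continuous (fun x => `|radial_extension f x|)}.
  apply: continuous_in_subspaceT => x /set_mem Sx.
  have c := continuous_radial_extension sf (sphere_punctured Sx : punctured x).
  exact: cvg_norm c.
have [c _ cM] := EVT_max_rV sphere_nonempty compact_sphere cf.
exists `|radial_extension f c| => x Sx.
by have := cM x (mem_set Sx); rewrite radial_extension_sphere.
Qed.

Lemma integrable_smooth_function f : smooth_function f ->
  mu.-integrable sphere (EFin \o f).
Proof.
move=> sf; have [_ _ fin _] := hmu.
apply: measurable_bounded_integrable => //; first exact: measurable_sphere.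
  exact: measurable_smooth_function.
have [M fM] := smooth_function_bounded sf.
exists M; split; first exact: num_real.
by move=> r Mr x Sx /=; apply: le_trans (fM x Sx) (ltW Mr).
Qed.

Local Notation SI f := (\int[mu]_(x in sphere) f x).

Lemma eq_sphere_integral f g : (forall x, sphere x -> f x = g x) -> SI f = SI g.
Proof. by move=> fg; apply: eq_Rintegral => x /set_mem; exact: fg. Qed.

Lemma sphere_integralD f g : smooth_function f -> smooth_function g ->
  SI (fun x => f x + g x) = SI f + SI g.
Proof.
move=> sf sg; apply: RintegralD; [exact: measurable_sphere| |];
exact: integrable_smooth_function.
Qed.

Lemma sphere_integralB f g : smooth_function f -> smooth_function g ->
  SI (fun x => f x - g x) = SI f - SI g.
Proof.
move=> sf sg; apply: RintegralB; [exact: measurable_sphere| |];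
exact: integrable_smooth_function.
Qed.

Lemma sphere_integralZ (c : R) f : smooth_function f -> SI (fun x => c * f x) = c * SI f.
Proof.
move=> sf; apply: RintegralZl; [exact: measurable_sphere|].
exact: integrable_smooth_function.
Qed.

Lemma sphere_integral0 : SI (fun=> 0) = 0.
Proof.
rewrite -[RHS](mul0r (SI (fun=> 0))) -sphere_integralZ; last exact: smooth_function_cst.
by apply: eq_sphere_integral => x _; rewrite mul0r.
Qed.

Lemma sphere_integral_sum (T : Type) (r : seq T) (P : pred T) (F : T -> E -> R) :
  (forall t, P t -> smooth_function (F t)) ->
  SI (fun x => \sum_(t <- r | P t) F t x) = \sum_(t <- r | P t) SI (F t).
Proof.
move=> sF; elim: r => [|t r IH].
  by rewrite big_nil -[RHS]sphere_integral0; apply: eq_sphere_integral => x _; rewrite big_nil.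
rewrite big_cons; under eq_Rintegral do rewrite big_cons.
case: (boolP (P t)) => Pt //.
by rewrite sphere_integralD ?IH//; [exact: sF|exact: smooth_function_sum].
Qed.

(** * Orthogonal invariance and integration by parts *)

Lemma dot_mulmx x y : dot x y = (x *m y^T) 0 0.
Proof. by rewrite mxE; apply: eq_bigr => i _; rewrite mxE. Qed.

Lemma dot_orthogonal (g : 'M[R]_n.+1) x y : g *m g^T = 1%:M ->
  dot (x *m g) (y *m g) = dot x y.
Proof. by move=> gg; rewrite !dot_mulmx trmx_mul mulmxA -(mulmxA x) gg mulmx1. Qed.

Lemma sphere_orthogonal (g : 'M[R]_n.+1) x : g *m g^T = 1%:M ->
  sphere (x *m g) = sphere x.
Proof. by move=> gg; rewrite /sphere/= dot_orthogonal. Qed.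

Lemma continuous_mulmxr (g : 'M[R]_n.+1) : continuous (fun x : E => x *m g).
Proof.
move=> x; apply: differentiable_continuous.
have -> : (fun x : E => x *m g) = \sum_i (fun x : E => x 0 i *: row i g).
  by apply/funext => y; rewrite mulmx_sum_row fct_sumE.
apply: differentiable_sum => i; apply: differentiableZl.
exact: differentiable_coord.
Qed.

Lemma measurable_mulmxr (g : 'M[R]_n.+1) :
  measurable_fun [set: borel_space R n] (fun x : E => x *m g : borel_space R n).
Proof.
apply: (@measurability _ _ _ (borel_space R n) _ _ (@open 'rV[R]_n.+1)) => //.
move=> _ [U oU <-]; rewrite setTI; apply: open_borel_measurable.
by move/continuousP : (@continuous_mulmxr g); exact.
Qed.

Lemma sphere_integral_orthogonal (g : 'M[R]_n.+1) f : g *m g^T = 1%:M -> smooth_function f ->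
  smooth_function (fun x => f (x *m g)) ->
  SI (fun x => f (x *m g)) = SI f.
Proof.
move=> gg sf sfg; have [_ _ _ inv] := hmu.
(* The cut-off at the sphere is measurable on the whole space, as the change of variables for an
   image measure requires. *)
pose F : borel_space R n -> \bar R := (EFin \o f) \_ sphere.
have mF : measurable_fun [set: borel_space R n] (((EFin \o f) : borel_space R n -> \bar R) \_ sphere).
  apply/(measurable_restrictT _ measurable_sphere).
  by apply/measurable_EFinP; exact: measurable_smooth_function.
have Spre : (fun x : E => x *m g : borel_space R n) @^-1` sphere = sphere.
  by apply/seteqP; split => x /=; rewrite -(sphere_orthogonal x gg).
have FE : forall x, sphere x -> F x = (f x)%:E.
  by move=> x Sx; rewrite /F patchE mem_set.
have H := @integral_pushforward _ _ _ _ R _ (measurable_mulmxr g) mu sphere F mF.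
rewrite Spre in H.
congr fine.
transitivity (\int[mu]_(x in sphere) (F \o (fun x : E => x *m g : borel_space R n)) x)%E.
  by apply: eq_integral => x /set_mem Sx; rewrite /= FE// sphere_orthogonal.
rewrite -H; last 2 first.
- apply: eq_integrable (integrable_smooth_function sfg); first exact: measurable_sphere.
  by move=> x /set_mem Sx; rewrite /= FE// sphere_orthogonal.
- exact: measurable_sphere.
transitivity (\int[mu]_(y in sphere) F y)%E.
  apply: eq_measure_integral; first exact: measurable_mulmxr.
  by move=> ? A mA _; exact: (inv g gg A mA).
by apply: eq_integral => x /set_mem Sx; rewrite FE.
Qed.

Lemma derive_mulmxr (g : 'M[R]_n.+1) (F : E -> R^o) v x :
  'D_v (fun y => F (y *m g)) x = 'D_(v *m g) F (x *m g).
Proof.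
rewrite /derive (_ : (fun h : R => _) =
  (fun h : R => h^-1 *: ((F \o shift (x *m g)) (h *: (v *m g)) - F (x *m g))))//.
by apply/funext => h /=; rewrite mulmxDl scalemxAl.
Qed.

Lemma smooth_upto_mulmxr (g : 'M[R]_n.+1) m (U : set E) (F : E -> R^o) :
  smooth_upto m U F -> smooth_upto m [set y | U (y *m g)] (fun y => F (y *m g)).
Proof.
have dg x : differentiable (fun y : E => y *m g) x.
  have -> : (fun x : E => x *m g) = \sum_i (fun x : E => x 0 i *: row i g).
    by apply/funext => y; rewrite mulmx_sum_row fct_sumE.
  by apply: differentiable_sum => i; apply: differentiableZl; exact: differentiable_coord.
have dc (G : E -> R^o) x : differentiable G (x *m g) -> differentiable (fun y => G (y *m g)) x.
  by move=> dG; apply: (@differentiable_comp _ _ _ _ (fun y : E => y *m g) G).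
elim: m F => [|m IH] F [dF sF]; split => //; try by move=> x Ux; apply: dc; exact: dF.
move=> v; have -> : 'D_v (fun y => F (y *m g)) = (fun y => 'D_(v *m g) F (y *m g)).
  by apply/funext => y; exact: derive_mulmxr.
exact: (IH ('D_(v *m g) F) (sF _)).
Qed.

Lemma smooth_function_orthogonal (g : 'M[R]_n.+1) f : g *m g^T = 1%:M ->
  smooth_function f -> smooth_function (fun x => f (x *m g)).
Proof.
move=> gg sf.
apply: (@smooth_function_of_extension _ _ _ (fun y => radial_extension f (y *m g))).
  by move=> x Sx; rewrite radial_extension_sphere// sphere_orthogonal.
move=> m; apply: (@smooth_upto_sub _ _ _ [set y | punctured (y *m g)]).
  move=> y /=; rewrite /punctured /= => y0; rewrite -dot_eq0 dot_orthogonal// dot_eq0//.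
exact/smooth_upto_mulmxr/smooth_function_upto.
Qed.

(** Rotation by t in the plane of e_i and e_j, written as 1 + (cos t - 1) P + (sin t) J with P the
    projection onto that plane and J the quarter turn in it. *)
Definition rotation i j (t : R) : 'M[R]_n.+1 := 1%:M +
  ((cos t - 1) *: (delta_mx i i + delta_mx j j) + sin t *: (delta_mx i j - delta_mx j i)).

(** From P^2 = P, P J = J P = J and J^2 = - P, the product is 1 + (cos^2 t + sin^2 t - 1) P. *)
Lemma rotation_orthogonal i j t : i != j -> rotation i j t *m (rotation i j t)^T = 1%:M.
Proof.
move=> ij; rewrite /rotation.
set B := (delta_mx i i + _); set A := (delta_mx i j - _).
have BT : B^T = B by rewrite /B linearD /= !trmx_delta.
have AT : A^T = - A by rewrite /A linearB /= !trmx_delta opprB.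
have ji : j != i by rewrite eq_sym.
have dij p q : delta_mx p i *m delta_mx j q = 0 :> 'M[R]_n.+1 by exact: mul_delta_mx_0.
have dji p q : delta_mx p j *m delta_mx i q = 0 :> 'M[R]_n.+1 by exact: mul_delta_mx_0.
have BB : B *m B = B.
  by rewrite /B mulmxDl !mulmxDr !dij !dji !mul_delta_mx addr0 add0r.
have AB : A *m B = A.
  by rewrite /A /B mulmxBl !mulmxDr !dij !dji !mul_delta_mx addr0 add0r.
have BA : B *m A = A.
  by rewrite /A /B mulmxDl !mulmxBr !dij !dji !mul_delta_mx subr0 sub0r.
have AA : A *m A = - B.
  by rewrite /A /B mulmxBl !mulmxBr !dij !dji !mul_delta_mx sub0r subr0 opprD addrC.
clearbody A B.
have -> : (1%:M + ((cos t - 1) *: B + sin t *: A))^T = 1%:M + ((cos t - 1) *: B + sin t *: - A).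
  rewrite [LHS]raddfD /= trmx1; congr (_ + _).
  apply/matrixP => p q; move: (congr1 (fun M : 'M[R]_n.+1 => M p q) BT) (congr1 (fun M : 'M[R]_n.+1 => M p q) AT).
  by rewrite !mxE => -> ->.
rewrite mulmxDl mul1mx mulmxDl !mulmxDr !mulmx1 -!scalemxAl -!scalemxAr.
rewrite !mulmxN BB AB BA AA opprK.
rewrite -[RHS]addr0 -!addrA; congr (_ + _).
have := cos2Dsin2 t; set c := cos t; set s := sin t => cs.
apply/matrixP => p q; rewrite !mxE; apply/eqP.
rewrite -subr_eq0 subr0 (_ : _ + _ = (c ^+ 2 + s ^+ 2 - 1) * B p q); last by ring.
by rewrite cs subrr mul0r.
Qed.

Lemma mulmx_rotation i j t x : x *m rotation i j t = x +
  ((cos t - 1) *: (x 0 i *: delta_mx 0 i + x 0 j *: delta_mx 0 j) +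
   sin t *: (x 0 i *: delta_mx 0 j - x 0 j *: delta_mx 0 i)).
Proof.
have xd p q : x *m delta_mx p q = x 0 p *: delta_mx 0 q.
  apply/rowP => m; rewrite !mxE (bigD1 p)//= big1 ?addr0 => [|r /negbTE rp].
    by rewrite mxE eqxx.
  by rewrite mxE rp mulr0.
by rewrite /rotation !mulmxDr mulmx1 -!scalemxAr mulmxDr mulmxBr !xd.
Qed.

Definition rotation_field i j f x : R := x 0 i * spartial j f x - x 0 j * spartial i f x.

Lemma sum_basis_pair (a b : R) i j (F : 'I_n.+1 -> R) :
  \sum_k (a *: delta_mx 0 j - b *: delta_mx 0 i : E) 0 k * F k = a * F j - b * F i.
Proof.
under eq_bigr => k _ do rewrite !mxE /= mulrBl.
rewrite sumrB (bigD1 j)//= big1 => [|k /negbTE kj]; last by rewrite kj mulr0 mul0r.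
rewrite (bigD1 i)//= big1 => [|k /negbTE ki]; last by rewrite ki mulr0 mul0r.
by rewrite !eqxx !mulr1 !addr0.
Qed.

Lemma derive_scalel (k : R -> R) (v : E) (t : R) : differentiable k t ->
  'D_1 (fun s => k s *: v) t = 'D_1 k t *: v.
Proof.
by move=> dk; rewrite (deriveE _ (differentiableZl v dk)) (diffZl v dk) -(deriveE _ dk).
Qed.

(** The velocity of the orbit is the quarter turn of the (i, j) component of the current position,
    so the derivative depends on t only through the point reached. *)
Lemma is_derive_rotation i j f x (t : R) : i != j -> smooth_function f -> sphere x ->
  is_derive t 1 (fun s : R => f (x *m rotation i j s))
    (rotation_field i j f (x *m rotation i j t)).
Proof.
move=> ij sf Sx.
have Sr s : sphere (x *m rotation i j s) by rewrite sphere_orthogonal// rotation_orthogonal.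
pose gam s : E := x *m rotation i j s.
pose u : E := x 0 i *: delta_mx 0 i + x 0 j *: delta_mx 0 j.
pose w : E := x 0 i *: delta_mx 0 j - x 0 j *: delta_mx 0 i.
have dcos : differentiable (fun s : R => cos s - 1 : R) t.
  by apply/derivable1_diffP; apply: derivableB => //; exact: derivable_cst.
have dsin : differentiable (sin : R -> R) t by apply/derivable1_diffP.
have gamE : gam = cst x + ((fun s => (cos s - 1) *: u) + (fun s => sin s *: w)).
  by apply/funext => s; rewrite /gam mulmx_rotation.
have dgam : differentiable gam t.
  rewrite gamE; apply: differentiableD; first exact: differentiable_cst.
  by apply: differentiableD; exact: differentiableZl.
have Dgam : 'D_1 gam t = (- sin t) *: u + cos t *: w.
  rewrite gamE deriveD; last 2 first.
  - exact: derivable_cst.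
  - by apply: diff_derivable; apply: differentiableD; exact: differentiableZl.
  rewrite derive_cst add0r deriveD; try by apply: diff_derivable; exact: differentiableZl.
  rewrite (derive_scalel u dcos) (derive_scalel w dsin).
  have -> : 'D_1 (fun s : R => cos s - 1) t = - sin t.
    rewrite (@deriveB _ _ _ cos (cst 1)) ?derive_cst ?subr0 ?derive_val//.
  by rewrite derive_val.
have dF : differentiable (radial_extension f) (gam t).
  by apply: differentiable_radial_extension => //; apply: sphere_punctured; exact: Sr.
have -> : (fun s => f (x *m rotation i j s)) = radial_extension f \o gam.
  by apply/funext => s; rewrite /= radial_extension_sphere//; exact: Sr.
have dcomp := differentiable_comp dgam dF.
apply: DeriveDef; first exact: diff_derivable.
rewrite (deriveE _ dcomp) (diff_comp dgam dF) /= -(deriveE _ dgam) -(deriveE _ dF) Dgam.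
rewrite derive_spartial//; last exact: Sr.
have -> : - sin t *: u + cos t *: w = gam t 0 i *: delta_mx 0 j - gam t 0 j *: delta_mx 0 i.
  have ji : (j == i) = false by rewrite eq_sym (negbTE ij).
  have gi : gam t 0 i = cos t * x 0 i - sin t * x 0 j.
    by rewrite /gam mulmx_rotation !mxE !eqxx (negbTE ij) ?ji /=; ring.
  have gj : gam t 0 j = cos t * x 0 j + sin t * x 0 i.
    by rewrite /gam mulmx_rotation !mxE !eqxx ji ?(negbTE ij) /=; ring.
  by rewrite gi gj; apply/rowP => k; rewrite !mxE; ring.
rewrite /rotation_field -/(gam t).
exact: sum_basis_pair.
Qed.

(** The integral of f (x R_t) over the sphere does not depend on t; its derivative at t = 0 is taken
    under the integral sign, dominated by a bound of the smooth rotation field on the sphere. *)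
Lemma sphere_integral_rotation_field i j f : i != j -> smooth_function f ->
  SI (rotation_field i j f) = 0.
Proof.
move=> ij sf.
have sL : smooth_function (rotation_field i j f).
  apply: smooth_functionB; apply: smooth_functionM; try exact: smooth_function_coord;
  exact: smooth_function_spartial.
have [M fM] := smooth_function_bounded sL.
have I0 : `](-1), 1[%classic (0 : R) by rewrite /= in_itv/=; apply/andP; split; lra.
have Sr s x : sphere x -> sphere (x *m rotation i j s).
  by move=> Sx; rewrite sphere_orthogonal// rotation_orthogonal.
have int s : mu.-integrable sphere (EFin \o (fun x => f (x *m rotation i j s))).
  apply: integrable_smooth_function; apply: smooth_function_orthogonal => //.
  exact: rotation_orthogonal.
have H := @differentiation_under_integral R _ (borel_space R n) mu
  (fun s x => f (x *m rotation i j s)) sphere measurable_sphere 0 (-1) 1 I0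
  (fun s _ => int s)
  (fun s x _ Sx => @ex_derive _ _ _ _ _ _ _ (is_derive_rotation s ij sf Sx))
  (fun=> `|M|) (fun=> normr_ge0 M) (integrable_smooth_function (smooth_function_cst `|M|)) _.
have dE s x : sphere x -> partial1of2 (fun s x => f (x *m rotation i j s)) s x =
    rotation_field i j f (x *m rotation i j s).
  by move=> Sx; rewrite partial1of2E; have [_] := is_derive_rotation s ij sf Sx.
have := H _ => {H} H.
transitivity (\int[mu]_(y in sphere)
   (partial1of2 (fun s x => f (x *m rotation i j s)))^~ y 0).
  apply: eq_sphere_integral => x Sx /=; rewrite dE// mulmx_rotation cos0 sin0 subrr !scale0r !addr0//.
rewrite -H.
  rewrite (_ : (fun s => _) = cst (SI f)) ?derive1_cst//.
  apply/funext => s; apply: sphere_integral_orthogonal => //; first exact: rotation_orthogonal.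
  by apply: smooth_function_orthogonal => //; exact: rotation_orthogonal.
by move=> s x _ Sx; rewrite dE// (le_trans (fM _ (Sr _ _ Sx)))// ler_norm.
Qed.

(* With L_jk the rotation field x_j d_k - x_k d_j,
   sum_j L_jk (x_j f) = d_k f - n x_k f, and rotation fields integrate to 0. *)
Lemma sphere_integral_spartial k f : smooth_function f ->
  SI (spartial k f) = n%:R * SI (fun x => x 0 k * f x).
Proof.
move=> sf; have sc := @smooth_function_coord R n.
have sxf j : smooth_function (fun x => x 0 j * f x) by exact: smooth_functionM.
have sd j := smooth_function_spartial j sf.
rewrite -sphere_integralZ//; apply/eqP; rewrite -subr_eq0 -sphere_integralB//; last exact: smooth_functionZ.
have <- : SI (fun x => \sum_j rotation_field j k (fun y => y 0 j * f y) x) = 0.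
  rewrite sphere_integral_sum; last first.
    move=> j _; apply: smooth_functionB; apply: smooth_functionM => //;
    exact: smooth_function_spartial.
  rewrite big1 // => j _; have [->|jk] := eqVneq j k; last exact: sphere_integral_rotation_field.
  by rewrite -[RHS]sphere_integral0; apply: eq_sphere_integral => x _; rewrite /rotation_field subrr.
apply/eqP; apply: eq_sphere_integral => x Sx; rewrite /rotation_field.
under eq_bigr => j _ do rewrite !spartialM// !spartial_coord// eqxx.
have S1 : \sum_j x 0 j * x 0 j = 1 by exact: Sx.
have S2 := sum_coord_spartial sf Sx.
(* The Kronecker terms add up to x_k f. Against the n + 1 terms - x_k f this leaves the factor n. *)
transitivity (\sum_j ((x 0 j * x 0 j) * spartial k f x + (k == j)%:R * x 0 j * f x
   - x 0 k * f x - x 0 k * (x 0 j * spartial j f x))); last first.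
  apply: eq_bigr => j _; rewrite (_ : true%:R = 1 :> R)//.
  by move: (x 0 j) (x 0 k) (spartial k f x) (spartial j f x) (f x) ((k == j)%:R : R) => a b c d e q; ring.
rewrite !sumrB big_split /= -!mulr_suml S1 mul1r -mulr_sumr S2 mulr0 subr0.
rewrite sumr_const card_ord (bigD1 k)//= eqxx mul1r big1 ?addr0; last first.
  by move=> j /negbTE jk; rewrite eq_sym jk mul0r.
by rewrite mulrSr -(mulr_natl (x 0 k) n); ring.
Qed.

(* The reflection in the hyperplane orthogonal to [q - p] exchanges [p] and [q]. *)
Lemma orthogonal_transitive p q : sphere p -> sphere q ->
  exists2 g : 'M[R]_n.+1, g *m g^T = 1%:M & q *m g = p.
Proof.
rewrite /sphere/= => Sp Sq; have [->|qp] := eqVneq q p.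
  by exists 1%:M; rewrite ?trmx1 mulmx1.
pose v : E := q - p; have v0 : dot v v != 0 by rewrite dot_eq0 subr_eq0.
have vE : v = q - p by [].
clearbody v.
have vv : v *m v^T = (dot v v)%:M.
  by rewrite [LHS]mx11_scalar dot_mulmx.
pose c := 2 / dot v v.
have cd : c * dot v v = 2 by rewrite /c divfK.
have HT : (1%:M - c *: (v^T *m v))^T = 1%:M - c *: (v^T *m v).
  by rewrite linearB /= trmx1 linearZ /= trmx_mul trmxK.
exists (1%:M - c *: (v^T *m v)).
  rewrite HT mulmxBl mul1mx mulmxBr mulmx1 -scalemxAl -scalemxAr mulmxA.
  rewrite -(mulmxA v^T v v^T) vv mul_mx_scalar -scalemxAl.
  rewrite !scalerA.
  by rewrite cd mulr_natr mulr2n scalerDl opprB addrK subrK.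
rewrite mulmxBr mulmx1 -scalemxAr mulmxA.
have -> : q *m v^T = (dot q v)%:M.
  by rewrite [LHS]mx11_scalar dot_mulmx.
rewrite mul_scalar_mx scalerA.
suff -> : c * dot q v = 1 by rewrite scale1r vE opprB addrC subrK.
have Evv : dot v v = 2 * dot q v.
  by rewrite vE -(scaleN1r p) dotDl !dotDr !dotZl !dotZr Sp Sq (dotC p q); ring.
by rewrite /c Evv mulrAC mulfV// -Evv.
Qed.

Lemma negligible_seq_cover (W : E -> set E) (s : seq E) :
  (forall q, sphere q -> mu.-negligible (W q `&` sphere : set (borel_space R n))) ->
  (forall q, q \in s -> sphere q) ->
  mu.-negligible ([set x | sphere x /\ exists2 q, q \in s & W q x] : set (borel_space R n)).
Proof.
move=> W0; elim: s => [|q s IH] Ss.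
  by apply: negligibleS (negligible_set0 mu) => x /= [_ []].
apply: (negligibleS _ (negligibleU (W0 q (Ss q (mem_head _ _)))
  (IH (fun r rs => Ss r (mem_behead (s := q :: s) rs))))).
move=> x /= [Sx [r]]; rewrite inE => /orP[/eqP -> Wx|rs Wx]; first by left.
by right; split => //; exists r.
Qed.

(* If [f p > 0], a ball around [p] is negligible; so are its rotated copies,
   finitely many of which cover the sphere. *)
Lemma sphere_integral_eq0 f : smooth_function f -> (forall x, sphere x -> 0 <= f x) ->
  SI f = 0 -> forall x, sphere x -> f x = 0.
Proof.
move=> sf f0 If p Sp; apply/eqP; rewrite eq_le f0// andbT leNgt; apply/negP => fp.
have mS := measurable_sphere; have intf := integrable_smooth_function sf.
have ae : ae_eq mu sphere (EFin \o f) (cst 0%E).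
  apply/ae_eq_integral_abs => //.
    by apply/measurable_EFinP; exact: measurable_smooth_function.
  transitivity (\int[mu]_(x in sphere) (EFin \o f) x)%E.
    apply: eq_integral; move=> x /set_mem Sx; by rewrite /= ger0_norm// f0.
  by rewrite -(fineK (integrable_fin_num mS intf)) -[fine _]/(SI f) If.
(* The neighbourhood is described by [dot] rather than by the norm of row vectors, which is the
   maximum norm: orthogonal maps carry the former to a neighbourhood of the same kind around another
   point. *)
have [r r0 rV] : exists2 r : R, 0 < r &
    forall x, sphere x -> dot (x - p) (x - p) < r -> f x != 0.
  have cp := continuous_radial_extension sf (sphere_punctured Sp).
  have : nbhs p [set x | 0 < radial_extension f x].
    apply: (cp [set z : R | 0 < z]); apply: open_nbhs_nbhs; split; first exact: open_gt.
    by rewrite /= radial_extension_sphere.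
  move=> /nbhs_ballP[d /= d0 dV]; exists (d ^+ 2); first by rewrite exprn_gt0.
  move=> x Sx xp; rewrite gt_eqF// -(radial_extension_sphere f Sx).
  apply: dV; rewrite -ball_normE /= distrC.
  change (mx_norm (x - p : 'rV[R]_n.+1) < d).
  have [->//|/mx_norm_neq0[[i j] /= ->]] := eqVneq (mx_norm (x - p : 'rV[R]_n.+1)) 0.
  rewrite ord1 -(ltr_pXn2r (ltn0Sn 1)) ?nnegrE ?(ltW d0)//.
  rewrite real_normK ?num_real// (le_lt_trans _ xp)// /dot (bigD1 j)//= -expr2 lerDl.
  by apply: sumr_ge0 => k _; rewrite -expr2 sqr_ge0.
pose W (q : E) : set E := [set x | dot (x - q) (x - q) < r].
have oW (q : E) : open (W q).
  have -> : W q = (fun x : E => dot (x - q) (x - q) : R^o) @^-1` [set z | z < r] by [].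
  apply: open_comp; last exact: open_lt.
  by move=> x _; apply: differentiable_continuous; exact: (@differentiable_shift _ _ (fun z : E => dot z z : R^o) x (- q) (differentiable_dot _)).
have Wp : mu.-negligible (W p `&` sphere : set (borel_space R n)).
  apply: negligibleS ae => x /= [Wx Sx] /(_ Sx) [] /eqP.
  by rewrite (negbTE (rV x Sx Wx)).
have mWS q : measurable (W q `&` sphere : set (borel_space R n)).
  by apply: measurableI => //; exact: open_borel_measurable.
have Wq q : sphere q -> mu.-negligible (W q `&` sphere : set (borel_space R n)).
  move=> Sq; have [g gg qp] := orthogonal_transitive Sp Sq.
  apply/(negligibleP _ (mWS q)).
  have [_ _ _ inv] := hmu.
  have <- : [set x : E | (W p `&` sphere) (x *m g)] = W q `&` sphere.
    apply/seteqP; split => x /=; rewrite sphere_orthogonal// /W/= -qp -mulmxBl dot_orthogonal//.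
  apply: (etrans (inv g gg _ (mWS p))).
  by apply/(negligibleP _ (mWS p)).
have := compact_sphere; rewrite compact_cover => /(_ _ sphere W (fun q _ => oW q)) [].
  move=> x Sx; exists x => //=; rewrite /W/= subrr /dot big1// => i _.
  by rewrite mxE mul0r.
move=> D DS Dcov.
have := negligible_seq_cover (s := finmap.enum_fset D) Wq (fun q qD => set_mem (DS q qD)).
move=> N0; have : mu.-negligible (sphere : set (borel_space R n)).
  apply: negligibleS N0 => x Sx; split => //.
  by have [q /= qD Wx] := Dcov x Sx; exists q.
move=> /(negligibleP _ mS) mu0; have [_ + _ _] := hmu.
by rewrite mu0 ltxx.
Qed.

End SphericalMeasure.

(** * Differential forms on the sphere *)

HB.lock Definition dform {R : realType} {n : nat} (k : 'I_n.+1)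
  (s : 'rV[R]_n.+1 -> extalg R n) (x : 'rV[R]_n.+1) : extalg R n :=
  flat_derivative (delta_mx 0 k) s x.

Section FormCalculus.
Context {R : realType} {n : nat}.
Local Notation E := ('rV[R]_n.+1).
Local Notation interior := Defs.interior.
Local Notation scalar := Defs.scalar.
Implicit Types (f g : E -> R) (x y v w : E) (k l i j : 'I_n.+1).
Implicit Types (s t : E -> extalg R n) (a b : extalg R n) (I J : {set 'I_n.+1}).

(** Unlike in [smooth_section], the values need not be tangential: the flat derivative of a
    tangential form generally has a normal part. *)
Definition smooth_form s := forall I, smooth_function (fun x => s x I).

Lemma dformE k s x I : dform k s x I = spartial k (fun y => s y I) x.
Proof. by rewrite unlock ffunE spartialE. Qed.

Lemma flat_derivative_delta k s x : flat_derivative (delta_mx 0 k) s x = dform k s x.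
Proof. by rewrite unlock. Qed.

Lemma flat_derivative_sum v s x : smooth_form s -> sphere x ->
  flat_derivative v s x = \sum_k v 0 k *: dform k s x.
Proof.
move=> ss Sx; apply/ffunP => I; rewrite ffunE sum_ffunE.
rewrite [LHS](derive_spartial v (ss I) Sx); apply: eq_bigr => k _.
by rewrite extZE dformE.
Qed.

Lemma dform_eq k s t x : (forall y, sphere y -> s y = t y) -> sphere x ->
  dform k s x = dform k t x.
Proof.
by move=> st Sx; apply/ffunP => I; rewrite !dformE; apply: spartial_eq => // y /st ->.
Qed.

Lemma smooth_form_eq s t : (forall y, sphere y -> s y = t y) ->
  smooth_form s -> smooth_form t.
Proof. by move=> st ss I; apply: smooth_function_eq (ss I) => x /st ->. Qed.

Lemma smooth_form_cst a : smooth_form (fun=> a).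
Proof. by move=> I; exact: smooth_function_cst. Qed.

Lemma smooth_formD s t : smooth_form s -> smooth_form t -> smooth_form (fun x => s x + t x).
Proof.
move=> ss st I; apply: smooth_function_eq (smooth_functionD (ss I) (st I)) => x _.
by rewrite extDE.
Qed.

Lemma smooth_formZ f s : smooth_function f -> smooth_form s -> smooth_form (fun x => f x *: s x).
Proof.
move=> sf ss I; apply: smooth_function_eq (smooth_functionM sf (ss I)) => x _.
by rewrite extZE.
Qed.

Lemma smooth_formN s : smooth_form s -> smooth_form (fun x => - s x).
Proof.
move=> ss I; apply: smooth_function_eq (smooth_functionN (ss I)) => x _.
by rewrite extNE.
Qed.

Lemma smooth_formB s t : smooth_form s -> smooth_form t -> smooth_form (fun x => s x - t x).
Proof. by move=> ss st; apply: smooth_formD => //; exact: smooth_formN. Qed.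

Lemma smooth_form_sum (T : Type) (r : seq T) (P : pred T) (F : T -> E -> extalg R n) :
  (forall u, P u -> smooth_form (F u)) ->
  smooth_form (fun x => \sum_(u <- r | P u) F u x).
Proof.
move=> sF; elim: r => [|u r IH].
  by under eq_fun do rewrite big_nil; exact: smooth_form_cst.
under eq_fun do rewrite big_cons.
by case: (boolP (P u)) => Pu //; apply: smooth_formD => //; exact: sF.
Qed.

Lemma linear_basis_form (L : extalg R n -> extalg R n) a : linear L ->
  L a = \sum_J a J *: L (basis_form J).
Proof.
move=> linL.
have L0 : L 0 = 0 by have := linL (-1) 0 0; rewrite scaler0 addr0 scaleN1r => {1}->; rewrite addNr.
have LD b c : L (b + c) = L b + L c by have := linL 1 b c; rewrite !scale1r.
have LZ (c : R) b : L (c *: b) = c *: L b by have := linL c b 0; rewrite L0 !addr0.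
have aE : a = \sum_J a J *: basis_form J.
  apply/ffunP => I; rewrite sum_ffunE (bigD1 I)//= big1 ?addr0 => [|J /negbTE JI].
    by rewrite extZE ffunE eqxx mulr1.
  by rewrite extZE ffunE eq_sym JI mulr0.
by rewrite {1}aE (big_morph L LD L0); apply: eq_bigr => J _; rewrite LZ.
Qed.

Lemma smooth_form_linear (L : extalg R n -> extalg R n) s : linear L ->
  smooth_form s -> smooth_form (fun x => L (s x)).
Proof.
move=> linL ss; under eq_fun do rewrite (linear_basis_form _ linL).
by apply: smooth_form_sum => J _; apply: smooth_formZ; [exact: ss|exact: smooth_form_cst].
Qed.

Lemma smooth_form_dform k s : smooth_form s -> smooth_form (dform k s).
Proof.
move=> ss I; apply: smooth_function_eq (smooth_function_spartial k (ss I)) => x _.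
by rewrite dformE.
Qed.

Lemma dform_cst k a x : dform k (fun=> a) x = 0.
Proof. by apply/ffunP => I; rewrite dformE spartial_cst ext0E. Qed.

Lemma dformD k s t x : smooth_form s -> smooth_form t -> sphere x ->
  dform k (fun y => s y + t y) x = dform k s x + dform k t x.
Proof.
move=> ss st Sx; apply/ffunP => I; rewrite extDE !dformE -spartialD//.
by apply: spartial_eq => // y _; rewrite extDE.
Qed.

Lemma dformZ k f s x : smooth_function f -> smooth_form s -> sphere x ->
  dform k (fun y => f y *: s y) x = f x *: dform k s x + spartial k f x *: s x.
Proof.
move=> sf ss Sx; apply/ffunP => I; rewrite extDE !extZE !dformE.
rewrite [_ * s x I]mulrC -spartialM//.
by apply: spartial_eq => // y _; rewrite extZE.
Qed.

Lemma dformN k s x : smooth_form s -> sphere x -> dform k (fun y => - s y) x = - dform k s x.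
Proof.
move=> ss Sx; apply/ffunP => I; rewrite extNE !dformE -spartialN//.
by apply: spartial_eq => // y _; rewrite extNE.
Qed.

Lemma dformB k s t x : smooth_form s -> smooth_form t -> sphere x ->
  dform k (fun y => s y - t y) x = dform k s x - dform k t x.
Proof. by move=> ss st Sx; rewrite dformD ?dformN//; exact: smooth_formN. Qed.

Lemma dform_sum k (T : Type) (r : seq T) (P : pred T) (F : T -> E -> extalg R n) x :
  (forall u, P u -> smooth_form (F u)) -> sphere x ->
  dform k (fun y => \sum_(u <- r | P u) F u y) x = \sum_(u <- r | P u) dform k (F u) x.
Proof.
move=> sF Sx; elim: r => [|u r IH].
  by under eq_fun do rewrite big_nil; rewrite big_nil dform_cst.
under eq_fun do rewrite big_cons; rewrite big_cons.
case: (boolP (P u)) => Pu //.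
by rewrite dformD ?IH//; [exact: sF|exact: smooth_form_sum].
Qed.

Lemma dformZr k f a x : smooth_function f -> sphere x ->
  dform k (fun y => f y *: a) x = spartial k f x *: a.
Proof.
move=> sf Sx; rewrite dformZ// ?dform_cst ?scaler0 ?add0r//.
exact: smooth_form_cst.
Qed.

Lemma dform_linear k (L : extalg R n -> extalg R n) s x : linear L -> smooth_form s ->
  sphere x -> dform k (fun y => L (s y)) x = L (dform k s x).
Proof.
move=> linL ss Sx.
under eq_fun do rewrite (linear_basis_form _ linL).
rewrite dform_sum//; last by move=> J _; apply: smooth_formZ; [exact: ss|exact: smooth_form_cst].
rewrite [RHS](linear_basis_form _ linL); apply: eq_bigr => J _.
by rewrite (dformZr _ _ (ss J))// dformE.
Qed.

Lemma dform_iota k l s x : smooth_form s -> sphere x ->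
  dform k (fun y => iota l (s y)) x = iota l (dform k s x).
Proof. by apply: dform_linear; exact: interior_is_linear. Qed.

Lemma dform_eps k l s x : smooth_form s -> sphere x ->
  dform k (fun y => eps l (s y)) x = eps l (dform k s x).
Proof. by apply: dform_linear; exact: wedge_is_linear. Qed.

Lemma smooth_form_iota l s : smooth_form s -> smooth_form (fun y => iota l (s y)).
Proof. by apply: smooth_form_linear; exact: interior_is_linear. Qed.

Lemma smooth_form_eps l s : smooth_form s -> smooth_form (fun y => eps l (s y)).
Proof. by apply: smooth_form_linear; exact: wedge_is_linear. Qed.

Lemma smooth_form_interior s : smooth_form s -> smooth_form (fun y => interior y (s y)).
Proof.
move=> ss; under eq_fun do rewrite interior_sum.
apply: smooth_form_sum => k _; apply: smooth_formZ; first exact: smooth_function_coord.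
exact: smooth_form_iota.
Qed.

Lemma smooth_form_wedge s : smooth_form s -> smooth_form (fun y => wedge (flat y) (s y)).
Proof.
move=> ss; under eq_fun do rewrite wedge_flat_sum.
apply: smooth_form_sum => k _; apply: smooth_formZ; first exact: smooth_function_coord.
exact: smooth_form_eps.
Qed.

Lemma smooth_form_tangential_part s : smooth_form s ->
  smooth_form (fun y => tangential_part y (s y)).
Proof. by move=> ss; apply/smooth_form_interior/smooth_form_wedge. Qed.

(** Leibniz rule. The derivative of the contracting point x itself is e_k - x_k x, the tangential
    projection of the k-th basis vector. *)
Lemma dform_interior k s x : smooth_form s -> sphere x ->
  dform k (fun y => interior y (s y)) x =
  interior x (dform k s x) + (iota k (s x) - x 0 k *: interior x (s x)).
Proof.
move=> ss Sx; under eq_fun do rewrite interior_sum.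
rewrite dform_sum//; last first.
  move=> j _; apply: smooth_formZ; first exact: smooth_function_coord.
  exact: smooth_form_iota.
under eq_bigr => j _.
  rewrite dformZ//; last 2 first.
  - exact: smooth_function_coord.
  - exact: smooth_form_iota.
  rewrite dform_iota// spartial_coord// scalerBl.
  over.
rewrite big_split /= -interior_sum; congr (_ + _); rewrite sumrB; congr (_ - _).
  rewrite (bigD1 k)//= eqxx scale1r big1 ?addr0// => j /negbTE jk.
  by rewrite eq_sym jk scale0r.
by rewrite interior_sum scaler_sumr; apply: eq_bigr => j _; rewrite scalerA.
Qed.

Lemma dform_wedge k s x : smooth_form s -> sphere x ->
  dform k (fun y => wedge (flat y) (s y)) x =
  wedge (flat x) (dform k s x) + (eps k (s x) - x 0 k *: wedge (flat x) (s x)).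
Proof.
move=> ss Sx; under eq_fun do rewrite wedge_flat_sum.
rewrite dform_sum//; last first.
  move=> j _; apply: smooth_formZ; first exact: smooth_function_coord.
  exact: smooth_form_eps.
under eq_bigr => j _.
  rewrite dformZ//; last 2 first.
  - exact: smooth_function_coord.
  - exact: smooth_form_eps.
  rewrite dform_eps// spartial_coord// scalerBl.
  over.
rewrite big_split /= -wedge_flat_sum; congr (_ + _); rewrite sumrB; congr (_ - _).
  rewrite (bigD1 k)//= eqxx scale1r big1 ?addr0// => j /negbTE jk.
  by rewrite eq_sym jk scale0r.
by rewrite wedge_flat_sum scaler_sumr; apply: eq_bigr => j _; rewrite scalerA.
Qed.

Lemma dform_radial s x : smooth_form s -> sphere x -> \sum_k x 0 k *: dform k s x = 0.
Proof.
move=> ss Sx; apply/ffunP => I; rewrite sum_ffunE ext0E.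
under eq_bigr => k _ do rewrite extZE dformE.
exact: sum_coord_spartial.
Qed.

Lemma dform_comm k l s x : smooth_form s -> sphere x ->
  dform l (dform k s) x - dform k (dform l s) x =
  x 0 l *: dform k s x - x 0 k *: dform l s x.
Proof.
move=> ss Sx; apply/ffunP => I.
have gen (a b c d : extalg R n) (p q : R) :
    c I - d I = p * a I - q * b I -> (c - d) I = (p *: a - q *: b) I.
  by rewrite !ffunE.
apply: gen; rewrite (dformE k s x I) (dformE l s x I).
rewrite (dformE l (dform k s) x I) (dformE k (dform l s) x I) -(spartial_comm k l (ss I) Sx).
by congr (_ - _); apply: spartial_eq => // y _; rewrite dformE.
Qed.

Lemma smooth_function_inner s t : smooth_form s -> smooth_form t ->
  smooth_function (fun x => inner (s x) (t x)).
Proof.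
by move=> ss st; apply: smooth_function_sum => I _; apply: smooth_functionM.
Qed.

Lemma spartial_inner k s t x : smooth_form s -> smooth_form t -> sphere x ->
  spartial k (fun x => inner (s x) (t x)) x =
  inner (s x) (dform k t x) + inner (dform k s x) (t x).
Proof.
move=> ss st Sx; rewrite spartial_sum//; last by move=> I _; apply: smooth_functionM.
rewrite /inner -big_split; apply: eq_bigr => I _ /=.
by rewrite spartialM// !dformE [X in _ + X]mulrC.
Qed.

(** * Exterior derivative and codifferential *)

Lemma ext_dE s x : ext_d s x = tangential_part x (\sum_k eps k (dform k s x)).
Proof. by congr tangential_part; apply: eq_bigr => k _; rewrite -flat_derivative_delta. Qed.

Lemma ext_d_eq s t x : (forall y, sphere y -> s y = t y) -> sphere x -> ext_d s x = ext_d t x.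
Proof.
move=> st Sx; rewrite !ext_dE; congr tangential_part; apply: eq_bigr => k _.
by rewrite (dform_eq k st Sx).
Qed.

(* The classical formula for the codifferential. *)
Definition divergence s x : extalg R n := - tangential_part x (\sum_k iota k (dform k s x)).

Lemma divergence_eq s t x : (forall y, sphere y -> s y = t y) -> sphere x ->
  divergence s x = divergence t x.
Proof.
move=> st Sx; congr (- tangential_part x _); apply: eq_bigr => k _.
by rewrite (dform_eq k st Sx).
Qed.

Lemma smooth_section_eq s t : (forall y, sphere y -> s y = t y) ->
  smooth_section s -> smooth_section t.
Proof.
move=> st [ts ss]; split; first by move=> x Sx; rewrite -st//; exact: ts.
exact: smooth_form_eq ss.
Qed.

Lemma smooth_section_form s : smooth_section s -> smooth_form s.
Proof. by case. Qed.

Lemma smooth_section_tangential s : smooth_form s ->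
  smooth_section (fun x => tangential_part x (s x)).
Proof.
move=> ss; split; last exact: smooth_form_tangential_part.
by move=> x _; exact: tangential_tangential_part.
Qed.

Lemma smooth_section_divergence s : smooth_form s -> smooth_section (divergence s).
Proof.
move=> ss.
have sd : smooth_form (fun x => - \sum_k iota k (dform k s x)).
  apply/smooth_formN/smooth_form_sum => k _.
  exact/smooth_form_iota/smooth_form_dform.
apply: smooth_section_eq (smooth_section_tangential sd) => x _.
by rewrite raddfN.
Qed.

Lemma smooth_section_ext_d s : smooth_form s -> smooth_section (ext_d s).
Proof.
move=> ss.
have sd : smooth_form (fun x => \sum_k eps k (dform k s x)).
  by apply: smooth_form_sum => k _; exact/smooth_form_eps/smooth_form_dform.
by apply: smooth_section_eq (smooth_section_tangential sd) => x _; rewrite ext_dE.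
Qed.

Lemma smooth_sectionB s t : smooth_section s -> smooth_section t ->
  smooth_section (fun x => s x - t x).
Proof.
move=> [ts ss] [tt st]; split; last exact: smooth_formB.
by move=> x Sx; rewrite /tangential interiorB (ts x Sx) (tt x Sx) subrr.
Qed.

Section Codifferential.
Context (mu : {measure set (borel_space R n) -> \bar R}) (hmu : riemannian_measure mu).
Local Notation SI f := (\int[mu]_(x in sphere) f x).

(** Pointwise, <d p, s> = sum_k d_k <p, iota_k s> + <p, divergence s>. By [sphere_integral_spartial]
    the sum integrates to n times the integral of <p, iota_x s>, which vanishes because s is
    tangential. *)
Lemma is_codiff_divergence s : smooth_section s -> is_codiff mu s (divergence s).
Proof.
move=> [ts ss]; split; first exact: smooth_section_divergence.
move=> p [tp sp].
pose g k x := inner (p x) (iota k (s x)).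
have sg k : smooth_function (g k) by apply: smooth_function_inner => //; exact: smooth_form_iota.
have sdg k := smooth_function_spartial k (sg k).
have sps : smooth_function (fun x => inner (p x) (divergence s x)).
  by apply: smooth_function_inner => //; have [] := smooth_section_divergence ss.
have H : SI (fun x => \sum_k spartial k (g k) x + inner (p x) (divergence s x)) =
         SI (fun x => inner (p x) (divergence s x)).
  rewrite (sphere_integralD hmu) //; last by apply: smooth_function_sum => k _.
  rewrite (sphere_integral_sum hmu)//.
  under eq_bigr => k _ do rewrite (sphere_integral_spartial hmu k (sg k)).
  rewrite -mulr_sumr -(sphere_integral_sum hmu) //; last first.
    by move=> k _; apply: smooth_functionM => //; exact: smooth_function_coord.
  rewrite [X in n%:R * X](_ : _ = 0) ?mulr0 ?add0r//.
  rewrite -[RHS](sphere_integral0 hmu); apply: eq_sphere_integral => x Sx.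
  rewrite /g; under eq_bigr => k _ do rewrite -innerZr.
  by rewrite -inner_sumr -interior_sum (ts x Sx) innerC inner0l.
rewrite -H; apply: eq_sphere_integral => x Sx.
rewrite ext_dE inner_tangential_part (tangential_part_id Sx (ts x Sx)) inner_suml.
rewrite innerNr -inner_tangential_part (tangential_part_id Sx (tp x Sx)) inner_sumr.
rewrite -sumrB; apply: eq_bigr => k _.
rewrite inner_eps /g spartial_inner//; last exact: smooth_form_iota.
by rewrite dform_iota// addrC addKr.
Qed.

(** The difference of two adjoints is a smooth section, so it may be taken as its own test form; its
    squared norm then has integral zero. *)
Lemma is_codiff_unique s t t' : is_codiff mu s t -> is_codiff mu s t' ->
  forall x, sphere x -> t x = t' x.
Proof.
move=> [st Ht] [st' Ht'].
have sd := smooth_sectionB st st'; set d := fun x => _ in sd.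
have sdf := smooth_section_form sd.
have i0 : SI (fun x => inner (d x) (d x)) = 0.
  transitivity (SI (fun x => inner (d x) (t x) - inner (d x) (t' x))).
    by apply: eq_sphere_integral => x _; rewrite -innerNr -innerDr.
  rewrite (sphere_integralB hmu); last 2 first.
  - exact/smooth_function_inner/smooth_section_form/st.
  - exact/smooth_function_inner/smooth_section_form/st'.
  by rewrite -Ht// -Ht'// subrr.
move=> x Sx; apply/eqP; rewrite -subr_eq0; apply/eqP; apply: inner_eq0.
apply: (sphere_integral_eq0 hmu _ _ i0 Sx) => [|y _]; last exact: inner_ge0.
exact: smooth_function_inner.
Qed.

Lemma codiffE s x : smooth_section s -> sphere x -> codiff mu s x = divergence s x.
Proof.
move=> ss Sx; apply: is_codiff_unique Sx; last exact: is_codiff_divergence ss.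
by rewrite /codiff; apply: xgetI; exact: is_codiff_divergence.
Qed.

Lemma ext_d_adjoint s t : smooth_section s -> smooth_section t ->
  SI (fun x => inner (ext_d s x) (t x)) = SI (fun x => inner (s x) (divergence t x)).
Proof. by move=> ss st; have [_] := is_codiff_divergence st; exact. Qed.

(** With A = sum_k eps_k d_k s, the projection in d s subtracts x /\ iota_x A, and differentiating
    this term gives only multiples of x. The commutators of the partial derivatives turn sum_l eps_l
    d_l A into x /\ A, again a multiple of x, and the final projection removes all of these. *)
Lemma ext_d_ext_d s x : smooth_form s -> sphere x -> ext_d (ext_d s) x = 0.
Proof.
move=> ss Sx.
pose A y := \sum_k eps k (dform k s y).
have sA : smooth_form A.
  by apply: smooth_form_sum => k _; exact/smooth_form_eps/smooth_form_dform.
have dE y : sphere y -> ext_d s y = A y - wedge (flat y) (interior y (A y)).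
  by move=> Sy; rewrite ext_dE tangential_partE.
rewrite (ext_d_eq dE Sx) ext_dE.
have siA := smooth_form_interior sA.
have swA := smooth_form_wedge siA.
under eq_bigr => l _ do rewrite dformB// (dform_wedge l siA Sx) epsB epsD epsB.
rewrite sumrB big_split /= sumrB.
set S1 := \sum_k eps k (dform k A x).
have -> : \sum_l eps l (eps l (interior x (A x))) = 0.
  by rewrite big1 // => l _; rewrite eps_eps.
have -> : \sum_l eps l (x 0 l *: wedge (flat x) (interior x (A x))) = 0.
  under eq_bigr => l _ do rewrite epsZ.
  by rewrite -wedge_flat_sum wedge_wedge.
have -> : \sum_l eps l (wedge (flat x) (dform l (fun y => interior y (A y)) x)) =
   - wedge (flat x) (\sum_l eps l (dform l (fun y => interior y (A y)) x)).
  by rewrite wedge_sumr -sumrN; apply: eq_bigr => l _; exact: wedge_anticomm.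
rewrite subrr addr0 opprK raddfD /= tangential_part_wedge addr0.
suff -> : S1 = 2^-1 *: wedge (flat x) (2 *: A x).
  by rewrite linearZ /= tangential_part_wedge scaler0.
(* Exchanging the two summation indices changes the sign of eps_l eps_k, so twice the sum involves
   only commutators of derivatives. *)
have : S1 + S1 = wedge (flat x) (2 *: A x).
  have S1E : S1 = \sum_l \sum_k eps l (eps k (dform l (dform k s) x)).
    apply: eq_bigr => l _; rewrite dform_sum//; last first.
      by move=> k _; exact/smooth_form_eps/smooth_form_dform.
    rewrite eps_sumr; apply: eq_bigr => k _.
    by rewrite dform_eps//; exact: smooth_form_dform.
  have S1E' : S1 = - \sum_l \sum_k eps l (eps k (dform k (dform l s) x)).
    rewrite S1E exchange_big /= -sumrN; apply: eq_bigr => l _; rewrite -sumrN.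
    by apply: eq_bigr => k _; rewrite eps_anticomm.
  rewrite {1}S1E S1E' -sumrB.
  under eq_bigr => l _.
    rewrite -sumrB.
    under eq_bigr => k _ do rewrite -!epsB dform_comm// !epsB !epsZ.
    rewrite sumrB -scaler_sumr -eps_sumr.
    over.
  rewrite sumrB -wedge_flat_sum.
  rewrite exchange_big /=.
  have -> : \sum_k \sum_l x 0 k *: eps l (eps k (dform l s x)) = - wedge (flat x) (A x).
    rewrite wedge_flat_sum -sumrN; apply: eq_bigr => k _.
    rewrite -scaler_sumr -scalerN; congr (_ *: _).
    by rewrite /A eps_sumr -sumrN; apply: eq_bigr => l _; rewrite eps_anticomm.
  by rewrite opprK -wedgeD -mulr2n scaler_nat.
rewrite -mulr2n -scaler_nat => <-.
by rewrite scalerA mulVf ?scale1r// pnatr_eq0.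
Qed.

(** * Eigenfunctions of the Laplacian *)

Lemma sum_delta k (F : 'I_n.+1 -> R) : \sum_l (l == k)%:R * F l = F k.
Proof.
rewrite (bigD1 k)//= eqxx mul1r big1 ?addr0// => l /negbTE ->.
by rewrite mul0r.
Qed.

Lemma sphere_sum x : sphere x -> \sum_l x 0 l * x 0 l = 1. Proof. by []. Qed.

(** The Laplace-Beltrami operator with the sign opposite to that of the Hodge Laplacian, see
    [hodge_laplacian_function]. *)
Definition spherical_laplacian f x : R := \sum_k spartial k (spartial k f) x.

Lemma spartial_spartial_swap k l f x : smooth_function f -> sphere x ->
  spartial l (spartial k f) x =
  spartial k (spartial l f) x + (x 0 l * spartial k f x - x 0 k * spartial l f x).
Proof. by move=> sf Sx; rewrite -spartial_comm// addrC subrK. Qed.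

(** The corrections come from moving d_k past two derivatives. They are matched by those of
    [spherical_laplacian_coordM]: for an eigenfunction the Laplacians of d_k f and of x_k f cancel
    in [eigenfunction_hessian]. *)
Lemma spherical_laplacian_spartial k f x : smooth_function f -> sphere x ->
  spherical_laplacian (spartial k f) x =
  spartial k (spherical_laplacian f) x + (n%:R - 2) * spartial k f x
  - 2 * x 0 k * spherical_laplacian f x.
Proof.
move=> sf Sx; have sc := @smooth_function_coord R n.
have sd l : smooth_function (spartial l f) by exact: smooth_function_spartial.
have sdd l m : smooth_function (spartial l (spartial m f)) by exact: smooth_function_spartial.
have E l : spartial l (spartial l (spartial k f)) x =
   spartial k (spartial l (spartial l f)) x
   + x 0 l * spartial k (spartial l f) x - 2 * x 0 k * spartial l (spartial l f) x
   + spartial k f x - (x 0 l * x 0 l) * spartial k f x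
   + x 0 l * spartial l (spartial k f) x
   - (l == k)%:R * spartial l f x + x 0 k * (x 0 l * spartial l f x).
  have -> : spartial l (spartial l (spartial k f)) x =
     spartial l (fun y => spartial k (spartial l f) y +
        (y 0 l * spartial k f y - y 0 k * spartial l f y)) x.
    by apply: spartial_eq => // y Sy; exact: spartial_spartial_swap.
  have s1 : smooth_function (fun y => y 0 l * spartial k f y) by exact: smooth_functionM.
  have s2 : smooth_function (fun y => y 0 k * spartial l f y) by exact: smooth_functionM.
  rewrite spartialD ?spartialB ?spartialM//; last exact: smooth_functionB.
  rewrite !spartial_coord// eqxx (spartial_spartial_swap k l (sd l) Sx).
  rewrite (_ : true%:R = 1)//.
  move: (spartial k (spartial l (spartial l f)) x) (spartial k (spartial l f) x)
    (spartial l (spartial l f) x) (spartial l (spartial k f) x) (spartial k f x)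
    (spartial l f x) (x 0 k) (x 0 l) ((l == k)%:R : R) => a b c d e p q r u.
  by ring.
(* This is sum_l x_l d_l f = 0 differentiated in the direction k, derived here by exchanging the two
   derivatives. *)
have Exd : \sum_l x 0 l * spartial k (spartial l f) x = - spartial k f x.
  transitivity (\sum_l (x 0 l * spartial l (spartial k f) x
     - (x 0 l * x 0 l) * spartial k f x + x 0 k * (x 0 l * spartial l f x))).
    apply: eq_bigr => l _; rewrite (spartial_spartial_swap l k sf Sx); ring.
  rewrite big_split sumrB /= -mulr_suml -mulr_sumr sphere_sum//.
  by rewrite !sum_coord_spartial// mulr0 addr0 sub0r mul1r.
rewrite /spherical_laplacian; under eq_bigr => l _ do rewrite E.
rewrite !(big_split, sumrN) /= -!mulr_sumr -!mulr_suml Exd sphere_sum//.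
rewrite sum_delta !sum_coord_spartial// sumr_const card_ord -spartial_sum//.
rewrite -mulr_natl -natr1.
by ring.
Qed.

Lemma spherical_laplacian_coordM k f x : smooth_function f -> sphere x ->
  spherical_laplacian (fun y => y 0 k * f y) x =
  x 0 k * spherical_laplacian f x + 2 * spartial k f x - n%:R * x 0 k * f x.
Proof.
move=> sf Sx; have sc := @smooth_function_coord R n.
have sd l : smooth_function (spartial l f) by exact: smooth_function_spartial.
have E l : spartial l (spartial l (fun y => y 0 k * f y)) x =
   x 0 k * spartial l (spartial l f) x
   + 2 * ((l == k)%:R * spartial l f x) - 2 * x 0 k * (x 0 l * spartial l f x)
   - (l == k)%:R * (x 0 l * f x) + 2 * ((x 0 l * x 0 l) * (x 0 k * f x)) - x 0 k * f x.
  have -> : spartial l (spartial l (fun y => y 0 k * f y)) x =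
     spartial l (fun y => y 0 k * spartial l f y + f y * ((l == k)%:R - y 0 l * y 0 k)) x.
    by apply: spartial_eq => // y Sy; rewrite spartialM// spartial_coord.
  have s1 : smooth_function (fun y : E => y 0 l * y 0 k) by exact: smooth_functionM.
  have s2 : smooth_function (fun y : E => (l == k)%:R - y 0 l * y 0 k).
    by apply: smooth_functionB => //; exact: smooth_function_cst.
  rewrite spartialD ?spartialM ?spartialB ?spartialM//; try exact: smooth_functionM;
    try exact: smooth_function_cst.
  rewrite !spartial_coord// spartial_cst eqxx (_ : true%:R = 1)//.
  move: (spartial l (spartial l f) x) (spartial l f x) (f x) (x 0 k) (x 0 l) ((l == k)%:R : R).
  by move=> a b c d e p; ring.
rewrite /spherical_laplacian; under eq_bigr => l _ do rewrite E.
rewrite !(big_split, sumrN) /= -!mulr_sumr -!mulr_suml sphere_sum//.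
rewrite !sum_delta !sum_coord_spartial// sumr_const card_ord.
rewrite -mulr_natl -natr1.
by ring.
Qed.

Lemma spherical_laplacianD f g x : smooth_function f -> smooth_function g -> sphere x ->
  spherical_laplacian (fun y => f y + g y) x =
  spherical_laplacian f x + spherical_laplacian g x.
Proof.
move=> sf sg Sx; rewrite -big_split; apply: eq_bigr => k _ /=.
rewrite -spartialD//; try exact: smooth_function_spartial.
by apply: spartial_eq => // y Sy; rewrite spartialD.
Qed.

(** For harmonic f, |grad f|^2 = sum_l d_l (f d_l f), whose integral is n times that of f sum_l x_l
    d_l f, hence zero. *)
Lemma harmonic_constant f : smooth_function f ->
  (forall x, sphere x -> spherical_laplacian f x = 0) ->
  forall k x, sphere x -> spartial k f x = 0.
Proof.
move=> sf lf.
have sd l : smooth_function (spartial l f) by exact: smooth_function_spartial.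
have sg l : smooth_function (fun y => f y * spartial l f y) by exact: smooth_functionM.
have sq : smooth_function (fun x => \sum_l spartial l f x * spartial l f x).
  by apply: smooth_function_sum => l _; exact: smooth_functionM.
have i0 : SI (fun x => \sum_l spartial l f x * spartial l f x) = 0.
  transitivity (SI (fun x => \sum_l spartial l (fun y => f y * spartial l f y) x)).
    apply: eq_sphere_integral => x Sx; under [RHS]eq_bigr => l _ do rewrite spartialM//.
    rewrite big_split /= -mulr_sumr [X in f x * X](_ : _ = 0) ?mulr0 ?add0r//.
    exact: lf.
  rewrite (sphere_integral_sum hmu); last by move=> l _; exact: smooth_function_spartial.
  under eq_bigr => l _ do rewrite (sphere_integral_spartial hmu l (sg l)).
  rewrite -mulr_sumr -(sphere_integral_sum hmu); last first.
    by move=> l _; apply: smooth_functionM => //; exact: smooth_function_coord.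
  rewrite [X in _ * X](_ : _ = 0) ?mulr0// -[RHS](sphere_integral0 hmu); apply: eq_sphere_integral => x Sx.
  under eq_bigr => l _ do rewrite mulrCA.
  by rewrite -mulr_sumr sum_coord_spartial// mulr0.
move=> k x Sx; have := sphere_integral_eq0 hmu sq _ i0 Sx.
move=> /(_ (fun y _ => sumr_ge0 _ (fun l _ => _))) H.
have {}H : \sum_l spartial l f x * spartial l f x = 0.
  by apply: H => *; rewrite -expr2 sqr_ge0.
apply/eqP; rewrite -sqrf_eq0 expr2; apply/eqP.
by apply: (psumr_eq0P _ H) => // l _; rewrite -expr2 sqr_ge0.
Qed.

(* [spartial k f x + x_k f x] is the k-th partial derivative of the extension
   of [f] that is homogeneous of degree one; the eigenvalue equation says that
   this extension is harmonic. *)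
Lemma eigenfunction_hessian f : smooth_function f ->
  (forall x, sphere x -> spherical_laplacian f x = - (n%:R * f x)) ->
  forall k l x, sphere x ->
  spartial l (spartial k f) x = - (x 0 k * spartial l f x) - f x * ((l == k)%:R - x 0 l * x 0 k).
Proof.
move=> sf lf k l x Sx.
have sc := @smooth_function_coord R n.
have sd m : smooth_function (spartial m f) by exact: smooth_function_spartial.
have sxf : smooth_function (fun y => y 0 k * f y) by exact: smooth_functionM.
have sa : smooth_function (fun y => spartial k f y + y 0 k * f y).
  exact: smooth_functionD.
have la y : sphere y -> spherical_laplacian (fun y => spartial k f y + y 0 k * f y) y = 0.
  move=> Sy; rewrite spherical_laplacianD// spherical_laplacian_spartial//.
  rewrite spherical_laplacian_coordM// lf//.
  have -> : spartial k (spherical_laplacian f) y = - (n%:R * spartial k f y).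
    rewrite -spartialZ// -spartialN//; last exact: smooth_functionZ.
    exact: spartial_eq.
  by ring.
have := harmonic_constant sa la l Sx.
rewrite spartialD// spartialM// spartial_coord// => /eqP.
by rewrite addr_eq0 => /eqP ->; rewrite opprD.
Qed.

(** * Gradients, multiples of the volume form, and their images under d and d^* *)

Definition gradient f x : extalg R n := \sum_k spartial k f x *: eps k (scalar 1).

Lemma function_formE f x : function_form f x = f x *: scalar 1.
Proof. by rewrite /function_form scalarE. Qed.

Lemma scalar_inj : injective (scalar : R -> extalg R n).
Proof. by move=> b c /ffunP/(_ finset.set0); rewrite !ffunE eqxx. Qed.

Lemma smooth_section_function f : smooth_function f -> smooth_section (function_form f).
Proof.
move=> sf; split=> [x _|]; first exact: tangential_scalar.
apply: (@smooth_form_eq (fun x => f x *: scalar 1)) => [x _|]; first by rewrite function_formE.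
by apply: smooth_formZ => //; exact: smooth_form_cst.
Qed.

Lemma dform_function k f x : smooth_function f -> sphere x ->
  dform k (function_form f) x = scalar (spartial k f x).
Proof.
move=> sf Sx; rewrite (dform_eq k (fun y _ => function_formE f y) Sx) dformZr//.
by rewrite -scalarE.
Qed.

Lemma iota_eps_scalar l k : iota l (eps k (scalar 1)) = scalar (k == l)%:R :> extalg R n.
Proof.
have := eps_iota k l (scalar 1 : extalg R n); rewrite iota_scalar eps0 => /esym/eqP.
by rewrite subr_eq0 -scalarE => /eqP <-.
Qed.

Lemma interior_eps_scalar x k : interior x (eps k (scalar 1)) = scalar (x 0 k) :> extalg R n.
Proof.
rewrite interior_sum (bigD1 k)//= big1 ?addr0 => [|l /negbTE lk].
  by rewrite iota_eps_scalar eqxx -scalarE.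
by rewrite iota_eps_scalar eq_sym lk scalarE scale0r scaler0.
Qed.

Lemma interior_gradient f x : smooth_function f -> sphere x -> interior x (gradient f x) = 0.
Proof.
move=> sf Sx; rewrite /gradient interior_sumr.
under eq_bigr => k _ do rewrite interiorZ interior_eps_scalar scalarE scalerA mulrC.
by rewrite -scaler_suml sum_coord_spartial// scale0r.
Qed.

Lemma ext_d_function f x : smooth_function f -> sphere x ->
  ext_d (function_form f) x = gradient f x.
Proof.
move=> sf Sx; rewrite ext_dE.
under eq_bigr => k _ do rewrite dform_function// scalarE epsZ.
by rewrite tangential_part_id//; exact: interior_gradient.
Qed.

Lemma smooth_form_gradient f : smooth_function f -> smooth_form (gradient f).
Proof.
move=> sf; apply: smooth_form_sum => k _; apply: smooth_formZ.
  exact: smooth_function_spartial.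
exact: smooth_form_cst.
Qed.

Lemma smooth_section_gradient f : smooth_function f -> smooth_section (gradient f).
Proof.
by move=> sf; split; [move=> x; exact: interior_gradient|exact: smooth_form_gradient].
Qed.

Lemma divergence_function f x : smooth_function f -> sphere x ->
  divergence (function_form f) x = 0.
Proof.
move=> sf Sx; rewrite /divergence big1 ?linear0 ?oppr0// => k _.
by rewrite dform_function// iota_scalar.
Qed.

Lemma dform_gradient l f x : smooth_function f -> sphere x ->
  dform l (gradient f) x = \sum_k spartial l (spartial k f) x *: eps k (scalar 1).
Proof.
move=> sf Sx; rewrite dform_sum//; last first.
  move=> k _; apply: smooth_formZ; first exact: smooth_function_spartial.
  exact: smooth_form_cst.
by apply: eq_bigr => k _; rewrite dformZr//; exact: smooth_function_spartial.
Qed.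

Lemma divergence_gradient f x : smooth_function f -> sphere x ->
  divergence (gradient f) x = scalar (- spherical_laplacian f x).
Proof.
move=> sf Sx; rewrite /divergence.
have -> : \sum_k iota k (dform k (gradient f) x) = scalar (spherical_laplacian f x).
  rewrite scalarE /spherical_laplacian scaler_suml; apply: eq_bigr => l _.
  rewrite dform_gradient// iota_sumr (bigD1 l)//= big1 ?addr0 => [|k /negbTE kl].
    by rewrite iotaZ iota_eps_scalar eqxx.
  by rewrite iotaZ iota_eps_scalar kl [scalar _]scalarE scale0r scaler0.
rewrite tangential_part_id//; last exact: tangential_scalar.
by rewrite [RHS]scalarE scaleNr -scalarE.
Qed.

Lemma hodge_laplacian_function f x : smooth_function f -> sphere x ->
  hodge_laplacian mu (function_form f) x = scalar (- spherical_laplacian f x).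
Proof.
move=> sf Sx; rewrite /hodge_laplacian.
have c0 y : sphere y -> codiff mu (function_form f) y = 0.
  by move=> Sy; rewrite codiffE ?divergence_function//; exact: smooth_section_function.
rewrite (ext_d_eq c0 Sx) ext_dE big1 ?linear0 ?add0r => [|k _]; last first.
  by rewrite dform_cst eps0.
have sd : smooth_section (ext_d (function_form f)).
  by apply/smooth_section_ext_d/smooth_section_form/smooth_section_function.
rewrite codiffE// -divergence_gradient//; apply: divergence_eq => // y.
exact: ext_d_function.
Qed.

Lemma hodge_laplacian_eigen f : smooth_function f ->
  (forall x, sphere x -> hodge_laplacian mu (function_form f) x =
     function_form (fun y => n%:R * f y) x) <->
  (forall x, sphere x -> spherical_laplacian f x = - (n%:R * f x)).
Proof.
move=> sf; split=> H x Sx.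
  have := H x Sx; rewrite hodge_laplacian_function// => /scalar_inj <-.
  by rewrite opprK.
by rewrite hodge_laplacian_function// H// opprK.
Qed.

Lemma hodge_star_function f x : sphere x ->
  hodge_star (function_form f) x = f x *: volume_form x.
Proof. exact: hodge_scalar. Qed.

Lemma smooth_form_volume : smooth_form (@volume_form R n).
Proof. by apply: (@smooth_form_interior (fun=> top_form)); exact: smooth_form_cst. Qed.

Lemma dform_volume k x : sphere x ->
  dform k (@volume_form R n) x = iota k top_form - x 0 k *: volume_form x.
Proof.
move=> Sx; have := dform_interior k (smooth_form_cst top_form) Sx.
by rewrite dform_cst interior0 add0r.
Qed.

Lemma smooth_section_volume f : smooth_function f ->
  smooth_section (fun x => f x *: volume_form x).
Proof.
move=> sf; split; last by apply: smooth_formZ => //; exact: smooth_form_volume.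
by move=> x _; rewrite /tangential interiorZ tangential_volume scaler0.
Qed.

(* The form dual to the gradient: [iota_(grad f) vol]. *)
Definition dual_gradient f x : extalg R n :=
  \sum_k spartial k f x *: iota k (volume_form x).

Lemma iota_interior_anticomm k x a : iota k (interior x a) = - interior x (iota k a).
Proof. exact: interior_anticomm. Qed.

Lemma eps_wedge_anticomm k x a : eps k (wedge (flat x) a) = - wedge (flat x) (eps k a).
Proof. exact: wedge_anticomm. Qed.

Lemma wedge_iota x k a : wedge (flat x) (iota k a) = x 0 k *: a - iota k (wedge (flat x) a).
Proof.
rewrite /iota wedge_interior; congr (_ *: _ - _).
rewrite /dot (bigD1 k)//= big1 ?addr0; first by rewrite mxE !eqxx mulr1.
by move=> j /negbTE jk; rewrite mxE jk andbF mulr0.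
Qed.

Lemma eps_interior x k a : eps k (interior x a) = x 0 k *: a - interior x (eps k a).
Proof.
rewrite /eps wedge_interior; congr (_ *: _ - _).
rewrite /dot (bigD1 k)//= big1 ?addr0; first by rewrite mxE !eqxx mul1r.
by move=> j /negbTE jk; rewrite mxE jk andbF mul0r.
Qed.

Lemma interior_dual_gradient f x : interior x (dual_gradient f x) = 0.
Proof.
rewrite /dual_gradient interior_sumr big1 // => k _.
rewrite interiorZ -[interior x (iota k _)]opprK -iota_interior_anticomm tangential_volume.
by rewrite /iota interior0 oppr0 scaler0.
Qed.

Lemma smooth_section_dual_gradient f : smooth_function f -> smooth_section (dual_gradient f).
Proof.
move=> sf; split; first by move=> x _; exact: interior_dual_gradient.
apply: smooth_form_sum => k _; apply: smooth_formZ; first exact: smooth_function_spartial.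
by apply: smooth_form_iota; exact: smooth_form_volume.
Qed.

(** The derivative of the volume form contributes only iota_k iota_k = 0 and iota_x vol = 0, so only
    the derivatives of f remain. This is the source of the minus sign in front of [dual_gradient f2]
    in the later decompositions. *)
Lemma divergence_volume f x : smooth_function f -> sphere x ->
  divergence (fun y => f y *: volume_form y) x = - dual_gradient f x.
Proof.
move=> sf Sx; rewrite /divergence; congr (- _).
have -> : \sum_k iota k (dform k (fun y => f y *: volume_form y) x) = dual_gradient f x.
  transitivity (\sum_k (spartial k f x *: iota k (volume_form x)
      - f x *: (x 0 k *: iota k (volume_form x)))).
    apply: eq_bigr => k _; rewrite dformZ//; last exact: smooth_form_volume.
    rewrite dform_volume// iotaD !iotaZ iotaB iota_iota iotaZ sub0r.
    by rewrite scalerN addrC.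
  rewrite sumrB -scaler_sumr -interior_sum tangential_volume scaler0 subr0//.
rewrite tangential_part_id//; exact: interior_dual_gradient.
Qed.

Lemma codiff_hodge_star f x : smooth_function f -> sphere x ->
  codiff mu (hodge_star (function_form f)) x = - dual_gradient f x.
Proof.
move=> sf Sx; rewrite codiffE//.
  rewrite -divergence_volume//; apply: divergence_eq => // y.
  exact: hodge_star_function.
apply: smooth_section_eq (smooth_section_volume sf) => y Sy.
by rewrite hodge_star_function.
Qed.

(** * The connection, Clifford multiplication, and twistor sections from eigenfunctions *)

Local Notation dirac := Defs.dirac.
Lemma nablaE v s x : smooth_form s -> sphere x ->
  nabla v s x = tangential_part x (\sum_k v 0 k *: dform k s x).
Proof. by move=> ss Sx; rewrite /nabla flat_derivative_sum. Qed.

Lemma cliffordD v a b : clifford v (a + b) = clifford v a + clifford v b.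
Proof. by rewrite /clifford wedgeD interiorD opprD addrACA. Qed.

Lemma cliffordZ v (c : R) a : clifford v (c *: a) = c *: clifford v a.
Proof. by rewrite /clifford wedgeZ interiorZ scalerBr. Qed.

Lemma clifford_clifford v a : clifford v (clifford v a) = - (dot v v *: a).
Proof.
rewrite /clifford wedgeB interiorB wedge_wedge interior_interior wedge_interior.
by rewrite sub0r subr0 opprB addrC addrA addNr sub0r.
Qed.

(** Each of the n frame vectors satisfies e_i . e_i = -1. Hence a form a with nabla_v s = - v . a
    for all tangent v is necessarily D s / n, and to verify the twistor equation it is enough to
    exhibit such an a. *)
Lemma dirac_twistor (e : 'M[R]_(n, n.+1)) s x a : tangent_frame x e ->
  (forall v, tangent_vector x v -> nabla v s x = - clifford v a) ->
  dirac e s x = n%:R *: a.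
Proof.
move=> [et ee] H; rewrite /dirac.
rewrite (eq_bigr (fun=> a)); first by rewrite sumr_const card_ord scaler_nat.
move=> i _; rewrite H; last exact: et.
by rewrite -scaleN1r cliffordZ clifford_clifford ee eqxx scaleN1r opprK scale1r.
Qed.

Lemma twistor_of_nabla s (t : E -> extalg R n) : (0 < n)%N -> smooth_section s ->
  (forall x v, sphere x -> tangent_vector x v -> nabla v s x = - clifford v (t x)) ->
  twistor_section s.
Proof.
move=> n0 ss H; split => // x e v Sx ex vx.
rewrite (dirac_twistor ex (fun w => H x w Sx)) H// cliffordZ scalerA mulVf ?scale1r ?addNr//.
by rewrite pnatr_eq0 -lt0n.
Qed.

Definition gradient_vector f x : E := \row_k spartial k f x.

Lemma dot_gradient_vector f x : smooth_function f -> sphere x ->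
  dot x (gradient_vector f x) = 0.
Proof.
move=> sf Sx; rewrite -(sum_coord_spartial sf Sx); apply: eq_bigr => k _.
by rewrite mxE.
Qed.

Lemma gradientE f x : gradient f x = wedge (flat (gradient_vector f x)) (scalar 1).
Proof. by rewrite wedge_flat_sum; apply: eq_bigr => k _; rewrite mxE. Qed.

Lemma dual_gradientE f x : dual_gradient f x = interior (gradient_vector f x) (volume_form x).
Proof. by rewrite interior_sum; apply: eq_bigr => k _; rewrite mxE. Qed.

Lemma wedge_interior0 x v a : dot x v = 0 ->
  wedge (flat x) (interior v a) = - interior v (wedge (flat x) a).
Proof. by move=> xv; rewrite wedge_interior xv scale0r sub0r. Qed.

(** Contraction of the top form with tangent vectors leaves its factor x untouched, and the
    tangential projection removes every multiple of x. *)
Lemma tangential_part_interior_top x v : dot x v = 0 ->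
  tangential_part x (interior v top_form) = 0.
Proof.
by move=> xv; rewrite /tangential_part wedge_interior0// wedge_top interior0 oppr0 interior0.
Qed.

Lemma tangential_part_interior2_top x u v : dot x u = 0 -> dot x v = 0 ->
  tangential_part x (interior u (interior v top_form)) = 0.
Proof.
move=> xu xv; rewrite /tangential_part !wedge_interior0// wedge_top.
by rewrite !(interior0, oppr0).
Qed.

Lemma interior_tangent x v a : tangential x a -> interior x (interior v a) = 0.
Proof. by move=> xa; rewrite interior_anticomm xa interior0 oppr0. Qed.

Lemma tangential_wedge x v a : tangent_vector x v -> tangential x a ->
  tangential x (wedge (flat v) a).
Proof.
rewrite /tangent_vector => vx xa; have := wedge_interior v x a.
by rewrite xa wedge0 dotC vx scale0r sub0r => /esym/eqP; rewrite oppr_eq0 => /eqP.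
Qed.

Section Eigenfunctions.
Context (f1 f2 : E -> R) (sf1 : smooth_function f1) (sf2 : smooth_function f2).
Context (lf1 : forall x, sphere x -> spherical_laplacian f1 x = - (n%:R * f1 x)).
Context (lf2 : forall x, sphere x -> spherical_laplacian f2 x = - (n%:R * f2 x)).

Lemma nabla_gradient v x : sphere x -> tangent_vector x v ->
  nabla v (gradient f1) x = - (f1 x *: wedge (flat v) (scalar 1)).
Proof.
move=> Sx vx; rewrite nablaE//; last exact: smooth_form_gradient.
(* The Hessian formula is arranged so that everything except - f1 e_l is a multiple of x and
   disappears under the projection. *)
have dE l : dform l (gradient f1) x =
   (f1 x * x 0 l - spartial l f1 x) *: wedge (flat x) (scalar 1) - f1 x *: eps l (scalar 1).
  rewrite dform_gradient// wedge_flat_sum scaler_sumr.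
  transitivity (\sum_k ((f1 x * x 0 l - spartial l f1 x) *: (x 0 k *: eps k (scalar 1))
      - (l == k)%:R *: (f1 x *: eps k (scalar 1)) : extalg R n)).
    apply: eq_bigr => k _; rewrite (eigenfunction_hessian sf1 lf1)// !scalerA -scalerBl.
    by congr (_ *: _); ring.
  rewrite sumrB; congr (_ - _); rewrite (bigD1 l)//= eqxx scale1r big1 ?addr0// => k.
  by rewrite eq_sym => /negbTE ->; rewrite scale0r.
under eq_bigr => l _ do rewrite dE scalerBr scalerA.
rewrite sumrB -scaler_suml raddfB /= linearZ /= tangential_part_wedge scaler0 sub0r.
congr (- _); under eq_bigr => l _ do rewrite scalerA mulrC -scalerA.
rewrite -scaler_sumr -wedge_flat_sum linearZ /= tangential_part_id//.
by apply: tangential_wedge => //; exact: tangential_scalar.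
Qed.

Lemma nabla_dual_gradient v x : sphere x -> tangent_vector x v ->
  nabla v (dual_gradient f2) x = - (f2 x *: interior v (volume_form x)).
Proof.
move=> Sx vx; have [_ sd] := smooth_section_dual_gradient sf2.
rewrite nablaE//.
(* The second term comes from the derivative of the volume form; contracted with v it is a double
   contraction of the top form by tangent vectors, hence normal. The last term drops out because v
   is orthogonal to x. *)
have dE l : dform l (dual_gradient f2) x =
   - (f2 x *: iota l (volume_form x))
   + interior (gradient_vector f2 x) (iota l top_form) - x 0 l *: dual_gradient f2 x.
  rewrite dform_sum//; last first.
    move=> k _; apply: smooth_formZ; first exact: smooth_function_spartial.
    by apply: smooth_form_iota; exact: smooth_form_volume.
  transitivity (\sum_k (
      (f2 x * x 0 l - spartial l f2 x) *: (x 0 k *: iota k (volume_form x))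
      - (l == k)%:R *: (f2 x *: iota k (volume_form x))
      + (spartial k f2 x *: iota k (iota l top_form) - x 0 l *: (spartial k f2 x *: iota k (volume_form x)))
      : extalg R n)).
    apply: eq_bigr => k _; rewrite dformZ//; last 2 first.
    - exact: smooth_function_spartial.
    - by apply: smooth_form_iota; exact: smooth_form_volume.
    rewrite dform_iota//; last exact: smooth_form_volume.
    rewrite dform_volume// iotaB iotaZ scalerBr addrC; congr (_ + (_ - _)).
      rewrite (eigenfunction_hessian sf2 lf2)// !scalerA -scalerBl.
      by congr (_ *: _); ring.
    by rewrite !scalerA mulrC.
  rewrite big_split sumrB sumrB /= -!scaler_sumr -interior_sum tangential_volume scaler0 sub0r.
  rewrite -addrA; congr (- _ + (_ - _)).
    rewrite (bigD1 l)//= eqxx scale1r big1 ?addr0// => k.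
    by rewrite eq_sym => /negbTE ->; rewrite scale0r.
  by rewrite interior_sum; apply: eq_bigr => k _; rewrite mxE.
have lin (p q r : R) a b c : p *: (- (q *: a) + b - r *: c) =
    - (q *: (p *: a)) + p *: b - (p * r) *: c.
  by rewrite scalerBr scalerDr scalerN !scalerA (mulrC p q).
under eq_bigr => l _ do rewrite dE lin.
rewrite sumrB big_split sumrN /= -scaler_suml -scaler_sumr -interior_sum.
have -> : \sum_i v 0 i * x 0 i = 0 by rewrite -[RHS]vx dotC.
rewrite scale0r subr0.
have -> : \sum_i v 0 i *: interior (gradient_vector f2 x) (iota i top_form) =
  interior (gradient_vector f2 x) (interior v top_form).
  by rewrite (interior_sum v) interior_sumr; apply: eq_bigr => k _; rewrite interiorZ.
rewrite raddfD /= tangential_part_interior2_top ?dot_gradient_vector// addr0 raddfN /= linearZ /=.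
by rewrite tangential_part_id//; exact/interior_tangent/tangential_volume.
Qed.

End Eigenfunctions.

Lemma nabla_volume v x : sphere x -> tangent_vector x v -> nabla v (@volume_form R n) x = 0.
Proof.
move=> Sx vx; rewrite nablaE//; last exact: smooth_form_volume.
under eq_bigr => l _ do rewrite dform_volume// scalerBr scalerA.
rewrite sumrB -scaler_suml -interior_sum.
have -> : \sum_i v 0 i * x 0 i = 0 by rewrite -[RHS]vx dotC.
by rewrite scale0r subr0 tangential_part_interior_top.
Qed.

Lemma wedge_volume x v : tangent_vector x v -> wedge (flat v) (volume_form x) = 0.
Proof. by move=> vx; rewrite volume_formE wedge_interior0 1?dotC// wedge_top interior0 oppr0. Qed.

Lemma nablaD v s t x : smooth_form s -> smooth_form t -> sphere x ->
  nabla v (fun y => s y + t y) x = nabla v s x + nabla v t x.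
Proof.
move=> ss st Sx; rewrite !nablaE//; last exact: smooth_formD.
rewrite -raddfD -big_split /=; congr tangential_part; apply: eq_bigr => k _.
by rewrite dformD// scalerDr.
Qed.

Lemma nablaZ v (c : R) s x : smooth_form s -> sphere x ->
  nabla v (fun y => c *: s y) x = c *: nabla v s x.
Proof.
move=> ss Sx; rewrite !nablaE//; last by apply: smooth_formZ => //; exact: smooth_function_cst.
rewrite -linearZ scaler_sumr /=; congr tangential_part; apply: eq_bigr => k _.
by rewrite dformZ ?spartial_cst ?scale0r ?addr0 ?scalerA 1?mulrC//; exact: smooth_function_cst.
Qed.

Lemma nabla_cst v a x : sphere x -> nabla v (fun=> a) x = 0.
Proof.
move=> Sx; rewrite nablaE//; last exact: smooth_form_cst.
by rewrite big1 ?linear0// => k _; rewrite dform_cst scaler0.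
Qed.

Lemma nabla_eq v s t x : (forall y, sphere y -> s y = t y) -> smooth_form s -> sphere x ->
  nabla v s x = nabla v t x.
Proof.
move=> st ss Sx; rewrite !nablaE//; last exact: smooth_form_eq ss.
by congr tangential_part; apply: eq_bigr => k _; rewrite (dform_eq k st Sx).
Qed.

Lemma smooth_sectionD s t : smooth_section s -> smooth_section t ->
  smooth_section (fun x => s x + t x).
Proof.
move=> [ts ss] [tt st]; split; last exact: smooth_formD.
by move=> x Sx; rewrite /tangential interiorD (ts x Sx) (tt x Sx) addr0.
Qed.

Lemma twistor_of_eigenfunctions s (c1 c2 : R) f1 f2 : (0 < n)%N ->
  smooth_function f1 -> smooth_function f2 ->
  (forall x, sphere x -> spherical_laplacian f1 x = - (n%:R * f1 x)) ->
  (forall x, sphere x -> spherical_laplacian f2 x = - (n%:R * f2 x)) ->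
  (forall x, sphere x -> s x =
     scalar c1 + gradient f1 x + (-1) *: dual_gradient f2 x + c2 *: volume_form x) ->
  twistor_section s.
Proof.
move=> n0 sf1 sf2 lf1 lf2 sE.
have S0 : smooth_section (fun _ : E => scalar c1 : extalg R n).
  by apply: smooth_section_function; exact: smooth_function_cst.
have S1 := smooth_section_gradient sf1.
have S2' := smooth_section_dual_gradient sf2.
have S2 : smooth_section (fun x => (-1) *: dual_gradient f2 x).
  split; last by apply: smooth_formZ; [exact: smooth_function_cst|exact: smooth_section_form S2'].
  by move=> x Sx; rewrite /tangential interiorZ interior_dual_gradient scaler0.
have S3 := smooth_section_volume (smooth_function_cst c2).
have S01 := smooth_sectionD S0 S1; have S012 := smooth_sectionD S01 S2.
have SS := smooth_sectionD S012 S3.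
have ss : smooth_section s by apply: smooth_section_eq SS => x Sx; rewrite sE.
(* The candidate for D s / n. For tangent v, v /\ vol = 0 and iota_v kills scalars, so - v . (f1 +
   f2 vol) = - f1 v + f2 iota_v vol, the covariant derivative found from the two preceding
   lemmas. *)
apply: (twistor_of_nabla (t := fun x => scalar (f1 x) + f2 x *: volume_form x) n0 ss).
move=> x v Sx vx; rewrite (nabla_eq v sE (smooth_section_form ss) Sx).
rewrite (nablaD v (smooth_section_form S012) (smooth_section_form S3) Sx).
rewrite (nablaD v (smooth_section_form S01) (smooth_section_form S2) Sx).
rewrite (nablaD v (smooth_section_form S0) (smooth_section_form S1) Sx).
rewrite nabla_cst// (nablaZ v _ (smooth_section_form S2') Sx) (nablaZ v _ smooth_form_volume Sx).
rewrite nabla_volume// (nabla_gradient sf1 lf1)// (nabla_dual_gradient sf2 lf2)//.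
rewrite scaler0 addr0 add0r scaleN1r opprK.
rewrite (scalarE (f1 x)) cliffordD !cliffordZ /clifford interior_scalar wedge_volume//.
by rewrite subr0 sub0r scalerN opprD opprK.
Qed.

(** * Twistor sections *)

(** The rows of an orthogonal matrix that carries the first basis vector to x: row 0 is x, and the
    other n rows are a tangent frame. *)
Lemma tangent_frame_exists x : sphere x -> exists e : 'M[R]_(n, n.+1), tangent_frame x e.
Proof.
move=> Sx.
have S0 : sphere (delta_mx 0 0 : E).
  rewrite /sphere/= /dot (bigD1 0)//= big1 ?addr0 => [|j j0].
    by rewrite mxE !eqxx mulr1.
  by rewrite mxE (negbTE j0) andbF mul0r.
have [g gg xE] := orthogonal_transitive Sx S0.
have dd (i j : 'I_n.+1) : dot (delta_mx 0 i : E) (delta_mx 0 j) = (i == j)%:R.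
  rewrite /dot (bigD1 i)//= big1 ?addr0 => [|m /negbTE mi].
    by rewrite !mxE !eqxx mul1r.
  by rewrite mxE mi andbF mul0r.
exists (\matrix_(i < n) row (lift 0 i) g); split=> [i|i j].
  by rewrite rowK rowE /tangent_vector -[X in dot X]xE dot_orthogonal// dd.
by rewrite !rowK !rowE dot_orthogonal// dd (inj_eq lift_inj).
Qed.

Lemma derive_radial_extension_eq0 f v y : smooth_function f ->
  (forall k x, sphere x -> spartial k f x = 0) -> punctured y ->
  'D_v (radial_extension f) y = 0.
Proof.
move=> sf d0 y0; rewrite derive_radial_extension// derive_spartial//; last exact: sphere_retraction.
rewrite big1 ?mulr0// => k _; rewrite d0 ?mulr0//; exact: sphere_retraction.
Qed.

(** The chord from p to q avoids the origin, so the mean value theorem applies to the radial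
    extension along it, with no curve on the sphere. *)
Lemma constant_off_antipode f p q : smooth_function f ->
  (forall k x, sphere x -> spartial k f x = 0) ->
  sphere p -> sphere q -> dot p q != -1 -> f p = f q.
Proof.
move=> sf d0 Sp Sq pq.
have seg (t : R) : punctured (p + t *: (q - p)).
  apply: contraNneq pq => y0.
  have : dot (p + t *: (q - p)) (p + q) = 0.
    by rewrite y0 /dot big1 // => i _; rewrite mxE mul0r.
  (* The scalar product of a point of the chord with p + q is 1 + <p, q>, whatever t is. *)
  rewrite dotDl dotZl -(scaleN1r p) dotDl dotZl !dotDr (dotC q p).
  move: Sp Sq; rewrite /sphere/= => -> -> /eqP.
  rewrite (_ : _ + _ = 1 + dot p q); last by ring.
  by rewrite addrC addr_eq0.
have := @MVT_line R E (radial_extension f) p (q - p) 1 ltr01.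
case=> [t _|c _]; first exact: differentiable_radial_extension.
rewrite derive_radial_extension_eq0// mulr0 scale1r [p + _]addrC subrK.
by rewrite !radial_extension_sphere// => /eqP; rewrite subr_eq0 => /eqP.
Qed.

(** Antipodal points are joined through a unit vector r orthogonal to both; it exists because n >
    0. *)
Lemma constant_of_spartial_eq0 f p q : (0 < n)%N -> smooth_function f ->
  (forall k x, sphere x -> spartial k f x = 0) -> sphere p -> sphere q -> f p = f q.
Proof.
move=> n0 sf d0 Sp Sq; have [pq|pq] := eqVneq (dot p q) (-1); last exact: constant_off_antipode.
have [e [et ee]] := tangent_frame_exists Sp.
pose r := row (Ordinal n0) e.
have pr : dot p r = 0 by exact: et.
have Sr : sphere r by rewrite /sphere/= ee eqxx.
have n10 : (0 : R) != -1 by rewrite eq_sym oppr_eq0 oner_eq0.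
have Sp' : sphere (- p) by rewrite /sphere/= -scaleN1r dotZl dotZr mulrA mulrNN !mul1r.
have qp : q = - p.
  apply/eqP; rewrite -addr_eq0 -dot_eq0 dotDl !dotDr (dotC q p) pq.
  move: Sp Sq; rewrite /sphere/= => -> ->; apply/eqP; ring.
rewrite qp (@constant_off_antipode f p r)// ?pr//.
apply: constant_off_antipode => //.
by rewrite -scaleN1r dotZr dotC pr mulr0.
Qed.

Lemma tangential_clifford x v a : tangent_vector x v -> tangential x a ->
  tangential x (clifford v a).
Proof.
move=> vx ax; rewrite /tangential /clifford interiorB (tangential_wedge vx ax).
by rewrite interior_tangent// subrr.
Qed.

Lemma tangential_nabla v s x : tangential x (nabla v s x).
Proof. exact: tangential_tangential_part. Qed.

Lemma tangentialZ x (c : R) a : tangential x a -> tangential x (c *: a).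
Proof. by move=> ax; rewrite /tangential interiorZ ax scaler0. Qed.

Lemma tangential_sum x (m : nat) (F : 'I_m -> extalg R n) :
  (forall u : 'I_m, tangential x (F u)) -> tangential x (\sum_u F u).
Proof. by move=> Fx; rewrite /tangential interior_sumr big1 // => u _; exact: Fx. Qed.

Definition clifford_basis k a : extalg R n := eps k a - iota k a.

Lemma clifford_delta k a : clifford (delta_mx 0 k) a = clifford_basis k a. Proof. by []. Qed.

Lemma clifford_basis_sqr k a : clifford_basis k (clifford_basis k a) = - a.
Proof.
rewrite -!clifford_delta clifford_clifford /dot (bigD1 k)//= big1 ?addr0 => [|j /negbTE jk].
  by rewrite !mxE !eqxx mul1r scale1r.
by rewrite mxE jk andbF mul0r.
Qed.

Lemma clifford_sum v a : clifford v a = \sum_k v 0 k *: clifford_basis k a.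
Proof.
rewrite /clifford wedge_flat_sum interior_sum -sumrB; apply: eq_bigr => k _.
by rewrite scalerBr.
Qed.

(** * Forms of pure degree *)

Lemma grading_component (q : nat) a (I : {set 'I_n.+1}) :
  grading a = q%:R *: a -> #|I| != q -> a I = 0.
Proof.
move=> /ffunP/(_ I) + Iq; rewrite gradingE extZE => /eqP; rewrite -subr_eq0 -mulrBl mulf_eq0.
by rewrite subr_eq0 eqr_nat (negbTE Iq) => /eqP.
Qed.

Lemma grading_interior v a : grading (interior v a) = interior v (grading a - a).
Proof.
rewrite !interior_sum (big_morph _ (@gradingD R n) (@grading0 R n)); apply: eq_bigr => k _.
by rewrite gradingZ grading_iota.
Qed.

Lemma grading_wedge v a : grading (wedge (flat v) a) = wedge (flat v) (grading a + a).
Proof.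
rewrite !wedge_flat_sum (big_morph _ (@gradingD R n) (@grading0 R n)); apply: eq_bigr => k _.
by rewrite gradingZ grading_eps.
Qed.

Lemma grading_interior_nat v (q : nat) a :
  grading a = q.+1%:R *: a -> grading (interior v a) = q%:R *: interior v a.
Proof. by move=> ga; rewrite grading_interior ga -natr1 scalerDl scale1r addrK interiorZ. Qed.

Lemma grading_wedge_nat v (q : nat) a :
  grading a = q%:R *: a -> grading (wedge (flat v) a) = q.+1%:R *: wedge (flat v) a.
Proof. by move=> ga; rewrite grading_wedge ga wedgeD -natr1 wedgeZ scalerDl scale1r. Qed.

Lemma grading_volume x : grading (volume_form x) = n%:R *: volume_form x :> extalg R n.
Proof. exact/grading_interior_nat/grading_top. Qed.

Lemma grading_dual_gradient f x : (0 < n)%N ->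
  grading (dual_gradient f x) = n.-1%:R *: dual_gradient f x.
Proof.
by move=> n0; rewrite dual_gradientE; apply: grading_interior_nat; rewrite prednK// grading_volume.
Qed.

Lemma grading_gradient f x : grading (gradient f x) = 1%:R *: gradient f x.
Proof.
by rewrite gradientE; apply: grading_wedge_nat; rewrite grading_scalar scale0r.
Qed.

Lemma eps_volume k x : eps k (volume_form x) = x 0 k *: top_form :> extalg R n.
Proof. by rewrite volume_formE eps_interior eps_top interior0 subr0. Qed.

Lemma wedge_flat_volume x : sphere x -> wedge (flat x) (volume_form x) = top_form :> extalg R n.
Proof.
by rewrite /sphere/= => Sx; rewrite volume_formE wedge_interior Sx wedge_top interior0 subr0 scale1r.
Qed.

Lemma degree_part_topE a : degree_part n.+1 a = a -> a = a [set: 'I_n.+1]%SET *: top_form.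
Proof.
move=> <-; apply/ffunP => I; rewrite extZE !ffunE finset.cardsT card_ord eqxx.
have [->|IT] := eqVneq I [set: 'I_n.+1]%SET.
  by rewrite finset.cardsT card_ord eqxx mulr1.
rewrite mulr0; case: eqP => // E; case/eqP: IT.
by apply/eqP; rewrite eqEcard finset.subsetT finset.cardsT card_ord E leqnn.
Qed.

(** After the scalar is removed, x /\ a lies in degree n + 1 and is a multiple of the top form;
    contracting with x recovers a and turns the top form into the volume form. *)
Lemma tangential_two_degrees x a : (0 < n)%N -> sphere x -> tangential x a ->
  (forall I : {set 'I_n.+1}, #|I| != 0%N -> #|I| != n -> a I = 0) ->
  a = scalar (a finset.set0) + wedge (flat x) a [set: 'I_n.+1]%SET *: volume_form x.
Proof.
move=> n0 Sx ax aI; pose b := a - scalar (a finset.set0).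
have b_id : tangential_part x b = b.
  by rewrite tangential_part_id// /b /tangential interiorB (ax : interior x a = 0) interior_scalar subrr.
have bn : degree_part n b = b.
  apply/ffunP => I; rewrite /b !ffunE; have [//|In] := eqVneq #|I| n.
  have [->|I0] := eqVneq I finset.set0; first by rewrite subrr.
  by rewrite subr0 aI ?cards_eq0.
have -> : wedge (flat x) a [set: 'I_n.+1]%SET = wedge (flat x) b [set: 'I_n.+1]%SET.
  have lin c (p q r : extalg R n) : p = q - r -> r c = 0 -> p c = q c.
    by move=> ->; rewrite !ffunE => ->; rewrite subr0.
  apply/esym; apply: (lin _ _ _ (wedge (flat x) (scalar (a finset.set0)))).
    by rewrite -wedgeB.
  (* The scalar part contributes to x /\ a in degree 1 only, which differs from n + 1 because n >
     0. *)
  apply: (grading_component (q := 1)); last by rewrite finset.cardsT card_ord eqSS -lt0n.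
  by apply: grading_wedge_nat; rewrite grading_scalar scale0r.
have <- : b = wedge (flat x) b [set: 'I_n.+1]%SET *: volume_form x; last by rewrite addrC subrK.
rewrite -{1}b_id /tangential_part volume_formE -interiorZ -degree_part_topE//.
by rewrite -wedge_degree_part bn.
Qed.

(** The divergence without its sign and projection. Its coefficients are constant, so [dform l]
    passes through the [iota k]. *)
Definition contraction (u : E -> extalg R n) x : extalg R n := \sum_k iota k (dform k u x).

Lemma contractionZ f (u : E -> extalg R n) x : smooth_function f -> smooth_form u -> sphere x ->
  contraction (fun y => f y *: u y) x =
  f x *: contraction u x + \sum_k spartial k f x *: iota k (u x).
Proof.
move=> sf su Sx; rewrite scaler_sumr -big_split; apply: eq_bigr => k _ /=.
by rewrite dformZ// iotaD !iotaZ.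
Qed.

(** Differentiating the factor [flat y] produces sum_k iota_k eps_k = n + 1 - N, and the radial
    correction takes off one more. This is how N acts on iota_l s in the comparison behind
    [iota_residue]. *)
Lemma contraction_wedge_iota (u : E -> extalg R n) l x : smooth_form u -> sphere x ->
  tangential x (u x) ->
  contraction (fun y => wedge (flat y) (iota l (u y))) x =
  n%:R *: iota l (u x) - grading (iota l (u x)) + wedge (flat x) (iota l (contraction u x)).
Proof.
move=> su Sx ux; rewrite /contraction.
have lx : interior x (iota l (u x)) = 0 by rewrite -[LHS]opprK -iota_interior_anticomm ux iota0 oppr0.
transitivity (\sum_k (iota l (x 0 k *: dform k u x)
   + wedge (flat x) (iota l (iota k (dform k u x)))
   + iota k (eps k (iota l (u x))) - x 0 k *: iota k (wedge (flat x) (iota l (u x))))).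
  apply: eq_bigr => k _; rewrite dform_wedge//; last exact: smooth_form_iota.
  rewrite dform_iota// iotaD iotaB addrA iotaZ; congr (_ + _ - _).
  by rewrite iotaZ [iota l (iota k _)]iota_anticomm wedgeN (wedge_iota x k) opprB addrC subrK.
rewrite sumrB !big_split /= -!wedge_sumr -!iota_sumr -interior_sum dform_radial// iota0 add0r.
rewrite sum_iota_eps -[interior x (wedge _ _)]/(tangential_part x _) tangential_part_id//.
have lin (b c d : extalg R n) (p : R) : b + ((p + 1) *: c - d) - c = p *: c - d + b.
  by apply/ffunP => I; rewrite !ffunE /GRing.scale/=; ring.
by rewrite -natr1 lin.
Qed.

Lemma contraction_eps_scalar l x : contraction (fun=> eps l (scalar 1)) x = 0.
Proof. by rewrite /contraction big1 // => k _; rewrite dform_cst iota0. Qed.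

Lemma iota_wedge_scalar k x : iota k (wedge (flat x) (scalar 1)) = x 0 k *: scalar 1 :> extalg R n.
Proof. by rewrite -[LHS](subKr (x 0 k *: scalar 1)) -wedge_iota iota_scalar wedge0 subr0. Qed.

Lemma contraction_coord_wedge l x : sphere x ->
  contraction (fun y => y 0 l *: wedge (flat y) (scalar 1)) x = (n%:R * x 0 l) *: scalar 1.
Proof.
move=> Sx; have sc : smooth_form (fun=> scalar 1 : extalg R n) by exact: smooth_form_cst.
rewrite contractionZ//; last 2 first.
- exact: smooth_function_coord.
- exact: smooth_form_wedge.
have -> : contraction (fun y => wedge (flat y) (scalar 1)) x = n%:R *: scalar 1.
  rewrite /contraction; transitivity (\sum_k (scalar 1 - (x 0 k * x 0 k) *: scalar 1 : extalg R n)).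
    apply: eq_bigr => k _; rewrite dform_wedge// dform_cst wedge0 add0r iotaB iotaZ iota_wedge_scalar.
    by rewrite iota_eps_scalar eqxx scalerA.
  rewrite sumrB sumr_const card_ord -scaler_suml -[\sum_k _]/(dot x x).
  by move: Sx; rewrite /sphere/= => ->; rewrite scale1r mulrSr addrK scaler_nat.
have -> : \sum_k spartial k (fun y => y 0 l) x *: iota k (wedge (flat x) (scalar 1)) = 0 :> extalg R n.
  under eq_bigr => k _ do rewrite iota_wedge_scalar scalerA mulrC.
  by rewrite -scaler_suml sum_coord_spartial ?scale0r//; exact: smooth_function_coord.
by rewrite addr0 scalerA mulrC.
Qed.

Lemma contraction_iota_volume l x : sphere x ->
  contraction (fun y => iota l (volume_form y : extalg R n)) x = 0.
Proof.
move=> Sx; rewrite /contraction.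
transitivity (\sum_k (- (x 0 k *: iota k (iota l (volume_form x))) : extalg R n)).
  apply: eq_bigr => k _; rewrite dform_iota//; last exact: smooth_form_volume.
  rewrite dform_volume// iotaB iotaZ iotaB iotaZ iota_anticomm.
  by rewrite iota_iota iota0 oppr0 sub0r.
rewrite sumrN -interior_sum -[interior x _]opprK -iota_interior_anticomm tangential_volume.
by rewrite iota0 !oppr0.
Qed.

Lemma contractionD (u w : E -> extalg R n) x : smooth_form u -> smooth_form w -> sphere x ->
  contraction (fun y => u y + w y) x = contraction u x + contraction w x.
Proof.
move=> su sw Sx; rewrite -big_split; apply: eq_bigr => k _ /=.
by rewrite dformD// iotaD.
Qed.

Lemma contractionB (u w : E -> extalg R n) x : smooth_form u -> smooth_form w -> sphere x ->
  contraction (fun y => u y - w y) x = contraction u x - contraction w x.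
Proof.
move=> su sw Sx; rewrite -sumrB; apply: eq_bigr => k _ /=.
by rewrite dformB// iotaB.
Qed.

Lemma contraction_eq (u w : E -> extalg R n) x : (forall y, sphere y -> u y = w y) -> sphere x ->
  contraction u x = contraction w x.
Proof. by move=> uw Sx; apply: eq_bigr => k _; rewrite (dform_eq k uw Sx). Qed.

(** By hypothesis N a = sum_k eps_k iota_k a has pure degree n, and N multiplies the components of
    nonzero degree by nonzero numbers. *)
Lemma two_degrees_of_iota a : (0 < n)%N ->
  (forall l, grading (iota l a) = n.-1%:R *: iota l a) ->
  forall I : {set 'I_n.+1}, #|I| != 0%N -> #|I| != n -> a I = 0.
Proof.
move=> n0 H I I0 In.
have : grading (grading a) = n%:R *: grading a.
  rewrite -(sum_eps_iota a) (big_morph _ (@gradingD R n) (@grading0 R n)) scaler_sumr.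
  apply: eq_bigr => k _; rewrite grading_eps H -[X in _ = X%:R *: _](prednK n0) -natr1.
  by rewrite scalerDl scale1r epsD epsZ.
move=> /grading_component/(_ In)/eqP; rewrite gradingE mulf_eq0 pnatr_eq0 (negbTE I0)/=.
by move/eqP.
Qed.

Lemma iota_gradient l f x : iota l (gradient f x) = spartial l f x *: scalar 1.
Proof.
rewrite /gradient iota_sumr (bigD1 l)//= big1 ?addr0 => [|k /negbTE kl].
  by rewrite iotaZ iota_eps_scalar eqxx.
by rewrite iotaZ iota_eps_scalar kl scalarE scale0r scaler0.
Qed.

(** Dual to d^2 = 0: by adjointness the squared norm of the result integrates to the pairing of u
    with d d of something. *)
Lemma divergence_divergence (u : E -> extalg R n) x :
  smooth_section u -> sphere x -> divergence (divergence u) x = 0.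
Proof.
move=> su Sx; have sdu := smooth_section_divergence (smooth_section_form su).
have sddu := smooth_section_divergence (smooth_section_form sdu).
have := smooth_section_form sddu; set w := divergence (divergence u) => sw.
apply: inner_eq0; apply: (sphere_integral_eq0 hmu (smooth_function_inner sw sw) _ _ Sx) => [y _|].
  exact: inner_ge0.
rewrite -ext_d_adjoint// -ext_d_adjoint//; last exact: smooth_section_ext_d.
rewrite -[RHS](sphere_integral0 hmu); apply: eq_sphere_integral => y Sy.
by rewrite ext_d_ext_d// inner0l.
Qed.

Lemma divergenceD (u w : E -> extalg R n) x : smooth_form u -> smooth_form w -> sphere x ->
  divergence (fun y => u y + w y) x = divergence u x + divergence w x.
Proof.
move=> su sw Sx; rewrite /divergence -[\sum_k _]/(contraction _ x) contractionD//.
by rewrite raddfD opprD.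
Qed.

Lemma divergenceN (u : E -> extalg R n) x : smooth_form u -> sphere x ->
  divergence (fun y => - u y) x = - divergence u x.
Proof.
move=> su Sx; rewrite /divergence; congr (- _); rewrite -raddfN -sumrN; congr tangential_part.
by apply: eq_bigr => k _; rewrite dformN// iotaN.
Qed.

Lemma ext_dD (u w : E -> extalg R n) x : smooth_form u -> smooth_form w -> sphere x ->
  ext_d (fun y => u y + w y) x = ext_d u x + ext_d w x.
Proof.
move=> su sw Sx; rewrite !ext_dE -raddfD -big_split /=; congr tangential_part.
by apply: eq_bigr => k _; rewrite dformD// epsD.
Qed.

Lemma ext_dN (u : E -> extalg R n) x : smooth_form u -> sphere x ->
  ext_d (fun y => - u y) x = - ext_d u x.
Proof.
move=> su Sx; rewrite !ext_dE -raddfN -sumrN; congr tangential_part.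
by apply: eq_bigr => k _; rewrite dformN// epsN.
Qed.

Lemma divergence_dual_gradient f x : smooth_function f -> sphere x ->
  divergence (dual_gradient f) x = 0.
Proof.
move=> sf Sx; have sv := smooth_section_volume sf.
have E y : sphere y -> dual_gradient f y = - divergence (fun z => f z *: volume_form z) y.
  by move=> Sy; rewrite divergence_volume// opprK.
rewrite (divergence_eq E Sx) divergenceN//; last first.
  exact/smooth_section_form/smooth_section_divergence/smooth_section_form.
by rewrite divergence_divergence// oppr0.
Qed.

Lemma ext_d_gradient f x : smooth_function f -> sphere x -> ext_d (gradient f) x = 0.
Proof.
move=> sf Sx; rewrite -(ext_d_eq (fun y => @ext_d_function f y sf) Sx) ext_d_ext_d//.
exact/smooth_section_form/smooth_section_function.
Qed.

Lemma tangential_part_top x : tangential_part x (top_form : extalg R n) = 0.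
Proof. by rewrite /tangential_part wedge_top interior0. Qed.

Lemma tangential_part_iota_top k x : tangential_part x (iota k top_form) = x 0 k *: volume_form x :> extalg R n.
Proof. by rewrite /tangential_part wedge_iota wedge_top iota0 subr0 interiorZ. Qed.

Lemma ext_d_volume f x : smooth_function f -> sphere x ->
  ext_d (fun y => f y *: volume_form y) x = 0.
Proof.
move=> sf Sx; rewrite ext_dE raddf_sum big1 //= => k _; have sv := smooth_form_volume.
rewrite dformZ// dform_volume// epsD !epsZ epsB epsZ eps_volume eps_iota eqxx scale1r eps_top iota0 subr0.
have lin (p q r : R) (a : extalg R n) : p *: (a - q *: (q *: a)) + r *: (q *: a) = (p * (1 - q * q) + r * q) *: a.
  by apply/ffunP => I; rewrite !ffunE /GRing.scale/=; ring.
by rewrite lin linearZ /= tangential_part_top scaler0.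
Qed.

Lemma ext_d_dual_gradient f x : smooth_function f -> sphere x ->
  ext_d (dual_gradient f) x = spherical_laplacian f x *: volume_form x.
Proof.
move=> sf Sx; rewrite ext_dE; have sv := smooth_form_volume.
have sdf k := smooth_function_spartial k sf.
have siv k : smooth_form (fun y => iota k (volume_form y) : extalg R n) by exact: smooth_form_iota.
have dE l : dform l (dual_gradient f) x =
    \sum_k (spartial l (spartial k f) x *: iota k (volume_form x)
      + spartial k f x *: iota k (iota l top_form - x 0 l *: volume_form x)).
  rewrite dform_sum//; last by move=> k _; exact: smooth_formZ.
  by apply: eq_bigr => k _; rewrite dformZ// dform_iota// dform_volume// addrC.
under eq_bigr => l _ do rewrite dE eps_sumr.
rewrite exchange_big raddf_sum /=.
(* For a single k a term n x_k d_k f remains; it cancels only in the sum over k, the gradient being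
   tangential. *)
transitivity (\sum_k (spartial k (spartial k f) x *: volume_form x
    - (n%:R * (x 0 k * spartial k f x)) *: volume_form x) : extalg R n); last first.
  by rewrite sumrB -!scaler_suml -mulr_sumr sum_coord_spartial// mulr0 scale0r subr0.
apply: eq_bigr => k _.
transitivity (tangential_part x (\sum_l (spartial l (spartial k f) x *: ((l == k)%:R *: volume_form x)
    - (x 0 l * spartial l (spartial k f) x) *: iota k top_form
    - spartial k f x *: eps l (iota l (iota k top_form))
    - spartial k f x *: (x 0 l *: eps l (iota k (volume_form x)))))).
  congr tangential_part; apply: eq_bigr => l _.
  rewrite epsD !epsZ iotaB epsB iotaZ epsZ eps_iota eps_volume iotaZ (iota_anticomm k l) epsN.
  have lin (p q r : R) (a b c d : extalg R n) :
    p *: (a - r *: b) + q *: (- c - r *: d) = p *: a - (r * p) *: b - q *: c - q *: (r *: d).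
    by apply/ffunP => I; rewrite !ffunE /GRing.scale/=; ring.
  exact: lin.
rewrite !sumrB -scaler_suml -!scaler_sumr sum_coord_spartial// scale0r subr0.
rewrite sum_eps_iota grading_iota grading_top -natr1 scalerDl scale1r addrK iotaZ.
rewrite -wedge_flat_sum !raddfB /= !linearZ /= tangential_part_wedge.
rewrite oppr0 scaler0 addr0 tangential_part_iota_top !scalerN !scalerA; congr (_ - _ *: _); last by ring.
rewrite (bigD1 k)//= eqxx scale1r big1 ?addr0 => [|l /negbTE ->]; last by rewrite scale0r scaler0.
by rewrite linearZ /= tangential_part_id//; exact: tangential_volume.
Qed.

Lemma gradient_eq0 f x : gradient f x = 0 -> forall k, spartial k f x = 0.
Proof.
move=> f0 k; have := iota_gradient k f x; rewrite f0 iota0 -scalarE => /ffunP/(_ finset.set0).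
by rewrite !ffunE eqxx => <-.
Qed.

Lemma wedge_dual_gradient f x : smooth_function f -> sphere x ->
  wedge (flat x) (dual_gradient f x) = - \sum_k spartial k f x *: iota k top_form.
Proof.
move=> sf Sx; rewrite /dual_gradient wedge_sumr.
transitivity (\sum_k ((x 0 k * spartial k f x) *: volume_form x - spartial k f x *: iota k top_form)
    : extalg R n).
  apply: eq_bigr => k _; rewrite wedgeZ wedge_iota wedge_flat_volume// scalerBr scalerA.
  by rewrite (mulrC (x 0 k)).
by rewrite sumrB -scaler_suml sum_coord_spartial// scale0r sub0r.
Qed.

Lemma top_form_neq0 (c : R) : c *: top_form = 0 :> extalg R n -> c = 0.
Proof. by move=> /ffunP/(_ [set: 'I_n.+1]%SET); rewrite extZE !ffunE eqxx mulr1. Qed.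

(** Multiplying by x replaces the volume form by the top form, and [eps l] then reads off the l-th
    coefficient. *)
Lemma dual_gradient_eq0 f x : smooth_function f -> sphere x -> dual_gradient f x = 0 ->
  forall k, spartial k f x = 0.
Proof.
move=> sf Sx f0 l; have := wedge_dual_gradient sf Sx; rewrite f0 wedge0.
move=> /esym/eqP; rewrite oppr_eq0 => /eqP/(congr1 (eps l)); rewrite eps0 eps_sumr.
rewrite (bigD1 l)//= big1 ?addr0 => [|k /negbTE kl].
  by rewrite epsZ eps_iota eqxx eps_top iota0 subr0 scale1r; exact: top_form_neq0.
by rewrite epsZ eps_iota eq_sym kl eps_top iota0 subr0 scale0r scaler0.
Qed.

(** * The potential of a twistor section and the resulting decomposition *)

Section Twistor.
Context (s : E -> extalg R n) (n2 : (1 < n)%N) (ts : twistor_section s).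

Let ss : smooth_form s. Proof. by case: ts => /smooth_section_form. Qed.
Let tans x : sphere x -> tangential x (s x). Proof. by case: ts => -[+ _] _; exact. Qed.

(* This is D s / n, see [twistor_potentialP]; the expression through the partial
   derivatives, unlike the one through orthonormal frames, is visibly smooth. *)
Definition twistor_potential x : extalg R n :=
  n%:R^-1 *: \sum_k clifford_basis k (tangential_part x (dform k s x)).
Local Notation t := twistor_potential.

Lemma nabla_tangent_basis k x : sphere x ->
  nabla (delta_mx 0 k - x 0 k *: x) s x = tangential_part x (dform k s x).
Proof.
move=> Sx; rewrite nablaE//; congr tangential_part.
under eq_bigr => l _ do rewrite !mxE /= scalerBl -scalerA.
rewrite sumrB -scaler_sumr dform_radial// scaler0 subr0.
rewrite (bigD1 k)//= eqxx scale1r big1 ?addr0// => l /negbTE lk.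
by rewrite lk scale0r.
Qed.

Lemma tangent_basis k x : sphere x -> tangent_vector x (delta_mx 0 k - x 0 k *: x).
Proof.
move=> Sx; rewrite /tangent_vector -scaleN1r scalerA mulN1r dotDr dotZr.
move: (Sx); rewrite /sphere/= => ->; rewrite mulr1.
rewrite /dot (bigD1 k)//= big1 ?addr0 => [|j /negbTE jk].
  by rewrite mxE !eqxx mulr1 subrr.
by rewrite mxE jk andbF mulr0.
Qed.

(** The twistor equation is applied to e_k - x_k x. With a = D s / n in some frame, the Clifford
    squares of the n + 1 ambient basis vectors give (n + 1) a and that of x takes one a away, so the
    sum defining the potential is n a. *)
Lemma twistor_potentialP x : sphere x -> tangential x (t x) /\
  forall k, tangential_part x (dform k s x) =
    - (clifford_basis k (t x) - x 0 k *: clifford x (t x)).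
Proof.
move=> Sx; have [e ex] := tangent_frame_exists Sx.
have n0 : n%:R != 0 :> R by rewrite pnatr_eq0 -lt0n ltnW.
pose a := n%:R^-1 *: dirac e s x.
have ax : tangential x a.
  apply/tangentialZ/tangential_sum => i; apply: tangential_clifford; first by have [+ _] := ex; exact.
  exact: tangential_nabla.
have aE : n%:R^-1 *: dirac e s x = a by [].
clearbody a.
have H k : tangential_part x (dform k s x) =
    - (clifford_basis k a - x 0 k *: clifford x a).
  rewrite -nabla_tangent_basis//; have [_ /(_ x e _ Sx ex (tangent_basis k Sx))] := ts.
  rewrite -(cliffordZ _ n%:R^-1) aE => /eqP; rewrite addr_eq0 => /eqP ->; congr (- _).
  rewrite clifford_sum; under eq_bigr => l _ do rewrite !mxE /= scalerBl -scalerA.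
  rewrite sumrB -scaler_sumr -clifford_sum; congr (_ - _).
  rewrite (bigD1 k)//= eqxx scale1r big1 ?addr0// => l /negbTE lk.
  by rewrite lk scale0r.
have cBN k b : clifford_basis k (- b) = - clifford_basis k b.
  by rewrite /clifford_basis epsN iotaN opprB opprK addrC.
have cBB k b c : clifford_basis k (b - c) = clifford_basis k b - clifford_basis k c.
  by rewrite -!clifford_delta cliffordD -[- c]scaleN1r cliffordZ scaleN1r.
have cBZ k (c : R) b : clifford_basis k (c *: b) = c *: clifford_basis k b.
  by rewrite -!clifford_delta cliffordZ.
suff -> : t x = a by [].
rewrite /t; under eq_bigr => k _ do rewrite H cBN cBB clifford_basis_sqr cBZ opprB opprK.
rewrite big_split /= -clifford_sum clifford_clifford sumr_const card_ord.
move: (Sx); rewrite /sphere/= => ->; rewrite scale1r mulrSr addrC addrK -(scaler_nat n a).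
by rewrite scalerA mulVf// scale1r.
Qed.

Lemma smooth_form_potential : smooth_form t.
Proof.
apply: smooth_formZ; first exact: smooth_function_cst.
apply: smooth_form_sum => k _; apply: smooth_formB.
  exact/smooth_form_eps/smooth_form_tangential_part/smooth_form_dform.
exact/smooth_form_iota/smooth_form_tangential_part/smooth_form_dform.
Qed.

(** The normal part of the flat derivative, from differentiating iota_x s = 0. *)
Lemma interior_dform k x : sphere x -> interior x (dform k s x) = - iota k (s x).
Proof.
move=> Sx; have := dform_interior k ss Sx.
have -> : dform k (fun y => interior y (s y)) x = 0.
  by rewrite -(dform_cst k 0 x); apply: dform_eq => // y; exact: tans.
rewrite (tans Sx) scaler0 subr0 => /esym/eqP.
by rewrite addr_eq0 => /eqP.
Qed.

(** The tangential part is given by the twistor equation and the normal part by [interior_dform];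
    together they are the whole flat derivative. *)
Lemma dform_twistor k x : sphere x -> dform k s x =
  - wedge (flat x) (iota k (s x)) - eps k (t x) + x 0 k *: wedge (flat x) (t x) + iota k (t x).
Proof.
move=> Sx; have [tx /(_ k)] := twistor_potentialP Sx.
rewrite tangential_partE// interior_dform// wedgeN opprK => /(canRL (addrK _)) ->.
have lin (b c d e : extalg R n) : - (c - d - e) - b = - b - c + e + d.
  by apply/ffunP => I; rewrite !ffunE; ring.
by rewrite /clifford_basis /clifford (tx : interior x (t x) = 0) subr0 lin.
Qed.

Lemma interior_grading x a : tangential x a -> tangential x (grading a).
Proof.
move=> ax; rewrite /tangential interior_sum.
transitivity (grading (interior x a) + interior x a); last by rewrite ax grading0 addr0.
rewrite !interior_sum (big_morph _ (@gradingD R n) (@grading0 R n)) -big_split /=.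
apply: eq_bigr => k _; rewrite gradingZ grading_iota iotaB scalerBr subrK//.
Qed.

Lemma ext_d_twistor x : sphere x -> ext_d s x = grading (t x).
Proof.
move=> Sx; have [tx _] := twistor_potentialP Sx; rewrite ext_dE.
have -> : \sum_k eps k (dform k s x) = wedge (flat x) (grading (s x)) + grading (t x).
  transitivity (\sum_k (wedge (flat x) (eps k (iota k (s x)))
     + x 0 k *: eps k (wedge (flat x) (t x)) + eps k (iota k (t x)))).
    apply: eq_bigr => k _; rewrite dform_twistor// !epsD !epsN eps_eps epsZ.
    by rewrite eps_wedge_anticomm opprK subr0.
  rewrite !big_split /= -wedge_sumr -wedge_flat_sum wedge_wedge addr0 !sum_eps_iota//.
rewrite raddfD /= tangential_part_wedge add0r tangential_part_id//.
exact: interior_grading.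
Qed.

Lemma sum_iota_dform x : sphere x ->
  \sum_k iota k (dform k s x) = grading (t x) - n%:R *: t x.
Proof.
move=> Sx; have [tx _] := twistor_potentialP Sx.
transitivity (\sum_k (- (x 0 k *: iota k (s x)) - iota k (eps k (t x))
    + x 0 k *: iota k (wedge (flat x) (t x)))).
  apply: eq_bigr => k _; rewrite dform_twistor// !iotaD !iotaN iota_iota addr0 iotaZ.
  by rewrite wedge_iota iotaB iota_iota subr0 iotaZ.
rewrite big_split sumrB sumrN /= -!interior_sum (tans Sx) oppr0 sub0r sum_iota_eps.
rewrite -[interior x _]/(tangential_part x (t x)) tangential_part_id//.
have lin (b c : extalg R n) (p : R) : - ((p + 1) *: b - c) + b = c - p *: b.
  by apply/ffunP => I; rewrite !ffunE /GRing.scale/=; ring.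
by rewrite -natr1 lin.
Qed.

Lemma divergence_twistor x : sphere x -> divergence s x = n%:R *: t x - grading (t x).
Proof.
move=> Sx; have [tx _] := twistor_potentialP Sx.
rewrite /divergence sum_iota_dform// tangential_part_id// ?opprB//.
by rewrite /tangential interiorB interiorZ (interior_grading tx) tx scaler0 subrr.
Qed.

(* With N the degree operator, d s = N t and d^* s = (n - N) t; these are
   orthogonal in L^2 since d^2 = 0, and N (n - N) is positive in the degrees
   strictly between 0 and n. *)
Lemma potential_degree x (I : {set 'I_n.+1}) : sphere x -> #|I| != 0%N -> #|I| != n -> t x I = 0.
Proof.
move=> Sx.
have st := smooth_form_potential.
pose F x := inner (ext_d s x) (divergence s x).
have FE y : sphere y -> F y = \sum_(J : {set 'I_n.+1}) (#|J|%:R * (n%:R - #|J|%:R)) * (t y J * t y J).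
  move=> Sy; rewrite /F ext_d_twistor// divergence_twistor//; apply: eq_bigr => J _.
  by rewrite !ffunE /GRing.scale/=; ring.
have term_ge0 y (J : {set 'I_n.+1}) : sphere y ->
    0 <= (#|J|%:R * (n%:R - #|J|%:R)) * (t y J * t y J).
  move=> Sy; have [tx _] := twistor_potentialP Sy.
  (* In degree n + 1 the weight is negative, but a tangential form has no component there. *)
  have [Jn|Jn] := leqP #|J| n.
    apply: mulr_ge0; last by rewrite -expr2 sqr_ge0.
    by apply: mulr_ge0; rewrite ?ler0n// subr_ge0 ler_nat.
  have -> : J = [set: 'I_n.+1]%SET.
    by apply/eqP; rewrite eqEcard finset.subsetT finset.cardsT card_ord Jn.
  by rewrite (tangential_setT Sy tx) !mulr0.
have sF : smooth_function F.
  apply: smooth_function_inner.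
    exact/smooth_section_form/smooth_section_ext_d.
  exact/smooth_section_form/smooth_section_divergence.
have F0 : SI F = 0.
  have [sss _] := ts.
  rewrite -(ext_d_adjoint (smooth_section_ext_d ss) sss) -[RHS](sphere_integral0 hmu).
  by apply: eq_sphere_integral => y Sy; rewrite ext_d_ext_d// inner0l.
have := sphere_integral_eq0 hmu sF _ F0 Sx; rewrite FE// => H I0 In.
have {}H : \sum_(J : {set 'I_n.+1}) (#|J|%:R * (n%:R - #|J|%:R)) * (t x J * t x J) = 0.
  by apply: H => y Sy; rewrite FE//; apply: sumr_ge0 => J _; exact: term_ge0.
have /(_ I isT)/eqP := psumr_eq0P (fun J _ => term_ge0 x J Sx) H.
rewrite !mulf_eq0 orbb pnatr_eq0 (negbTE I0) subr_eq0 eqr_nat eq_sym (negbTE In)/=.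
by move/eqP.
Qed.

Let n0 : (0 < n)%N. Proof. exact: ltnW. Qed.

Definition potential_scalar x := t x finset.set0.
Definition potential_volume x := wedge (flat x) (t x) [set: 'I_n.+1]%SET.
Local Notation h := potential_scalar.
Local Notation g := potential_volume.

Lemma smooth_potential_scalar : smooth_function h.
Proof. exact: smooth_form_potential. Qed.

Lemma smooth_potential_volume : smooth_function g.
Proof. exact: smooth_form_wedge smooth_form_potential _. Qed.

Lemma potentialE x : sphere x -> t x = scalar (h x) + g x *: volume_form x.
Proof.
move=> Sx; have [tx _] := twistor_potentialP Sx.
by apply: tangential_two_degrees => // I; exact: potential_degree.
Qed.

Lemma grading_potential x : sphere x -> grading (t x) = (n%:R * g x) *: volume_form x.
Proof.
move=> Sx; rewrite potentialE// gradingD grading_scalar add0r gradingZ grading_volume.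
by rewrite scalerA mulrC.
Qed.

Lemma contraction_twistor x : sphere x -> contraction s x = (- (n%:R * h x)) *: scalar 1.
Proof.
move=> Sx; rewrite /contraction sum_iota_dform// grading_potential// (potentialE Sx).
rewrite scalarE; have lin (p q r : R) b c : (p * r) *: c - p *: (q *: b + r *: c) = (- (p * q)) *: b.
  by apply/ffunP => I; rewrite !ffunE /GRing.scale/=; ring.
exact: lin.
Qed.

Lemma dform_twistorE l x : sphere x -> dform l s x =
  h x *: (x 0 l *: wedge (flat x) (scalar 1)) + g x *: iota l (volume_form x)
  - wedge (flat x) (iota l (s x)) - h x *: eps l (scalar 1).
Proof.
move=> Sx; rewrite dform_twistor// (potentialE Sx) wedgeD epsD iotaD epsZ wedgeZ iotaZ.
rewrite eps_volume wedge_flat_volume// iota_scalar add0r (scalarE (h x)) epsZ wedgeZ.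
have lin (p q r : R) (a b c d e : extalg R n) :
    - a - (p *: b + q *: (r *: c)) + r *: (p *: d + q *: c) + e
    = p *: (r *: d) + e - a - p *: b.
  by apply/ffunP => I; rewrite !ffunE /GRing.scale/=; ring.
exact: lin.
Qed.

(* This and [contraction_dform_twistorE] evaluate the same quantity, by commuting
   the two derivatives and by differentiating [dform_twistorE]; comparing them
   gives [iota_residue]. *)
Lemma contraction_dform_twistor l x : sphere x -> contraction (dform l s) x =
  (n%:R * (h x * x 0 l) - n%:R * spartial l h x) *: scalar 1 - iota l (s x).
Proof.
move=> Sx; have sh := smooth_potential_scalar.
have E1 : dform l (contraction s) x = \sum_k iota k (dform l (dform k s) x).
  rewrite /contraction dform_sum//; last first.
    by move=> k _; exact/smooth_form_iota/smooth_form_dform.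
  by apply: eq_bigr => k _; rewrite dform_iota//; exact: smooth_form_dform.
have E2 : dform l (contraction s) x = (- (n%:R * spartial l h x)) *: scalar 1.
  rewrite (dform_eq l contraction_twistor Sx) dformZr//.
    congr (_ *: _); rewrite spartialN//; last by apply: smooth_functionZ.
    by rewrite spartialZ.
  by apply/smooth_functionN/smooth_functionZ.
have lin (a b c : extalg R n) : b - a = c -> a = b - c.
  by move=> <-; rewrite opprB addrC subrK.
(* The commutator contributes iota_x d_l s, which is - iota_l s by [interior_dform]: here s
   reappears without derivatives. *)
transitivity (\sum_k (iota k (dform l (dform k s) x)
   + x 0 k *: iota k (dform l s x) - x 0 l *: iota k (dform k s x))).
  apply: eq_bigr => k _; rewrite (lin _ _ _ (dform_comm k l ss Sx)) !iotaB !iotaZ.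
  by rewrite opprB addrA.
rewrite sumrB big_split /= -E1 E2 -interior_sum interior_dform// -scaler_sumr.
rewrite -[\sum_k iota k _]/(contraction s x) contraction_twistor//.
have lin2 (p q r u : R) (a b : extalg R n) :
  (- (p * u)) *: a - b - r *: ((- (p * q)) *: a) = (p * (q * r) - p * u) *: a - b.
  by apply/ffunP => I; rewrite !ffunE /GRing.scale/=; ring.
exact: lin2.
Qed.

Lemma contraction_dform_twistorE l x : sphere x -> contraction (dform l s) x =
  (n%:R * (h x * x 0 l) - spartial l h x) *: scalar 1
  - iota l (dual_gradient g x) - n%:R *: iota l (s x) + grading (iota l (s x)).
Proof.
move=> Sx; have sh := smooth_potential_scalar; have sg := smooth_potential_volume.
have s1 : smooth_form (fun=> scalar 1 : extalg R n) by exact: smooth_form_cst.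
have sA : smooth_form (fun y => y 0 l *: wedge (flat y) (scalar 1) : extalg R n).
  by apply: smooth_formZ; [exact: smooth_function_coord|exact: smooth_form_wedge].
have sB : smooth_form (fun y => iota l (volume_form y) : extalg R n).
  exact/smooth_form_iota/smooth_form_volume.
have sC : smooth_form (fun y => wedge (flat y) (iota l (s y))).
  exact/smooth_form_wedge/smooth_form_iota.
have sD : smooth_form (fun y => eps l (scalar 1) : extalg R n) by exact: smooth_form_cst.
have shA := smooth_formZ sh sA; have sgB := smooth_formZ sg sB; have shD := smooth_formZ sh sD.
have sAB := smooth_formD shA sgB; have sABC := smooth_formB sAB sC.
rewrite (contraction_eq (dform_twistorE l) Sx) (contractionB sABC shD)// (contractionB sAB sC)//.
rewrite (contractionD shA sgB)// (contractionZ sh sA)// (contractionZ sg sB)// (contractionZ sh sD)//.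
rewrite contraction_coord_wedge// contraction_iota_volume// contraction_eps_scalar.
rewrite (contraction_wedge_iota l ss Sx (tans Sx)) contraction_twistor// iotaZ iota_scalar.
rewrite !scaler0 linear0.
have -> : \sum_k spartial k h x *: iota k (x 0 l *: wedge (flat x) (scalar 1)) = 0 :> extalg R n.
  transitivity ((x 0 l * \sum_k x 0 k * spartial k h x) *: scalar 1 : extalg R n).
    rewrite mulr_sumr scaler_suml; apply: eq_bigr => k _.
    by rewrite iotaZ iota_wedge_scalar !scalerA; congr (_ *: _); ring.
  by rewrite sum_coord_spartial// mulr0 scale0r.
have -> : \sum_k spartial k g x *: iota k (iota l (volume_form x)) = - iota l (dual_gradient g x).
  by rewrite /dual_gradient iota_sumr -sumrN; apply: eq_bigr => k _; rewrite iotaZ iota_anticomm scalerN.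
have -> : \sum_k spartial k h x *: iota k (eps l (scalar 1)) = spartial l h x *: scalar 1 :> extalg R n.
  rewrite (bigD1 l)//= big1 ?addr0 => [|k /negbTE kl]; first by rewrite iota_eps_scalar eqxx.
  by rewrite iota_eps_scalar eq_sym kl scalarE scale0r scaler0.
have lin (p q r u : R) (a b c d : extalg R n) :
  q *: ((p * r) *: a) + 0 + (0 + - b) - (p *: c - d + 0) - (0 + u *: a)
  = (p * (q * r) - u) *: a - b - p *: c + d.
  by apply/ffunP => I; rewrite !ffunE /GRing.scale/=; ring.
exact: lin.
Qed.

Definition residue x : extalg R n := s x - gradient h x + dual_gradient g x.

(** Put a = iota_l s, p = d_l h and d = iota_l ([dual_gradient g]). Equating the two evaluations
    gives N a = (n - 1) (a - p) + d. Since N d = (n - 2) d and N kills scalars, a - p + d is an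
    eigenvector of N for n - 1. *)
Lemma iota_residue l x : sphere x -> grading (iota l (residue x)) = n.-1%:R *: iota l (residue x).
Proof.
move=> Sx.
have n20 : (0 < n.-1)%N by rewrite -ltnS prednK.
have gd : grading (iota l (dual_gradient g x)) = (n%:R - 2) *: iota l (dual_gradient g x).
  have -> : n%:R - 2 = n.-2%:R :> R by rewrite -(prednK n0) -(prednK n20) -!natr1/=; ring.
  apply: grading_interior_nat.
  by rewrite grading_dual_gradient// prednK.
have -> : n.-1%:R = n%:R - 1 :> R by rewrite -[in RHS](prednK n0) -natr1 addrK.
have g1 : grading (scalar 1 : extalg R n) = 0 by exact: grading_scalar.
have ga := etrans (esym (contraction_dform_twistor l Sx)) (contraction_dform_twistorE l Sx).
rewrite /residue iotaD iotaB iota_gradient.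
have lin (c p q : R) (a d o : extalg R n) : grading d = (q - 2) *: d -> grading o = 0 ->
    (c - q * p) *: o - a = (c - p) *: o - d - q *: a + grading a ->
    grading (a - p *: o + d) = (q - 1) *: (a - p *: o + d).
  move=> dE oE /esym/(canRL (addKr _)) aE; rewrite !gradingD -scaleNr gradingZ dE oE scaler0 addr0 aE.
  by apply/ffunP => I; rewrite !ffunE /GRing.scale/=; ring.
exact: (lin _ _ _ _ _ _ gd g1 ga).
Qed.

Definition scalar_residue x := residue x finset.set0.
Definition volume_residue x := wedge (flat x) (residue x) [set: 'I_n.+1]%SET.
Local Notation u0 := scalar_residue.
Local Notation u1 := volume_residue.

Lemma smooth_form_residue : smooth_form residue.
Proof.
apply: smooth_formD; last first.
  exact/smooth_section_form/smooth_section_dual_gradient/smooth_potential_volume.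
by apply: smooth_formB => //; exact/smooth_form_gradient/smooth_potential_scalar.
Qed.

Lemma smooth_scalar_residue : smooth_function u0.
Proof. exact: smooth_form_residue. Qed.

Lemma smooth_volume_residue : smooth_function u1.
Proof. exact: smooth_form_wedge smooth_form_residue _. Qed.

Lemma tangential_residue x : sphere x -> tangential x (residue x).
Proof.
move=> Sx; rewrite /tangential interiorD interiorB tans// interior_dual_gradient.
by rewrite interior_gradient ?subr0 ?addr0//; exact: smooth_potential_scalar.
Qed.

Lemma twistorE x : sphere x ->
  s x = scalar (u0 x) + gradient h x + (- dual_gradient g x) + u1 x *: volume_form x.
Proof.
move=> Sx; have rE : residue x = scalar (u0 x) + u1 x *: volume_form x.
  apply: tangential_two_degrees => //; first exact: tangential_residue.
  by apply: two_degrees_of_iota => // l; exact: iota_residue.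
have lin (a b c d e : extalg R n) : a - b + c = d + e -> a = d + b - c + e.
  move=> H; have -> : d + b - c + e = (d + e) + b - c by apply/ffunP => I; rewrite !ffunE; ring.
  by rewrite -H; apply/ffunP => I; rewrite !ffunE; ring.
exact: lin rE.
Qed.

Lemma twistor_equations x : sphere x ->
  [/\ scalar (- spherical_laplacian h x) - dual_gradient u1 x = scalar (n%:R * h x) &
      gradient u0 x - spherical_laplacian g x *: volume_form x = (n%:R * g x) *: volume_form x].
Proof.
move=> Sx; have sh := smooth_potential_scalar; have sg := smooth_potential_volume.
have s0 := smooth_scalar_residue; have s1 := smooth_volume_residue.
have S0 := smooth_section_form (smooth_section_function s0).
have S1 := smooth_form_gradient sh.
have S2' := smooth_section_form (smooth_section_dual_gradient sg).
have S2 := smooth_formN S2'.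
have S3 := smooth_section_form (smooth_section_volume s1).
have S01 := smooth_formD S0 S1; have S012 := smooth_formD S01 S2.
split.
  have := divergence_twistor Sx; rewrite (divergence_eq twistorE Sx).
  rewrite (divergenceD S012 S3)// (divergenceD S01 S2)// (divergenceD S0 S1)//.
  rewrite divergence_function// divergence_gradient// divergenceN// divergence_dual_gradient//.
  rewrite divergence_volume// oppr0 add0r addr0 => ->.
  rewrite grading_potential// (potentialE Sx).
  by rewrite [scalar (h x)]scalarE [RHS]scalarE scalerDr !scalerA addrK.
have := ext_d_twistor Sx; rewrite (ext_d_eq twistorE Sx).
rewrite (ext_dD S012 S3)// (ext_dD S01 S2)// (ext_dD S0 S1)//.
rewrite ext_d_function// ext_d_gradient// ext_dN// ext_d_dual_gradient// ext_d_volume//.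
by rewrite !addr0 grading_potential.
Qed.

Lemma twistor_conclusion x : sphere x ->
  [/\ spherical_laplacian h x = - (n%:R * h x), spherical_laplacian g x = - (n%:R * g x),
      (forall k, spartial k u0 x = 0) & (forall k, spartial k u1 x = 0)].
Proof.
move=> Sx; have [E1 E2] := twistor_equations Sx.
(* The first equation equates a form of degree n - 1 with a scalar, the second a form of degree 1
   with a multiple of the volume form. As n - 1 != 0 the degrees differ, so both sides vanish. *)
have n10 : n.-1%:R != 0 :> R by rewrite pnatr_eq0 -lt0n -ltnS prednK.
have dual0 : dual_gradient u1 x = 0.
  have : grading (dual_gradient u1 x) = 0.
    move/(canRL (addKr _))/(congr1 -%R): E1; rewrite opprK => ->.
    rewrite !(scalarE (- _)) (scalarE (n%:R * _)) -scaleNr -scalerDl -scalerN gradingZ -scaleN1r gradingZ.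
    by rewrite grading_scalar !scaler0.
  rewrite grading_dual_gradient// => /eqP.
  by rewrite scaler_eq0 (negbTE n10) => /eqP.
have {E2} E2 : gradient u0 x = (n%:R * g x + spherical_laplacian g x) *: volume_form x.
  by rewrite scalerDl -E2 subrK.
have grad0 : gradient u0 x = 0.
  have /eqP := grading_gradient u0 x; rewrite {1}E2 gradingZ grading_volume scalerA mulrC -scalerA -E2.
  rewrite -subr_eq0 -scalerBl scaler_eq0 -[in n%:R](prednK n0) -natr1 addrK (negbTE n10).
  by move/eqP.
split; last 2 first.
- exact: gradient_eq0.
- exact: dual_gradient_eq0 smooth_volume_residue Sx dual0.
- by move: E1; rewrite dual0 subr0 => /scalar_inj <-; rewrite opprK.
move: E2; rewrite grad0 => /esym/(congr1 (wedge (flat x))).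
rewrite wedgeZ wedge_flat_volume// wedge0 => /top_form_neq0/eqP.
by rewrite addrC addr_eq0 => /eqP.
Qed.

Lemma eigenfunctions_of_twistor : exists (c1 c2 : R) f1 f2,
  [/\ smooth_function f1, smooth_function f2,
      (forall x, sphere x -> spherical_laplacian f1 x = - (n%:R * f1 x)),
      (forall x, sphere x -> spherical_laplacian f2 x = - (n%:R * f2 x)) &
      (forall x, sphere x ->
         s x = scalar c1 + gradient f1 x - dual_gradient f2 x + c2 *: volume_form x)].
Proof.
pose p : E := delta_mx 0 0.
have Sp : sphere p.
  rewrite /sphere/= /dot (bigD1 0)//= big1 ?addr0 => [|j /negbTE j0].
    by rewrite mxE !eqxx mulr1.
  by rewrite mxE j0 andbF mul0r.
have conc := twistor_conclusion.
(* The functions u0 and u1 have zero derivatives, so the constants are their values at an arbitrary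
   base point. *)
exists (u0 p), (u1 p), h, g; split=> [||x /conc[]|x /conc[]|x Sx] //.
- exact: smooth_potential_scalar.
- exact: smooth_potential_volume.
rewrite (twistorE Sx) (constant_of_spartial_eq0 (p := x) (q := p) n0 smooth_scalar_residue)//.
  by rewrite (constant_of_spartial_eq0 (p := x) (q := p) n0 smooth_volume_residue)// => k y /conc[].
by move=> k y /conc[].
Qed.

End Twistor.
End Codifferential.
End FormCalculus.

Theorem theoremD (R : realType) (n : nat) (hn : (2 <= n)%N)
    (mu : {measure set (borel_space R n) -> \bar R})
    (hmu : riemannian_measure mu)
    (sigma : 'rV[R]_n.+1 -> extalg R n) :
  twistor_section sigma <->
  exists (c1 c2 : R) (f1 f2 : 'rV[R]_n.+1 -> R),
    [/\ smooth_function f1, smooth_function f2,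
        (forall x, sphere x ->
           hodge_laplacian mu (function_form f1) x =
           function_form (fun y => n%:R * f1 y) x),
        (forall x, sphere x ->
           hodge_laplacian mu (function_form f2) x =
           function_form (fun y => n%:R * f2 y) x) &
        (forall x, sphere x ->
           sigma x = function_form (fun=> c1) x
                     + ext_d (function_form f1) x
                     + codiff mu (hodge_star (function_form f2)) x
                     + hodge_star (function_form (fun=> c2)) x)].
Proof.
split=> [ts|[c1 [c2 [f1 [f2 [sf1 sf2 lf1 lf2 sE]]]]]].
  have [c1 [c2 [f1 [f2 [sf1 sf2 lf1 lf2 sE]]]]] := eigenfunctions_of_twistor hmu hn ts.
  exists c1, c2, f1, f2; split=> //; [exact/(hodge_laplacian_eigen hmu)..|].
  move=> x Sx; rewrite sE// ext_d_function// (codiff_hodge_star hmu)// hodge_star_function//.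
apply: (twistor_of_eigenfunctions hmu (c1 := c1) (c2 := c2) (ltnW hn) sf1 sf2).
- exact/(hodge_laplacian_eigen hmu).
- exact/(hodge_laplacian_eigen hmu).
move=> x Sx; rewrite sE// ext_d_function// (codiff_hodge_star hmu)// hodge_star_function//.
by rewrite scaleN1r.
Qed.
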